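(* Let $A$ be an associative conformal algebra. Then $\big(\bigoplus_{i\ge1}\mathrm{HH}^i(A),\ \sqcup,\ [-,-]\big)$, with the cup product $\sqcup$ and the degree $-1$ bracket $[-,-]$ induced from the Hochschild cochains of $A$, is a Gerstenhaber algebra.
   Context: Base field: $\mathbb C$ denotes a fixed algebraically closed field of characteristic zero; all vector spaces, linear maps and tensor products are over $\mathbb C$. For a vector space $V$, $V[\lambda_1,\dots,\lambda_k]$ is the space of polynomials in $\lambda_1,\dots,\lambda_k$ with coefficients in $V$. All operations are extended coefficientwise to polynomial-valued arguments. Gerstenhaber algebra: a graded commutative associative algebra $(\bigoplus_i\mathcal A^i,\sqcup)$ (so $b\sqcup a=(-1)^{|a||b|}a\sqcup b$; no unit is required) with a bracket $[-,-]:\mathcal A^m\times\mathcal A^n\to\mathcal A^{m+n-1}$ which is a graded Lie bracket with respect to the shifted degree $|a|-1$, i.e. $[a,b]=-(-1)^{(|a|-1)(|b|-1)}[b,a]$ and $[a,[b,c]]=[[a,b],c]+(-1)^{(|a|-1)(|b|-1)}[b,[a,c]]$, and satisfies $[a\sqcup b,c]=[a,c]\sqcup b+(-1)^{(|c|-1)|a|}a\sqcup[b,c]$. Associative conformal algebra: a $\mathbb C[\partial]$-module $A$ with a bilinear map $A\times A\to A[\lambda]$, $(a,b)\mapsto a_{(\lambda)}b$, such that for all $a,b,c\in A$: $(\partial a)_{(\lambda)}b=-\lambda\, a_{(\lambda)}b$, $a_{(\lambda)}(\partial b)=(\partial+\lambda)(a_{(\lambda)}b)$, $(a_{(\lambda)}b)_{(\lambda+\mu)}c=a_{(\lambda)}(b_{(\mu)}c)$.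 If $a_{(\lambda)}b=\sum_k\lambda^kc_k$, then $a_{(-\partial)}b:=\sum_k(-\partial)^kc_k$. Hochschild complex: $\mathcal C^0(A,A)=A/\partial A$, $\mathcal C^1(A,A)=\mathrm{Hom}_{\mathbb C[\partial]}(A,A)$, and for $n\ge2$, $\mathcal C^n(A,A)$ is the space of conformal sesquilinear maps, i.e. linear maps $\varphi:A^{\otimes n}\to A[\lambda_1,\dots,\lambda_{n-1}]$ with $\varphi_{\lambda_1,\dots,\lambda_{n-1}}(a_1,\dots,\partial a_i,\dots,a_n)=-\lambda_i\varphi_{\lambda_1,\dots,\lambda_{n-1}}(a_1,\dots,a_n)$ for $1\le i\le n-1$, and $\varphi_{\lambda_1,\dots,\lambda_{n-1}}(a_1,\dots,a_{n-1},\partial a_n)=(\partial+\lambda_1+\dots+\lambda_{n-1})\varphi_{\lambda_1,\dots,\lambda_{n-1}}(a_1,\dots,a_n)$. Differentials: $d_0(v+\partial A)(a)=a_{(-\partial)}v-v_{(0)}a$, and for $n\ge1$ $$d_n(\varphi)_{\lambda_1,\dots,\lambda_n}(a_1,\dots,a_{n+1})=a_1{}_{(\lambda_1)}\varphi_{\lambda_2,\dots,\lambda_n}(a_2,\dots,a_{n+1})+\sum_{i=1}^n(-1)^i\varphi_{\lambda_1,\dots,\lambda_{i-1},\lambda_i+\lambda_{i+1},\lambda_{i+2},\dots,\lambda_n}(a_1,\dots,a_{i-1},a_i{}_{(\lambda_i)}a_{i+1},a_{i+2},\dots,a_{n+1})+(-1)^{n+1}\varphi_{\lambda_1,\dots,\lambda_{n-1}}(a_1,\dots,a_n)_{(\lambda_1+\dots+\lambda_n)}a_{n+1}.$$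 (In the term $i=n$, where the product is in the last argument, the subscript of $\varphi$ is $\lambda_1,\dots,\lambda_{n-1}$.) One has $d_{n+1}\circ d_n=0$; $\mathrm{HH}^n(A)=\ker d_n/\mathrm{im}\, d_{n-1}$ for $n\ge1$. Bracket: for $f\in\mathcal C^m(A,A)$, $g\in\mathcal C^n(A,A)$, $m,n\ge1$, $0\le i\le m-1$, define $f\bullet_ig\in\mathcal C^{m+n-1}(A,A)$ by $$(f\bullet_ig)_{\lambda_1,\dots,\lambda_{m+n-2}}(a_1,\dots,a_{m+n-1})=f_{\lambda_1,\dots,\lambda_i,\lambda_{i+1}+\dots+\lambda_{i+n},\lambda_{i+n+1},\dots,\lambda_{m+n-2}}\big(a_1,\dots,a_i,g_{\lambda_{i+1},\dots,\lambda_{i+n-1}}(a_{i+1},\dots,a_{i+n}),a_{i+n+1},\dots,a_{m+n-1}\big)$$ (when $i=m-1$, i.e. $g$ is in the last argument, the subscript of $f$ is $\lambda_1,\dots,\lambda_{m-1}$), $f\bullet g=\sum_{i=0}^{m-1}(-1)^{(n-1)i}f\bullet_ig$, and $[f,g]=f\bullet g-(-1)^{(m-1)(n-1)}g\bullet f$. Cup product: for $f\in\mathcal C^m(A,A)$, $g\in\mathcal C^n(A,A)$, $m,n\ge1$, $$(f\sqcup g)_{\lambda_1,\dots,\lambda_{m+n-1}}(a_1,\dots,a_{m+n})=f_{\lambda_1,\dots,\lambda_{m-1}}(a_1,\dots,a_m)_{(\lambda_1+\dots+\lambda_m)}g_{\lambda_{m+1},\dots,\lambda_{m+n-1}}(a_{m+1},\dots,a_{m+n}).$$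 The operations on $\bigoplus_{i\ge1}\mathrm{HH}^i(A)$ are those induced on cohomology classes by applying these formulas to representing cocycles. *)

(* Defs.v *)
From HB Require Import structures.
From mathcomp Require Import all_boot all_algebra ring_quotient.
From mathcomp Require Import boolp functions finmap monalg.

Set Implicit Arguments.
Unset Strict Implicit.
Unset Printing Implicit Defensive.
Import GRing.Theory.
Local Open Scope ring_scope.
Local Open Scope quotient_scope.

(* Variables lambda_1, ..., lambda_k are numbered from 0 to k-1, arguments     *)
(* a_1, ..., a_n from 0 to n-1, and [cmaps A n] is the type of maps with n+1   *)
(* arguments and values in A[lambda_1, ..., lambda_n].                         *)

(* V[lambda_1, ..., lambda_k]: finitely supported families of coefficients in  *)
(* V, indexed by the monomials in k variables. The alias is needed because     *)
(* malg has a scaling only by a ring of coefficients.                          *)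
Definition lpoly (V : zmodType) (k : nat) : Type := {malg V['X_{1..k}]}.

HB.instance Definition _ V k := GRing.Zmodule.on (lpoly V k).

Definition lcoef (V : zmodType) k (p : lpoly V k) (m : 'X_{1..k}) : V := p@_m.

Definition lsupp (V : zmodType) k (p : lpoly V k) : seq 'X_{1..k} :=
  enum_fset (msupp p).

HB.lock Definition lmono (V : zmodType) k (v : V) (m : 'X_{1..k}) : lpoly V k :=
  << v *g m >>.

Definition lconst (V : zmodType) k (v : V) : lpoly V k := lmono v mone.

Definition lamX (V : zmodType) k (i : 'I_k) (p : lpoly V k) : lpoly V k :=
  \sum_(m <- lsupp p) lmono (lcoef p m) (mmul m (ucm i)).

(* Multiplication by the sum of the variables with indices in [lo, hi). Every  *)
(* polynomial substituted for a variable in the cochain operations is such a   *)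
(* sum.                                                                        *)
Definition lamS (V : zmodType) k (lo hi : nat) (p : lpoly V k) : lpoly V k :=
  \sum_(i < k | (lo <= i < hi)%N) lamX i p.

HB.lock Definition lmap (V W : zmodType) k (f : V -> W) (p : lpoly V k) : lpoly W k :=
  [malg m in msupp p => f (lcoef p m)].

(* If p = \sum_m lambda^m p_m, then [leval t e p] is \sum_m t^m (e p_m), where *)
(* the operator t i is substituted for the i-th variable. It is only used with *)
(* commuting operators, so that the order of composition is irrelevant.        *)
Definition leval (V W : zmodType) k (t : 'I_k -> W -> W) (e : V -> W)
    (p : lpoly V k) : W :=
  \sum_(m <- lsupp p)
    foldr (fun i w => iter (m i) (t i) w) (e (lcoef p m)) (enum 'I_k).

(* A linear form is given as the operator of multiplication by it. *)
Definition lsubst (V : zmodType) k l (t : 'I_k -> lpoly V l -> lpoly V l) :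
  lpoly V k -> lpoly V l := leval t (@lconst V l).

(* P_(L) Q: the product mu : (a, b) |-> a_(lambda) b is extended               *)
(* coefficientwise to P and Q, and the form L is substituted for lambda.       *)
Definition lprod (V : zmodType) (mu : V -> V -> lpoly V 1) k
    (L : lpoly V k -> lpoly V k) (P Q : lpoly V k) : lpoly V k :=
  leval (@lamX V k)
    (fun u => leval (@lamX V k) (fun v => lsubst (fun=> L) (mu u v)) Q) P.

Section LpolyLmod.
Variables (R : pzRingType) (V : lmodType R) (k : nat).
Implicit Types p q : lpoly V k.

Lemma lpolyP p q : (forall m, lcoef p m = lcoef q m) <-> p = q.
Proof. exact: malgP. Qed.

Lemma lcoefD p q m : lcoef (p + q) m = lcoef p m + lcoef q m.
Proof. exact: mcoeffD. Qed.

Lemma lcoef_lmono (v : V) m m' : lcoef (lmono v m : lpoly V k) m' = v *+ (m == m').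
Proof. by rewrite unlock; apply: mcoeffU. Qed.

Lemma lcoef_out p m : m \notin lsupp p -> lcoef p m = 0.
Proof. exact: mcoeff_outdom. Qed.

Lemma lcoef_lmap (W : zmodType) (f : V -> W) p m :
  f 0 = 0 -> lcoef (lmap f p) m = f (lcoef p m).
Proof. move=> f0; rewrite unlock; apply: etrans (mcoeffE _ _ _) _; rewrite /lcoef.
by case: msuppP. Qed.

Definition lscale (c : R) p : lpoly V k := lmap (fun v => c *: v) p.

Lemma lcoef_scale c p m : lcoef (lscale c p) m = c *: lcoef p m.
Proof. by rewrite lcoef_lmap ?scaler0. Qed.

Lemma lscaleA c d p : lscale c (lscale d p) = lscale (c * d) p.
Proof. by apply/lpolyP => m; rewrite !lcoef_scale scalerA. Qed.

Lemma lscale1 p : lscale 1 p = p.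
Proof. by apply/lpolyP => m; rewrite lcoef_scale scale1r. Qed.

Lemma lscaleDr : right_distributive lscale +%R.
Proof.
by move=> c p q; apply/lpolyP => m; rewrite !(lcoef_scale, lcoefD) scalerDr.
Qed.

Lemma lscaleDl p : {morph lscale^~ p : c d / c + d}.
Proof.
by move=> c d; apply/lpolyP => m; rewrite !(lcoef_scale, lcoefD) scalerDl.
Qed.

HB.instance Definition _ := GRing.Zmodule_isLmodule.Build R (lpoly V k)
  lscaleA lscale1 lscaleDr lscaleDl.

Lemma lcoefZ c p m : lcoef (c *: p) m = c *: lcoef p m.
Proof. exact: lcoef_scale. Qed.

Lemma lsumE (W : zmodType) (F : 'X_{1..k} -> V -> W) p (s : seq 'X_{1..k}) :
    (forall m, F m 0 = 0) -> uniq s -> {subset (lsupp p) <= s} ->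
  \sum_(m <- lsupp p) F m (lcoef p m) = \sum_(m <- s) F m (lcoef p m).
Proof.
move=> F0 us sub; rewrite [RHS](bigID (mem ((lsupp p)))) /= addrC.
rewrite [X in _ = X + _]big1_seq ?add0r; last first.
  by move=> m /andP[mp _]; rewrite lcoef_out.
rewrite -[in RHS]big_filter; apply: perm_big; apply: uniq_perm.
- exact: fset_uniq.
- exact: filter_uniq.
- by move=> m; rewrite mem_filter andb_idr // => /sub.
Qed.

End LpolyLmod.

Section LpolyLinear.
Variables (R : pzRingType) (V : lmodType R).

Lemma linear_at0 (U W : lmodType R) (f : U -> W) : linear f -> f 0 = 0.
Proof.
move=> fl; have := fl 1 0 0; rewrite !scale1r addr0 => h.
by apply: (addrI (f 0)); rewrite -h addr0.
Qed.

Lemma lsum_linear k (W : lmodType R) (F : 'X_{1..k} -> V -> W) :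
  (forall m, linear (F m)) ->
  linear (fun p : lpoly V k => \sum_(m <- lsupp p) F m (lcoef p m)).
Proof.
move=> Fl c p q /=; have F0 m : F m 0 = 0 by apply: linear_at0.
pose s := undup ((lsupp (c *: p + q)) ++
                 (lsupp p) ++ (lsupp q)).
have us : uniq s by exact: undup_uniq.
rewrite (lsumE (s := s) F0 us); last first.
  by move=> m; rewrite mem_undup !mem_cat => ->.
rewrite (lsumE (s := s) (p := p) F0 us); last first.
  by move=> m; rewrite mem_undup !mem_cat => ->; rewrite !orbT.
rewrite (lsumE (s := s) (p := q) F0 us); last first.
  by move=> m; rewrite mem_undup !mem_cat => ->; rewrite !orbT.
rewrite scaler_sumr -big_split; apply: eq_bigr => m _ /=.
by rewrite lcoefD lcoefZ Fl.
Qed.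

Lemma lmono_linear k (m : 'X_{1..k}) : linear (fun v => lmono v m : lpoly V k).
Proof.
move=> c u v; apply/lpolyP => m'; rewrite lcoefD lcoefZ !lcoef_lmono.
by case: (m == m'); rewrite ?mulr1n // !mulr0n scaler0 addr0.
Qed.

Lemma lconst_linear k : linear (@lconst V k).
Proof. exact: lmono_linear. Qed.

Lemma lmap_linear k (W : lmodType R) (f : V -> W) :
  linear f -> linear (lmap f : lpoly V k -> lpoly W k).
Proof.
move=> fl c p q; apply/lpolyP => m; have f0 := linear_at0 fl.
by rewrite lcoefD lcoefZ !lcoef_lmap // lcoefD lcoefZ fl.
Qed.

Lemma sum_linear (U W : lmodType R) I (r : seq I) (P : pred I) (f : I -> U -> W) :
  (forall i, linear (f i)) -> linear (fun u => \sum_(i <- r | P i) f i u).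
Proof.
move=> fl c u v; rewrite scaler_sumr -big_split.
by apply: eq_bigr => i _; rewrite fl.
Qed.

Lemma lamX_linear k (i : 'I_k) : linear (@lamX V k i).
Proof.
by apply: (lsum_linear (F := fun m v => lmono v (mmul m (ucm i)))) => m;
  apply: lmono_linear.
Qed.

Lemma lamS_linear k lo hi : linear (@lamS V k lo hi).
Proof. by apply: sum_linear => i; apply: lamX_linear. Qed.

Lemma foldr_linear (W : lmodType R) (I : Type) (s : seq I) (n : I -> nat)
    (t : I -> W -> W) :
  (forall i, linear (t i)) ->
  linear (fun w => foldr (fun i w => iter (n i) (t i) w) w s).
Proof.
move=> tl; elim: s => [|i s IHs] c u v //=; rewrite IHs.
by elim: (n i) => //= j ->; rewrite tl.
Qed.

Lemma leval_linear k (W : lmodType R) (t : 'I_k -> W -> W) (e : V -> W) :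
  (forall i, linear (t i)) -> linear e -> linear (leval t e).
Proof.
move=> tl el; apply: (lsum_linear (F := fun m v =>
  foldr (fun i w => iter (m i) (t i) w) (e v) (enum 'I_k))) => m c u v.
by rewrite el (foldr_linear _ _ tl).
Qed.

Lemma leval_linear_e k (X : zmodType) (U W : lmodType R) (t : 'I_k -> W -> W)
    (e : U -> X -> W) p :
  (forall i, linear (t i)) -> (forall v, linear (e^~ v)) ->
  linear (fun u => leval t (e u) p).
Proof.
move=> tl el; apply: sum_linear => m c u v.
by rewrite el (foldr_linear _ _ tl).
Qed.

Lemma lsubst_linear k l (t : 'I_k -> lpoly V l -> lpoly V l) :
  (forall i, linear (t i)) -> linear (lsubst t).
Proof. by move=> tl; apply: leval_linear => //; apply: lconst_linear. Qed.

Section Lprod.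
Variable mu : V -> V -> lpoly V 1.
Hypotheses (mul_l : forall b, linear (mu^~ b)) (mul_r : forall a, linear (mu a)).
Variables (k : nat) (L : lpoly V k -> lpoly V k).
Hypothesis Ll : linear L.

Let Lsub := lsubst_linear (fun=> Ll) : linear (lsubst (fun _ : 'I_1 => L)).

Lemma lprod_linear_r P : linear (lprod mu L P).
Proof.
apply: (leval_linear_e (e := fun Q u => leval (@lamX V k)
  (fun v => lsubst (fun=> L) (mu u v)) Q)) => [i|u]; first exact: lamX_linear.
apply: leval_linear => [i|c v w]; first exact: lamX_linear.
by rewrite mul_r Lsub.
Qed.

Lemma lprod_linear_l Q : linear (lprod mu L ^~ Q).
Proof.
apply: leval_linear => [i|]; first exact: lamX_linear.
apply: (leval_linear_e (e := fun u v => lsubst (fun=> L) (mu u v))) => [i|v c u w].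
  exact: lamX_linear.
by rewrite mul_l Lsub.
Qed.

End Lprod.
End LpolyLinear.

HB.mixin Record isAssocConformal (C : closedFieldType) A of GRing.Lmodule C A := {
  del : {linear A -> A};
  mu : A -> A -> lpoly A 1;
  mu_linear_l : forall b, linear (mu^~ b);
  mu_linear_r : forall a, linear (mu a);
  mu_del_l : forall a b, mu (del a) b = - lamX ord0 (mu a b);
  mu_del_r : forall a b, mu a (del b) = lmap del (mu a b) + lamX ord0 (mu a b);
  mu_assoc : forall a b c,
    lprod mu (lamS 0 2) (lsubst (fun=> lamS 0 1) (mu a b)) (lconst 2 c) =
    lprod mu (lamS 0 1) (lconst 2 a) (lsubst (fun=> lamS 1 2) (mu b c))
}.

#[short(type="assocConformalType")]
HB.structure Definition AssocConformal (C : closedFieldType) :=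
  {A of isAssocConformal C A & GRing.Lmodule C A}.

Section Cochains.
Variables (C : closedFieldType) (A : assocConformalType C).

Definition cmaps (n : nat) : Type := n.+1.-tuple A -> lpoly A n.

HB.instance Definition _ n := GRing.Lmodule.on (cmaps n).

Definition upd n (i : 'I_n) (v : A) (a : n.-tuple A) : n.-tuple A :=
  [tuple if j == i then v else tnth a j | j < n].

(* n consecutive arguments, from position lo on *)
Definition seg N n (a : N.-tuple A) (lo : nat) : n.-tuple A :=
  [tuple nth 0 a (lo + j) | j < n].

(* For n = 0 this says that phi is a C[del]-linear map A -> A. *)
Record is_cochain n (phi : cmaps n) : Prop := {
  cochain_linear : forall i a, linear (fun v => phi (upd i v a));
  cochain_del : forall (i : 'I_n) a,
    phi (upd (widen_ord (leqnSn n) i)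
             (del (tnth a (widen_ord (leqnSn n) i))) a) = - lamX i (phi a);
  cochain_del_last : forall a,
    phi (upd ord_max (del (tnth a ord_max)) a) =
    lmap del (phi a) + \sum_(i < n) lamX i (phi a)
}.

(* f \bullet_i g, meaningful for i <= m and k = m + n. The entry g(...) of f   *)
(* is expanded into its coefficients v. Of the variables of f, those before    *)
(* the i-th are kept, the i-th becomes the sum of n+1 variables, the later     *)
(* ones are shifted by n; if i = m, then f has no i-th variable.               *)
Definition comp_at m n k (i : nat) (f : cmaps m) (g : cmaps n) : cmaps k :=
  fun a => leval (fun j : 'I_n => lamS (i + j) (i + j).+1)
    (fun v => lsubst
      (fun j : 'I_m => if (j < i)%N then lamS j j.+1
        else if j == i :> nat then lamS i (i + n).+1
        else lamS (j + n) (j + n).+1)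
      (f [tuple if (j < i)%N then nth 0 a j
                else if j == i :> nat then v else nth 0 a (j + n) | j < m.+1]))
    (g (seg _ a i)).

#[global] Arguments comp_at {m n} k i f g a.

Definition bullet m n k (f : cmaps m) (g : cmaps n) : cmaps k :=
  \sum_(i < m.+1) (-1) ^+ (n * i) *: comp_at k i f g.

#[global] Arguments bullet {m n} k f g a.

(* meaningful for k = m + n *)
Definition cochain_bracket m n k (f : cmaps m) (g : cmaps n) : cmaps k :=
  bullet k f g - (-1) ^+ (m * n) *: bullet k g f.

#[global] Arguments cochain_bracket {m n} k f g a.

(* meaningful for k = m + n + 1 *)
Definition cochain_cup m n k (f : cmaps m) (g : cmaps n) : cmaps k :=
  fun a => lprod mu (lamS 0 m.+1)
    (lsubst (fun j : 'I_m => lamS j j.+1) (f (seg _ a 0)))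
    (lsubst (fun j : 'I_n => lamS (m.+1 + j) (m.+1 + j).+1) (g (seg _ a m.+1))).

#[global] Arguments cochain_cup {m n} k f g a.

Definition mu_cochain : cmaps 1 :=
  fun a => mu (tnth a ord0) (tnth a ord_max).

(* d_0 (v + del A) *)
Definition diff0 (v : A) : cmaps 0 :=
  fun a => lconst 0 (leval (fun=> fun w => - del w) id (mu (tnth a ord0) v)
                     - lcoef (mu v (tnth a ord0)) mone).

(* d_{n+1}. The inner terms insert the products of consecutive arguments into  *)
(* phi, with the same substitution of variables as in [comp_at].               *)
Definition diff n (phi : cmaps n) : cmaps n.+1 :=
  fun a =>
    lprod mu (lamS 0 1) (lconst _ (nth 0 a 0))
      (lsubst (fun j : 'I_n => lamS j.+1 j.+2) (phi (seg _ a 1)))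
    + \sum_(i < n.+1) (-1) ^+ i.+1 *: comp_at n.+1 i phi mu_cochain a
    + (-1) ^+ n.+2 *:
      lprod mu (lamS 0 n.+1)
        (lsubst (fun j : 'I_n => lamS j j.+1) (phi (seg _ a 0)))
        (lconst _ (nth 0 a n.+1)).

Lemma cmapsE n c (f g : cmaps n) a : (c *: f + g) a = c *: f a + g a.
Proof. by []. Qed.

Lemma is_cochain0 n : is_cochain (0 : cmaps n).
Proof.
have lX i : lamX i (0 : lpoly A n) = 0 by apply: linear_at0 (@lamX_linear _ _ _ i).
split=> [i a c u v|i a|a].
- by rewrite [LHS]/0 /= [RHS](_ : _ = c *: 0 + 0) // scaler0 addr0.
- by rewrite /= [RHS](congr1 -%R (lX i)) oppr0.
- rewrite big1 ?addr0; last by move=> i _; apply: lX.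
  by rewrite [RHS](linear_at0 (lmap_linear (@linearP _ _ _ _ _))).
Qed.

Lemma is_cochainP n c (f g : cmaps n) :
  is_cochain f -> is_cochain g -> is_cochain (c *: f + g).
Proof.
move=> [fl fd fe] [gl gd ge]; split=> [i a d u v|i a|a]; rewrite !cmapsE.
- rewrite fl gl !scalerDr !scalerA [c * d]mulrC addrACA -!scalerA.
  by rewrite -scalerDr.
- by rewrite fd gd lamX_linear opprD scalerN.
- rewrite fe ge (lmap_linear (@linearP _ _ _ _ _)).
  rewrite (sum_linear _ _ (fun i : 'I_n => @lamX_linear _ A n i)).
  by rewrite scalerDr addrACA.
Qed.

Lemma comp_at_linear m n k i (g : cmaps n) :
  linear (fun f : cmaps m => comp_at k i f g).
Proof.
move=> c f h; apply/funext => a; rewrite cmapsE /comp_at.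
pose e (f : cmaps m) v := lsubst
      (fun j : 'I_m => if (j < i)%N then @lamS A k j j.+1
        else if j == i :> nat then lamS i (i + n).+1
        else lamS (j + n) (j + n).+1)
      (f [tuple if (j < i)%N then nth 0 a j
                else if j == i :> nat then v else nth 0 a (j + n) | j < m.+1]).
apply: (leval_linear_e (e := e)) => [j|v d u w]; first exact: lamS_linear.
by apply: lsubst_linear => j; do 2?case: ifP => _; apply: lamS_linear.
Qed.

Lemma diff_linear n : linear (@diff n).
Proof.
move=> c f g; apply/funext => a; rewrite cmapsE /diff !cmapsE.
have sl (s : 'I_n -> nat) :
    linear (lsubst (fun j : 'I_n => @lamS A n.+1 (s j) (s j).+1)).
  by apply: lsubst_linear => j; apply: lamS_linear.
rewrite !sl (lprod_linear_r (@mu_linear_r _ A) (@lamS_linear _ A _ _ _)).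
rewrite (lprod_linear_l (@mu_linear_l _ A) (@lamS_linear _ A _ _ _)).
rewrite (eq_bigr (fun i : 'I_n.+1 =>
  c *: ((-1) ^+ i.+1 *: comp_at n.+1 i f mu_cochain a) +
  (-1) ^+ i.+1 *: comp_at n.+1 i g mu_cochain a)); last first.
  move=> i _; rewrite comp_at_linear cmapsE scalerDr !scalerA.
  by rewrite [c * _]mulrC.
rewrite big_split /= -scaler_sumr.
have combine (x x' y y' z z' : lpoly A n.+1) s :
    c *: x + x' + (c *: y + y') + s *: (c *: z + z') =
    c *: (x + y + s *: z) + (x' + y' + s *: z').
  rewrite !scalerDr !scalerA [s * c]mulrC.
  by rewrite (addrACA _ x') (addrACA (_ + _) (x' + y')).
exact: combine.
Qed.

Lemma diff0_linear : linear diff0.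
Proof.
have dl : linear (fun w : A => - del w).
  by move=> c u v; rewrite linearP opprD scalerN.
have ll : linear (leval (fun _ : 'I_1 => fun w : A => - del w) (@id A)).
  exact: leval_linear.
move=> c u v; apply/funext => a; rewrite cmapsE /diff0 -lconst_linear.
congr lconst; rewrite mu_linear_r mu_linear_l ll [lcoef (_ + _) _]lcoefD.
by rewrite [lcoef (_ *: _) _]lcoefZ scalerBr opprD addrACA.
Qed.

(* ker d_{n+1} *)
Definition cocycle n : {pred cmaps n} :=
  fun phi => `[< is_cochain phi /\ diff phi = 0 >].

Lemma cocycle_submod n : submod_closed (@cocycle n).
Proof.
split=> [|c f g /asboolP[fc df] /asboolP[gc dg]]; apply/asboolP; split.
- exact: is_cochain0.
- exact: linear_at0 (@diff_linear n).
- exact: is_cochainP.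
- by rewrite diff_linear df dg scaler0 addr0.
Qed.

HB.instance Definition _ n :=
  GRing.isSubmodClosed.Build C (cmaps n) (@cocycle n) (cocycle_submod n).

Record cocycles n := Cocycle { cocycle_val : cmaps n; _ : cocycle_val \in @cocycle n }.

HB.instance Definition _ n := [isSub for @cocycle_val n].
HB.instance Definition _ n := [Choice of cocycles n by <:].
HB.instance Definition _ n := [SubChoice_isSubLmodule of cocycles n by <:].

(* im d_n *)
Definition is_coboundary n : cmaps n -> Prop :=
  match n with
  | 0 => fun phi => exists v : A, phi = diff0 v
  | n'.+1 => fun phi => exists psi : cmaps n', is_cochain psi /\ phi = diff psi
  end.

Definition coboundary n : {pred cocycles n} :=
  fun z => `[< is_coboundary (val z) >].

Lemma is_coboundary0 n : is_coboundary (0 : cmaps n).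
Proof.
case: n => [|n] /=; first by exists 0; rewrite (linear_at0 diff0_linear).
by exists 0; split; [exact: is_cochain0 | rewrite (linear_at0 (@diff_linear n))].
Qed.

Lemma is_coboundaryP n c (f g : cmaps n) :
  is_coboundary f -> is_coboundary g -> is_coboundary (c *: f + g).
Proof.
case: n f g => [|n] f g /=.
  by move=> [u ->] [v ->]; exists (c *: u + v); rewrite diff0_linear.
move=> [f' [fc ->]] [g' [gc ->]]; exists (c *: f' + g').
by split; [exact: is_cochainP | rewrite diff_linear].
Qed.

Lemma val_cocyclesP n c (z w : cocycles n) :
  val (c *: z + w) = c *: val z + val w.
Proof. exact: linearP. Qed.

Lemma val_cocycles0 n : val (0 : cocycles n) = 0.
Proof. exact: raddf0. Qed.

Lemma coboundary_submod n : submod_closed (@coboundary n).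
Proof.
split=> [|c z w /asboolP hz /asboolP hw]; apply/asboolP.
  by rewrite val_cocycles0; apply: is_coboundary0.
by rewrite val_cocyclesP; apply: is_coboundaryP.
Qed.

HB.instance Definition _ n :=
  GRing.isSubmodClosed.Build C (cocycles n) (@coboundary n) (coboundary_submod n).

(* HH^{n+1}(A) *)
Definition HH n : Type := Quotient.quot (@coboundary n).

HB.instance Definition _ n := GRing.Zmodule.on (HH n).

Definition HHclass n (z : cocycles n) : HH n := \pi_(Quotient.quot (@coboundary n)) z.

Lemma HHclassP n (z w : cocycles n) :
  HHclass z = HHclass w <-> is_coboundary (val z - val w).
Proof.
have E : (HHclass z == HHclass w) = (z - w \in @coboundary n).
  by rewrite Quotient.idealrBE.
split=> [/eqP|h].
  by rewrite E => /asboolP; rewrite raddfB.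
by apply/eqP; rewrite E; apply/asboolP; rewrite raddfB.
Qed.

Lemma HHclassD n (z w : cocycles n) : HHclass (z + w) = HHclass z + HHclass w.
Proof. exact: raddfD. Qed.

Definition HHscale n (c : C) (x : HH n) : HH n := HHclass (c *: repr x).

Lemma HHclassZ n c (z : cocycles n) : HHclass (c *: z) = HHscale c (HHclass z).
Proof.
apply/HHclassP; rewrite -raddfB -scalerBr; apply/asboolP.
rewrite -[X in is_true X]/(c *: (z - repr (HHclass z)) \in @coboundary n).
by rewrite rpredZ // Quotient.idealrBE reprK.
Qed.

Lemma HHclass_surj n (x : HH n) : exists z, x = HHclass z.
Proof. by exists (repr x); rewrite /HHclass reprK. Qed.

Fact HHscaleA n c d (x : HH n) : HHscale c (HHscale d x) = HHscale (c * d) x.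
Proof. by have [z ->] := HHclass_surj x; rewrite -!HHclassZ scalerA. Qed.

Fact HHscale1 n (x : HH n) : HHscale 1 x = x.
Proof. by have [z ->] := HHclass_surj x; rewrite -HHclassZ scale1r. Qed.

Fact HHscaleDr n : right_distributive (@HHscale n) +%R.
Proof.
move=> c x y; have [z ->] := HHclass_surj x; have [w ->] := HHclass_surj y.
by rewrite -HHclassD -!HHclassZ scalerDr HHclassD.
Qed.

Fact HHscaleDl n (x : HH n) : {morph (@HHscale n)^~ x : c d / c + d}.
Proof.
move=> c d; have [z ->] := HHclass_surj x.
by rewrite -!HHclassZ scalerDl HHclassD.
Qed.

HB.instance Definition _ n := GRing.Zmodule_isLmodule.Build C (HH n)
  (@HHscaleA n) (@HHscale1 n) (@HHscaleDr n) (@HHscaleDl n).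

End Cochains.

Arguments HH {C} A n.

Section Gerstenhaber.
Variables (K : fieldType) (H : nat -> lmodType K).

(* H i is the component of degree i+1 of a positively graded vector space. The *)
(* degree of a product is given by an equation between natural numbers, which  *)
(* has at most one proof, instead of being computed in the type.               *)
Definition cup_op := forall i j k, (i.+1 + j.+1 = k.+1)%N -> H i -> H j -> H k.
Definition bracket_op :=
  forall i j k, (i.+1 + j.+1 = k.+2)%N -> H i -> H j -> H k.

(* For a in H i, |a| = i+1 and |a| - 1 = i. *)
Record is_gerstenhaber (cup : cup_op) (br : bracket_op) : Prop := {
  cup_linear_l : forall i j k (e : (i.+1 + j.+1 = k.+1)%N) b,
    linear (fun a => cup _ _ _ e a b);
  cup_linear_r : forall i j k (e : (i.+1 + j.+1 = k.+1)%N) a,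
    linear (cup _ _ _ e a);
  br_linear_l : forall i j k (e : (i.+1 + j.+1 = k.+2)%N) b,
    linear (fun a => br _ _ _ e a b);
  br_linear_r : forall i j k (e : (i.+1 + j.+1 = k.+2)%N) a,
    linear (br _ _ _ e a);
  cup_assoc : forall i j l ij jl k
      (e1 : (i.+1 + j.+1 = ij.+1)%N) (e2 : (ij.+1 + l.+1 = k.+1)%N)
      (e3 : (j.+1 + l.+1 = jl.+1)%N) (e4 : (i.+1 + jl.+1 = k.+1)%N) a b c,
    cup _ _ _ e2 (cup _ _ _ e1 a b) c = cup _ _ _ e4 a (cup _ _ _ e3 b c);
  cup_comm : forall i j k
      (e : (i.+1 + j.+1 = k.+1)%N) (e' : (j.+1 + i.+1 = k.+1)%N) a b,
    cup _ _ _ e' b a = (-1) ^+ (i.+1 * j.+1) *: cup _ _ _ e a b;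
  br_antisym : forall i j k
      (e : (i.+1 + j.+1 = k.+2)%N) (e' : (j.+1 + i.+1 = k.+2)%N) a b,
    br _ _ _ e a b = - ((-1) ^+ (i * j) *: br _ _ _ e' b a);
  br_jacobi : forall i j l ij jl il k
      (e1 : (j.+1 + l.+1 = jl.+2)%N) (e2 : (i.+1 + jl.+1 = k.+2)%N)
      (e3 : (i.+1 + j.+1 = ij.+2)%N) (e4 : (ij.+1 + l.+1 = k.+2)%N)
      (e5 : (i.+1 + l.+1 = il.+2)%N) (e6 : (j.+1 + il.+1 = k.+2)%N) a b c,
    br _ _ _ e2 a (br _ _ _ e1 b c) =
    br _ _ _ e4 (br _ _ _ e3 a b) c +
    (-1) ^+ (i * j) *: br _ _ _ e6 b (br _ _ _ e5 a c);
  br_cup : forall i j l ij il jl k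
      (e1 : (i.+1 + j.+1 = ij.+1)%N) (e2 : (ij.+1 + l.+1 = k.+2)%N)
      (e3 : (i.+1 + l.+1 = il.+2)%N) (e4 : (il.+1 + j.+1 = k.+1)%N)
      (e5 : (j.+1 + l.+1 = jl.+2)%N) (e6 : (i.+1 + jl.+1 = k.+1)%N) a b c,
    br _ _ _ e2 (cup _ _ _ e1 a b) c =
    cup _ _ _ e4 (br _ _ _ e3 a c) b +
    (-1) ^+ (l * i.+1) *: cup _ _ _ e6 a (br _ _ _ e5 b c)
}.

End Gerstenhaber.

Section Induced.
Variables (C : closedFieldType) (A : assocConformalType C).

(* The operation on cohomology sends the classes of any two cocycles to the    *)
(* class of the result of the cochain operation, which is again a cocycle.     *)
Definition is_induced_cup (cup : cup_op (HH A)) : Prop :=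
  forall i j k (e : (i.+1 + j.+1 = k.+1)%N) (f : cocycles A i) (g : cocycles A j),
  exists h : cocycles A k, val h = cochain_cup k (val f) (val g) /\
    cup _ _ _ e (HHclass f) (HHclass g) = HHclass h.

Definition is_induced_bracket (br : bracket_op (HH A)) : Prop :=
  forall i j k (e : (i.+1 + j.+1 = k.+2)%N) (f : cocycles A i) (g : cocycles A j),
  exists h : cocycles A k, val h = cochain_bracket k (val f) (val g) /\
    br _ _ _ e (HHclass f) (HHclass g) = HHclass h.

End Induced.

(* Main.v *)
(* A cochain f is studied through its values on words. A word is a sequence of *)
(* letters (lambda, a), with lambda a scalar, except for one letter whose      *)
(* variable is replaced by -del minus the sum of the other scalars. If g is    *)
(* applied to a subword, then its value together with the sum of the scalars   *)
(* of the subword is again a letter, so that f \bullet_i g becomes a plain     *)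
(* substitution of functions. These values determine f, the field being        *)
(* infinite, and hence the cochains form a nonsymmetric operad, including the  *)
(* elements of A as operations of arity 0, with mu as a multiplication.        *)
(* The Gerstenhaber identities then hold in any operad with a multiplication:  *)
(* d is -[-, mu], f \cup g is up to sign the brace mu{f,g}, the pre-Lie        *)
(* identity gives the Jacobi identity and the homotopy f \bullet g for         *)
(* commutativity, and the expansion of x{y}{f,g} - x{f,g}{y} for x and y equal *)
(* to mu and h gives the Leibniz rule and the homotopy h{f,g} for the          *)
(* Poisson identity.                                                           *)
Require Import Defs.
From mathcomp Require Import all_boot all_algebra.
From mathcomp Require Import boolp functions finmap monalg.
From mathcomp Require Import zify ring.
Set Implicit Arguments.
Unset Strict Implicit.
Unset Printing Implicit Defensive.
Import GRing.Theory.
Local Open Scope ring_scope.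

(** For an ordinary associative algebra the Gerstenhaber identities are formal: Hochschild cochains
    form a nonsymmetric operad, the product is an element [M] of arity 2, and associativity says M•M
    = 0. The proof carries this argument over to conformal algebras.

    Formal part. In an [odd_operad], [prelie] computes the associator of • as f{g,h} ± f{h,g}; its
    symmetry in g and h gives [jacobi]. The differential is bracketing with [M], so Jacobi also
    shows that brackets respect cocycles and coboundaries ([ebr_dd], [ebr_boundary]). The identity
    [brace2_bul], comparing x{y}{f,g} with x{f,g}{y}, is the source of everything about the cup
    product: for x = y = M it is the Leibniz rule [dd_ecup], and its instances (h, M) and (M, h)
    together give [poisson] up to the coboundary of h{f,g}. Commutativity ([ecup_comm]) holds up to
    the coboundary of f•g, associativity ([ecup_assoc]) strictly.

    Conformal part. A cochain has one variable fewer than arguments, which makes direct substitution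
    asymmetric. On words all arguments have a variable, the variables adding up to -del, and
    composition becomes substitution of functions; its axioms are [wcomp_seq] and [wcomp_par]. A
    polynomial is determined by its values at scalar points, so nothing is lost ([real_inj]). The
    dictionary consists of [real_comp_at], [real_diff], [real_diff0], [real_bracket] and [real_cup].
    Elements of [A] serve as operations of arity 0, so that coboundaries in degree 1 are treated
    like all others. *)

(** * Deciding identities in abelian groups *)

Section ZmodTactic.
Variable V : zmodType.

Inductive zexpr := ZVar of nat | ZZero | ZOpp of zexpr | ZAdd of zexpr & zexpr.

Fixpoint zeval (env : seq V) e : V :=
  match e with
  | ZVar i => env`_i
  | ZZero => 0
  | ZOpp e => - zeval env e
  | ZAdd e1 e2 => zeval env e1 + zeval env e2
  end.

Fixpoint zcoef e (i : nat) : int :=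
  match e with
  | ZVar j => (i == j)%:R
  | ZZero => 0
  | ZOpp e => - zcoef e i
  | ZAdd e1 e2 => zcoef e1 i + zcoef e2 i
  end.

Lemma zevalE env e : zeval env e = \sum_(i < size env) env`_i *~ zcoef e i.
Proof.
elim: e => [j||e IH|e1 IH1 e2 IH2] /=.
- case: (ltnP j (size env)) => hj; last first.
    rewrite nth_default // big1 // => i _.
    by rewrite (ltn_eqF (leq_trans (ltn_ord i) hj)).
  rewrite (bigD1 (Ordinal hj)) //= eqxx mulr1z big1 ?addr0 // => i /negPf.
  by rewrite -val_eqE /= => ->.
- by rewrite big1 // => i _.
- by rewrite IH -sumrN; apply: eq_bigr => i _; rewrite mulrNz.
- by rewrite IH1 IH2 -big_split; apply: eq_bigr => i _; rewrite mulrzDr.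
Qed.

(** Soundness of the tactic [zmod]: by [zevalE] a value depends only on the integer coefficients at
    the atoms, and these are compared by computation. *)
Lemma zeval_eq env e1 e2 :
  all (fun i => zcoef e1 i == zcoef e2 i) (iota 0 (size env)) ->
  zeval env e1 = zeval env e2.
Proof.
move=> /allP h; rewrite !zevalE; apply: eq_bigr => i _.
by rewrite (eqP (h i _)) // mem_iota /= add0n.
Qed.

End ZmodTactic.

Ltac zindex x env :=
  lazymatch env with
  | x :: _ => constr:(0%N)
  | _ :: ?r => let n := zindex x r in constr:(n.+1)
  end.

Ltac zadd x env :=
  lazymatch env with
  | context [x :: _] => env
  | _ => constr:(x :: env)
  end.

Ltac zatoms t env :=
  lazymatch t with
  | GRing.zero => env
  | 0%R => env
  | (- ?a)%R => zatoms a env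
  | (?a + ?b)%R => let e := zatoms a env in zatoms b e
  | _ => zadd t env
  end.

Ltac zreify t env :=
  lazymatch t with
  | 0%R => constr:(ZZero)
  | (- ?a)%R => let e := zreify a env in constr:(ZOpp e)
  | (?a + ?b)%R =>
      let e1 := zreify a env in let e2 := zreify b env in constr:(ZAdd e1 e2)
  | _ => let n := zindex t env in constr:(ZVar n)
  end.

Ltac zmod :=
  lazymatch goal with
  | |- @eq ?T ?a ?b =>
    let env := zatoms a (@nil T) in
    let env := zatoms b env in
    let e1 := zreify a env in
    let e2 := zreify b env in
    apply: (@zeval_eq _ env e1 e2); vm_compute; reflexivity
  end.

(** * Signs, and sums over the slots of a composite *)

(** With exponents reduced to booleans, every sign identity is a finite case analysis on
    parities. *)
Definition sg (V : zmodType) (b : bool) (x : V) : V := if b then - x else x.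

Section Sg.
Variable V : zmodType.
Implicit Types x y : V.

Lemma sgD b x y : sg b (x + y) = sg b x + sg b y.
Proof. by case: b => //=; rewrite opprD. Qed.

Lemma sg0 b : sg b 0 = 0 :> V.
Proof. by case: b => //=; rewrite oppr0. Qed.

Lemma sg_sum b I r (P : pred I) (F : I -> V) :
  sg b (\sum_(i <- r | P i) F i) = \sum_(i <- r | P i) sg b (F i).
Proof. by case: b => //=; rewrite sumrN. Qed.

Lemma sgK b : involutive (@sg V b).
Proof. by move=> x; case: b => //=; rewrite opprK. Qed.

Lemma sgg b b' x : sg b (sg b' x) = sg (b (+) b') x.
Proof. by case: b b' => [] [] //=; rewrite opprK. Qed.

End Sg.

Section Sums.
Variable V : zmodType.

(** After an insertion of arity [n] in slot [i], the slots are those before [i], those of the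
    inserted operation, and the later ones moved by n - 1. The predecessor is taken after adding
    [n], which covers n = 0. *)
Lemma sum_block (E : nat -> V) k i m n : (i < m)%N -> k.+1 = (m + n)%N ->
  \sum_(0 <= j < k) E j = \sum_(0 <= j < i) E j
    + \sum_(0 <= j < n) E (i + j)%N + \sum_(i.+1 <= j < m) E (j + n).-1.
Proof.
move=> im e; rewrite (@big_cat_nat _ _ _ (i + n)%N) //=; [|lia..].
rewrite (@big_cat_nat _ _ _ i) //=; [|lia].
congr (_ + _ + _).
  by rewrite -{1}[i]add0n big_addn addKn; apply: eq_bigr => j _; rewrite addnC.
case: n e => [|n] e.
  rewrite addn0; have -> : k = m.-1 by lia.
  case: m im {e} => // m _; rewrite -[i.+1]addn1 big_addn subn1 /=.
  by apply: eq_bigr => j _; congr E; lia.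
have -> : k = (m + n)%N by lia.
rewrite [(i + n.+1)%N](_ : _ = i.+1 + n)%N; [|lia].
rewrite big_addn addnK; apply: eq_bigr => j _; congr E; lia.
Qed.

Lemma sum_triangle (E : nat -> nat -> V) n :
  \sum_(0 <= j < n) \sum_(0 <= i < j) E i j =
  \sum_(0 <= i < n) \sum_(i.+1 <= j < n) E i j.
Proof.
elim: n => [|n IH]; first by rewrite !big_geq.
rewrite big_nat_recr //= IH [RHS]big_nat_recr //=.
rewrite [X in _ = _ + X]big_geq // addr0 -big_split /=.
by apply: eq_big_nat => i /andP[_ hi]; rewrite big_nat_recr.
Qed.

(** The six sums are the six possible positions of a pair i < j with respect to the block of [b]
    slots starting at [k]. *)
Lemma sum_triangle_block (E : nat -> nat -> V) k a b ab :
  (k < a)%N -> ab.+1 = (a + b)%N ->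
  \sum_(0 <= j < ab) \sum_(0 <= i < j) E i j =
  \sum_(0 <= j < k) \sum_(0 <= i < j) E i j
  + \sum_(0 <= j < b) \sum_(0 <= i < k) E i (k + j)%N
  + \sum_(0 <= j < b) \sum_(0 <= i < j) E (k + i)%N (k + j)%N
  + \sum_(k.+1 <= j < a) \sum_(0 <= i < k) E i (j + b).-1
  + \sum_(k.+1 <= j < a) \sum_(0 <= i < b) E (k + i)%N (j + b).-1
  + \sum_(k.+1 <= j < a) \sum_(k.+1 <= i < j) E (i + b).-1 (j + b).-1.
Proof.
move=> ka eab; rewrite (sum_block _ ka eab).
have -> : \sum_(0 <= j < b) \sum_(0 <= i < k + j) E i (k + j)%N =
    \sum_(0 <= j < b) \sum_(0 <= i < k) E i (k + j)%N
    + \sum_(0 <= j < b) \sum_(0 <= i < j) E (k + i)%N (k + j)%N.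
  rewrite -big_split /=; apply: eq_bigr => j _.
  rewrite (@big_cat_nat _ _ _ k) //= ?leq_addr //; congr (_ + _).
  by rewrite -{1}[k]add0n big_addn addKn; apply: eq_bigr => i _; rewrite addnC.
rewrite -!addrA; do 3!congr (_ + _); rewrite -!big_split /=.
apply: eq_big_nat => j /andP[kj _].
by rewrite (sum_block _ kj (n := b)) ?addrA //; lia.
Qed.

Lemma sum_shift (F : nat -> V) j a m : (0 < j)%N ->
  \sum_((j + m).-1.+1 <= k < (a + m).-1) F k =
  \sum_(j.+1 <= k < a) F (k + m).-1.
Proof.
move=> j0; case: m => [|m].
  case: a => [|a]; first by rewrite !big_geq.
  rewrite [RHS]big_add1 /= !addn0 prednK //.
  by apply: eq_bigr => k _; rewrite addn0.
rewrite !addnS /= -addSn big_addn addnK.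
by apply: eq_bigr => k _; rewrite addnS.
Qed.

End Sums.

(* The sign (-1)^((n-1) i) of the i-th term of the Gerstenhaber composition is *)
(* absorbed in the partial compositions c n i, with n the arity of the         *)
(* inserted element. As a result the sequential law has no sign. The         *)
(* parallel law excludes n = p = 0, where it only holds modulo del A.        *)
Record odd_operad (P : zmodType) (ar : nat -> P -> Prop)
    (c : nat -> nat -> P -> P -> P) : Prop := OddOperad {
  arB : forall n f g, ar n f -> ar n g -> ar n (f - g);
  ar0 : forall n, ar n 0;
  ar_c : forall m n k i f g, (i < m)%N -> k.+1 = (m + n)%N ->
    ar m f -> ar n g -> ar k (c n i f g);
  cBl : forall n i f g h, c n i (f - g) h = c n i f h - c n i g h;
  cBr : forall m n i f g h, ar m h -> c n i h (f - g) = c n i h f - c n i h g;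
  c_seq : forall m n p k i j f g h, ar m f -> ar n g -> ar p h ->
    (i < m)%N -> (j < n)%N -> k.+1 = (n + p)%N ->
    c p (i + j)%N (c n i f g) h = c k i f (c p j g h);
  c_par : forall m n p i j f g h, ar m f -> ar n g -> ar p h ->
    (i < j < m)%N -> (0 < n + p)%N ->
    c p (j + n).-1 (c n i f g) h = sg (~~ odd n && ~~ odd p) (c n i (c p j f h) g)
}.

(** * Gerstenhaber composition and braces in an operad *)

Section OddOperad.
Variables (P : zmodType) (ar : nat -> P -> Prop) (c : nat -> nat -> P -> P -> P).
Hypothesis O : odd_operad ar c.
Implicit Types f g h x y : P.

Definition bul m n f g := \sum_(0 <= i < m) c n i f g.

(** The brace x{f,g}: [f] is to the left of [g], and its insertion has moved slot [j] to
    [(j + m).-1]. The usual brace signs are inside [c]. *)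
Definition brace2 a m n x f g :=
  \sum_(0 <= j < a) \sum_(0 <= i < j) c n (j + m).-1 (c m i x f) g.

Definition ebr m n f g := bul m n f g - sg (~~ odd m && ~~ odd n) (bul n m g f).

Lemma c0l n i h : c n i 0 h = 0.
Proof. by rewrite -[X in c n i X h](subrr 0) (cBl O) subrr. Qed.

Lemma cNl n i f h : c n i (- f) h = - c n i f h.
Proof. by rewrite -[- f]add0r (cBl O) c0l add0r. Qed.

Lemma cDl n i f g h : c n i (f + g) h = c n i f h + c n i g h.
Proof. by rewrite -[g in LHS]opprK (cBl O) cNl opprK. Qed.

Lemma c_suml n i I r (Q : pred I) (F : I -> P) h :
  c n i (\sum_(j <- r | Q j) F j) h = \sum_(j <- r | Q j) c n i (F j) h.
Proof. by apply: (big_morph (fun f => c n i f h)) => [f g|]; rewrite ?cDl ?c0l. Qed.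

Lemma c_sgl n i b f h : c n i (sg b f) h = sg b (c n i f h).
Proof. by case: b => //=; rewrite cNl. Qed.

Section Right.
Variables (m : nat) (h : P).
Hypothesis hh : ar m h.

Lemma c0r n i : c n i h 0 = 0.
Proof. by rewrite -[X in c n i h X](subrr 0) (cBr O _ _ _ _ hh) subrr. Qed.

Lemma cNr n i f : c n i h (- f) = - c n i h f.
Proof. by rewrite -[- f]add0r (cBr O _ _ _ _ hh) c0r add0r. Qed.

Lemma cDr n i f g : c n i h (f + g) = c n i h f + c n i h g.
Proof. by rewrite -[g in LHS]opprK (cBr O _ _ _ _ hh) cNr opprK. Qed.

Lemma c_sumr n i I r (Q : pred I) (F : I -> P) :
  c n i h (\sum_(j <- r | Q j) F j) = \sum_(j <- r | Q j) c n i h (F j).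
Proof. by apply: (big_morph (c n i h)) => [f g|]; rewrite ?cDr ?c0r. Qed.

Lemma c_sgr n i b f : c n i h (sg b f) = sg b (c n i h f).
Proof. by case: b => //=; rewrite cNr. Qed.

Lemma bulDr n f g : bul m n h (f + g) = bul m n h f + bul m n h g.
Proof. by rewrite -big_split; apply: eq_bigr => i _; rewrite cDr. Qed.

Lemma bul_sgr n b f : bul m n h (sg b f) = sg b (bul m n h f).
Proof. by rewrite sg_sum; apply: eq_bigr => i _; rewrite c_sgr. Qed.

Lemma bulBr n f g : bul m n h (f - g) = bul m n h f - bul m n h g.
Proof. by rewrite bulDr (bul_sgr n true). Qed.

End Right.

Lemma bulDl m n f g h : bul m n (f + g) h = bul m n f h + bul m n g h.
Proof. by rewrite -big_split; apply: eq_bigr => i _; rewrite cDl. Qed.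

Lemma bul_sgl m n b f h : bul m n (sg b f) h = sg b (bul m n f h).
Proof. by rewrite sg_sum; apply: eq_bigr => i _; rewrite c_sgl. Qed.

Lemma bulBl m n f g h : bul m n (f - g) h = bul m n f h - bul m n g h.
Proof. by rewrite bulDl (bul_sgl m n true). Qed.

Lemma arN n f : ar n f -> ar n (- f).
Proof. by move=> hf; rewrite -[- f]add0r; apply: (arB O) => //; apply: (ar0 O). Qed.

Lemma arD n f g : ar n f -> ar n g -> ar n (f + g).
Proof. by move=> hf hg; rewrite -[g]opprK; apply: (arB O) => //; apply: arN. Qed.

Lemma ar_sg n b f : ar n f -> ar n (sg b f).
Proof. by case: b => //; apply: arN. Qed.

Lemma ar_bul m n k f g : k.+1 = (m + n)%N -> ar m f -> ar n g -> ar k (bul m n f g).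
Proof.
move=> e hf hg; rewrite /bul big_nat_cond; apply: (big_ind (ar k)) => [|x y|i].
- exact: (ar0 O).
- exact: arD.
- by rewrite andbT => /andP[_ im]; apply: (ar_c O) hf hg.
Qed.

Lemma bul_bul m n mn p f g h : bul mn p (bul m n f g) h =
  \sum_(0 <= i < m) \sum_(0 <= k < mn) c p k (c n i f g) h.
Proof.
by rewrite /bul [RHS]exchange_big_nat; apply: eq_bigr => k _; rewrite c_suml.
Qed.

(** By the sequential law, the terms of (f•g)•h with [h] inside [g] make up f•(g•h). In the others
    [h] is to the right of [g], giving f{g,h}, or to its left, and the parallel law turns these into
    ± f{h,g}. *)
Lemma prelie m n p mn np f g h : ar m f -> ar n g -> ar p h -> (0 < n + p)%N ->
    mn.+1 = (m + n)%N -> np.+1 = (n + p)%N ->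
  bul mn p (bul m n f g) h - bul m np f (bul n p g h) =
  brace2 m n p f g h + sg (~~ odd n && ~~ odd p) (brace2 m p n f h g).
Proof.
move=> hf hg hh np0 emn enp; apply/(canLR (addrK _)).
have -> : bul m np f (bul n p g h) =
    \sum_(0 <= i < m) \sum_(0 <= k < n) c p (i + k) (c n i f g) h.
  apply: eq_big_nat => i /andP[_ im]; rewrite (c_sumr hf).
  by apply: eq_big_nat => k /andP[_ kn]; rewrite (c_seq O hf hg hh im kn enp).
have -> : sg (~~ odd n && ~~ odd p) (brace2 m p n f h g) =
    \sum_(0 <= i < m) \sum_(0 <= k < i) c p k (c n i f g) h.
  rewrite sg_sum; apply: eq_big_nat => i /andP[_ im]; rewrite sg_sum.
  apply: eq_big_nat => k /andP[_ ki].
  by rewrite (c_par O hf hh hg) ?sgg ?[~~ odd p && _]andbC ?addbb ?ki ?im // addnC.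
rewrite bul_bul /brace2 sum_triangle -!big_split /=.
by apply: eq_big_nat => i /andP[_ im]; rewrite (sum_block _ im emn) /=; zmod.
Qed.

Lemma brace2Dl a m n x f f' g : ar a x ->
  brace2 a m n x (f + f') g = brace2 a m n x f g + brace2 a m n x f' g.
Proof.
move=> hx; rewrite -big_split; apply: eq_bigr => j _; rewrite -big_split.
by apply: eq_bigr => i _; rewrite (cDr hx) cDl.
Qed.

Lemma brace2_sgl a m n x b f g : ar a x ->
  brace2 a m n x (sg b f) g = sg b (brace2 a m n x f g).
Proof.
move=> hx; rewrite sg_sum; apply: eq_bigr => j _; rewrite sg_sum.
by apply: eq_bigr => i _; rewrite (c_sgr hx) c_sgl.
Qed.

Lemma brace2_sg a m n b x f g : brace2 a m n (sg b x) f g = sg b (brace2 a m n x f g).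
Proof.
rewrite /brace2 sg_sum; apply: eq_bigr => j _; rewrite sg_sum.
by apply: eq_bigr => i _; rewrite !c_sgl.
Qed.

Lemma brace2Bl a m n x f f' g : ar a x ->
  brace2 a m n x (f - f') g = brace2 a m n x f g - brace2 a m n x f' g.
Proof. by move=> hx; rewrite brace2Dl // (brace2_sgl _ _ true). Qed.

Section BraceRight.
Variables (a m n : nat) (x f : P).
Hypotheses (hx : ar a x) (hf : ar m f).

Let hxf i j : (i < j < a)%N -> ar (a + m).-1 (c m i x f).
Proof. by move=> ij; apply: (ar_c O) hx hf; lia. Qed.

Lemma brace2Dr g g' :
  brace2 a m n x f (g + g') = brace2 a m n x f g + brace2 a m n x f g'.
Proof.
rewrite -big_split; apply: eq_big_nat => j hj; rewrite -big_split.
apply: eq_big_nat => i hi /=.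
by rewrite (cDr (@hxf i j _)) //; lia.
Qed.

Lemma brace2_sgr b g : brace2 a m n x f (sg b g) = sg b (brace2 a m n x f g).
Proof.
rewrite sg_sum; apply: eq_big_nat => j hj; rewrite sg_sum.
apply: eq_big_nat => i hi /=.
by rewrite (c_sgr (@hxf i j _)) //; lia.
Qed.

Lemma brace2Br g g' :
  brace2 a m n x f (g - g') = brace2 a m n x f g - brace2 a m n x f g'.
Proof. by rewrite brace2Dr (brace2_sgr true). Qed.

End BraceRight.

Lemma ar_brace2 a m n k x f g : k.+2 = (a + m + n)%N ->
  ar a x -> ar m f -> ar n g -> ar k (brace2 a m n x f g).
Proof.
move=> e hx hf hg; rewrite /brace2 big_nat_cond.
apply: (big_ind (ar k)) => [|y z|j]; [exact: (ar0 O)|exact: arD|].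
rewrite andbT => hj; rewrite big_nat_cond.
apply: (big_ind (ar k)) => [|y z|i]; [exact: (ar0 O)|exact: arD|].
rewrite andbT => hi.
by apply: (ar_c O (m := (a + m).-1)) hg; [lia..|apply: (ar_c O) hx hf; lia].
Qed.

(** * Braces of a composite *)

Section BraceBul.
Variables (a b m n ab amn bm bn bmn : nat) (x y f g : P).
Hypotheses (hx : ar a x) (hy : ar b y) (hf : ar m f) (hg : ar n g).
Hypotheses (b0 : (0 < b)%N) (eab : ab.+1 = (a + b)%N).
Hypotheses (eamn : amn.+2 = (a + m + n)%N) (ebm : bm.+1 = (b + m)%N).
Hypotheses (ebn : bn.+1 = (b + n)%N) (ebmn : bmn.+2 = (b + m + n)%N).

(** [E] gives the terms of (x•y){f,g}, and [G] below those of x{f,g}•y. Both are sorted by which of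
    y, f, g lie inside one another and which occupy separate slots of [x]. *)
Let E k i j := c n (j + m).-1 (c m i (c b k x y) f) g.
Let s1 := ~~ odd b && ~~ odd m.
Let s2 := ~~ odd b && ~~ odd n.

Let hxf i : (i.+1 < a)%N -> ar (a + m).-1 (c m i x f).
Proof. by move=> ij; apply: (ar_c O) hx hf; lia. Qed.

Lemma brace2_bul_split : brace2 ab m n (bul a b x y) f g =
  \sum_(0 <= k < a) \sum_(0 <= j < ab) \sum_(0 <= i < j) E k i j.
Proof.
rewrite [RHS]exchange_big_nat; apply: eq_bigr => j _.
rewrite [RHS]exchange_big_nat; apply: eq_bigr => i _.
by rewrite /bul 2!c_suml.
Qed.

Lemma brace2_bul_fst : brace2 a bm n x (bul b m y f) g =
  \sum_(0 <= k < a) \sum_(k.+1 <= j < a) \sum_(0 <= i < b) E k (k + i)%N (j + b).-1.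
Proof.
rewrite -sum_triangle; apply: eq_big_nat => j hj; apply: eq_big_nat => k hk.
rewrite (c_sumr hx) c_suml; apply: eq_big_nat => i hi.
rewrite -(c_seq O hx hy hf) //; last lia.
by congr c; lia.
Qed.

Lemma brace2_bul_snd : sg s1 (brace2 a m bn x f (bul b n y g)) =
  \sum_(0 <= k < a) \sum_(0 <= j < b) \sum_(0 <= i < k) E k i (k + j)%N.
Proof.
rewrite sg_sum; apply: eq_big_nat => k hk.
rewrite exchange_big_nat sg_sum; apply: eq_big_nat => i hi.
have hi' : (i.+1 < a)%N by lia.
rewrite (c_sumr (hxf hi')) sg_sum; apply: eq_big_nat => j hj.
rewrite -(c_seq O (hxf hi') hy hg) //; [|lia..].
rewrite (c_par O hx hf hy) /s1; [|lia..].
rewrite c_sgl sgg [~~ odd m && _]andbC addbb /= /E; congr c; lia.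
Qed.

Lemma bul_brace2 : bul a bmn x (brace2 b m n y f g) =
  \sum_(0 <= k < a) \sum_(0 <= j < b) \sum_(0 <= i < j) E k (k + i)%N (k + j)%N.
Proof.
apply: eq_big_nat => k hk; rewrite (c_sumr hx); apply: eq_big_nat => j hj.
rewrite (c_sumr hx); apply: eq_big_nat => i hi.
have hyf : ar bm (c m i y f) by apply: (ar_c O) hy hf; lia.
rewrite -(c_seq O hx hyf hg) //; [|lia..].
rewrite -(c_seq O hx hy hf) //; [|lia..].
rewrite /E; congr c; lia.
Qed.

Let G i j K := c b K (c n (j + m).-1 (c m i x f) g) y.

Lemma bul_brace2_split : bul amn b (brace2 a m n x f g) y =
  \sum_(0 <= j < a) \sum_(0 <= i < j)
    (\sum_(0 <= k < i) G i j k + \sum_(0 <= k < m) G i j (i + k)%N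
     + \sum_(i.+1 <= k < j) G i j (k + m).-1
     + \sum_(0 <= k < n) G i j ((j + m).-1 + k)%N
     + \sum_(j.+1 <= k < a) G i j ((k + m).-1 + n).-1).
Proof.
transitivity (\sum_(0 <= j < a) \sum_(0 <= i < j) \sum_(0 <= K < amn) G i j K).
  rewrite [RHS](eq_bigr (fun j => \sum_(0 <= K < amn) \sum_(0 <= i < j) G i j K)).
    rewrite [RHS]exchange_big_nat; apply: eq_bigr => K _.
    rewrite c_suml; apply: eq_bigr => j _.
    by rewrite c_suml.
  by move=> j _; rewrite exchange_big_nat.
apply: eq_big_nat => j hj; apply: eq_big_nat => i hi.
rewrite (@sum_block P _ _ (j + m).-1 (a + m).-1 n); [|lia..].
rewrite (@sum_block P _ _ i j m); [|lia..].
by rewrite (sum_shift (fun k => G i j (k + n).-1)) //; lia.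
Qed.

Lemma brace2_bul_fst' : brace2 a bm n x (bul m b f y) g =
  sg s2 (\sum_(0 <= j < a) \sum_(0 <= i < j) \sum_(0 <= k < m) G i j (i + k)%N).
Proof.
rewrite sg_sum; apply: eq_big_nat => j hj; rewrite sg_sum.
apply: eq_big_nat => i hi; rewrite (c_sumr hx) c_suml sg_sum.
apply: eq_big_nat => k hk.
rewrite -(c_seq O hx hf hy) //; [|lia..].
have hi' : (i.+1 < a)%N by lia.
rewrite /s2 -(c_par O (hxf hi') hy hg); [|lia..].
by congr c; lia.
Qed.

Lemma brace2_bul_snd' : brace2 a m bn x f (bul n b g y) =
  \sum_(0 <= j < a) \sum_(0 <= i < j) \sum_(0 <= k < n) G i j ((j + m).-1 + k)%N.
Proof.
apply: eq_big_nat => j hj; apply: eq_big_nat => i hi.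
have hi' : (i.+1 < a)%N by lia.
rewrite (c_sumr (hxf hi')); apply: eq_big_nat => k hk.
by rewrite -(c_seq O (hxf hi') hg hy) //; lia.
Qed.

(** Terms with y, f, g in three separate slots of [x]: here [y] comes last, in [mid_part] it is in
    the middle, in [right_part] first. In each case two parallel exchanges match the terms, with the
    same total sign. *)
Let left_part :
  \sum_(0 <= k < a) \sum_(0 <= j < k) \sum_(0 <= i < j) E k i j =
  sg (s1 (+) s2) (\sum_(0 <= j < a) \sum_(0 <= i < j)
    \sum_(j.+1 <= k < a) G i j ((k + m).-1 + n).-1).
Proof.
transitivity (sg (s1 (+) s2) (\sum_(0 <= k < a) \sum_(0 <= j < k)
    \sum_(0 <= i < j) G i j ((k + m).-1 + n).-1)).
  rewrite sg_sum; apply: eq_big_nat => k hk; rewrite sg_sum.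
  apply: eq_big_nat => j hj; rewrite sg_sum; apply: eq_big_nat => i hi.
  have hi' : (i.+1 < a)%N by lia.
  rewrite /G (c_par O (hxf hi') hg hy); [|lia..].
  rewrite (c_par O hx hf hy) ?c_sgl ?sgg; [|lia..].
  rewrite /s1 /s2 /E [~~ odd n && _]andbC [~~ odd m && _]andbC.
  by rewrite [X in sg X _](_ : _ = false) //; do 3!case: (odd _).
congr sg; rewrite sum_triangle; apply: eq_bigr => j _.
by rewrite exchange_big_nat.
Qed.

Let mid_part :
  \sum_(0 <= k < a) \sum_(k.+1 <= j < a) \sum_(0 <= i < k) E k i (j + b).-1 =
  sg (s1 (+) s2) (\sum_(0 <= j < a) \sum_(0 <= i < j)
    \sum_(i.+1 <= k < j) G i j (k + m).-1).
Proof.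
rewrite -sum_triangle sg_sum; apply: eq_big_nat => j hj.
rewrite -sum_triangle sg_sum; apply: eq_big_nat => k hk.
rewrite sg_sum; apply: eq_big_nat => i hi.
have hi' : (i.+1 < a)%N by lia.
have -> : E k i (j + b).-1 =
    sg s1 (c n ((j + m).-1 + b).-1 (c b (k + m).-1 (c m i x f) y) g).
  rewrite (c_par O hx hf hy) ?c_sgl ?sgg; [|lia..].
  by rewrite /s1 [~~ odd m && _]andbC addbb /= /E; congr c; lia.
by rewrite (c_par O (hxf hi') hy hg) ?sgg //; lia.
Qed.

Let right_part :
  \sum_(0 <= k < a) \sum_(k.+1 <= j < a) \sum_(k.+1 <= i < j)
    E k (i + b).-1 (j + b).-1 =
  sg (s1 (+) s2) (\sum_(0 <= j < a) \sum_(0 <= i < j) \sum_(0 <= k < i) G i j k).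
Proof.
rewrite -sum_triangle sg_sum; apply: eq_big_nat => j hj.
rewrite -sum_triangle sg_sum; apply: eq_big_nat => i hi.
rewrite sg_sum; apply: eq_big_nat => k hk.
have hi' : (i.+1 < a)%N by lia.
rewrite /E (c_par O hx hy hf) ?c_sgl; [|lia..].
rewrite (_ : ((j + b).-1 + m).-1 = ((j + m).-1 + b).-1); last lia.
by rewrite (c_par O (hxf hi') hy hg) ?sgg //; lia.
Qed.

(** The threefold braces x{y,f,g}, x{f,y,g} and x{f,g,y} occur in both terms on the left and cancel.
    What survives has [f] or [g] inside [y], or [y] inside [f] or [g]. *)
Lemma brace2_bul :
  brace2 ab m n (bul a b x y) f g
    - sg (s1 (+) s2) (bul amn b (brace2 a m n x f g) y) =
  brace2 a bm n x (bul b m y f) g + sg s1 (brace2 a m bn x f (bul b n y g))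
  + bul a bmn x (brace2 b m n y f g)
  - (sg s1 (brace2 a bm n x (bul m b f y) g)
     + sg (s1 (+) s2) (brace2 a m bn x f (bul n b g y))).
Proof.
pose B1 := \sum_(0 <= j < a) \sum_(0 <= i < j) \sum_(0 <= k < i) G i j k.
pose B3 := \sum_(0 <= j < a) \sum_(0 <= i < j) \sum_(i.+1 <= k < j) G i j (k + m).-1.
pose B5 := \sum_(0 <= j < a) \sum_(0 <= i < j)
  \sum_(j.+1 <= k < a) G i j ((k + m).-1 + n).-1.
have -> : brace2 ab m n (bul a b x y) f g =
    sg (s1 (+) s2) B5 + sg s1 (brace2 a m bn x f (bul b n y g))
    + bul a bmn x (brace2 b m n y f g) + sg (s1 (+) s2) B3
    + brace2 a bm n x (bul b m y f) g + sg (s1 (+) s2) B1.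
  rewrite -left_part brace2_bul_snd bul_brace2 -mid_part brace2_bul_fst -right_part.
  rewrite brace2_bul_split -!big_split; apply: eq_big_nat => k /andP[_ ka].
  exact: sum_triangle_block.
have -> : bul amn b (brace2 a m n x f g) y =
    B1 + sg s2 (brace2 a bm n x (bul m b f y) g) + B3
    + brace2 a m bn x f (bul n b g y) + B5.
  rewrite brace2_bul_fst' sgK brace2_bul_snd' bul_brace2_split -!big_split.
  by apply: eq_bigr => j _; rewrite -!big_split.
rewrite !sgD sgg [_ (+) _ (+) _]addbK; move: B1 B3 B5 => B1 B3 B5.
by case: s1; case: s2 => /=; zmod.
Qed.

End BraceBul.

End OddOperad.

(** * The Gerstenhaber identities in an operad with multiplication *)

(** The goal is obtained as a signed combination of known equations. [zcomb] and [zcomb_with] try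
    all choices of signs, so that none has to be found by hand after a case split on parities. *)
Lemma zcomb1 (V : zmodType) b (x y u v : V) :
  x = y -> sg b (x - y) = u - v -> u = v.
Proof. by move=> -> h; apply: subr0_eq; rewrite -h subrr sg0. Qed.

Lemma zcomb2 (V : zmodType) b b' (x y x' y' u v : V) :
  x = y -> x' = y' -> sg b (x - y) + sg b' (x' - y') = u - v -> u = v.
Proof. by move=> -> -> h; apply: subr0_eq; rewrite -h !subrr !sg0 addr0. Qed.

Ltac zcomb E :=
  first [apply: (zcomb1 (b := false) E); rewrite /sg; zmod
        |apply: (zcomb1 (b := true) E); rewrite /sg; zmod].

Ltac zcomb_with E E' :=
  first [apply: (zcomb2 (b := false) (b' := false) E E'); rewrite /sg; zmod
        |apply: (zcomb2 (b := false) (b' := true) E E'); rewrite /sg; zmod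
        |apply: (zcomb2 (b := true) (b' := false) E E'); rewrite /sg; zmod
        |apply: (zcomb2 (b := true) (b' := true) E E'); rewrite /sg; zmod].

Section GradedLie.
Variables (P : zmodType) (ar : nat -> P -> Prop) (c : nat -> nat -> P -> P -> P).
Hypothesis O : odd_operad ar c.
Implicit Types f g h : P.
Local Notation bul := (bul c).
Local Notation ebr := (ebr c).
Local Notation brace2 := (brace2 c).

Lemma prelie_sym m n p mn np mp f g h : ar m f -> ar n g -> ar p h ->
    (0 < n + p)%N ->
    mn.+1 = (m + n)%N -> np.+1 = (n + p)%N -> mp.+1 = (m + p)%N ->
  bul mn p (bul m n f g) h - bul m np f (bul n p g h) =
  sg (~~ odd n && ~~ odd p)
    (bul mp n (bul m p f h) g - bul m np f (bul p n h g)).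
Proof.
move=> hf hg hh np0 emn enp emp.
rewrite (prelie O hf hg hh np0 emn enp).
rewrite (prelie O hf hh hg _ emp) ?sgD ?sgg; [|lia..].
by rewrite [~~ odd p && _]andbC addbb addrC.
Qed.

Lemma odd_pred_add m n k : k.+1 = (m + n)%N -> odd k = ~~ (odd m (+) odd n).
Proof. by move/(congr1 odd); rewrite oddD /= => <-; rewrite negbK. Qed.

Lemma ar_ebr m n k f g : k.+1 = (m + n)%N -> ar m f -> ar n g -> ar k (ebr m n f g).
Proof.
move=> e hf hg; apply: (arB O); first exact: (ar_bul O).
by apply: (ar_sg O); apply: (ar_bul O) => //; rewrite addnC.
Qed.

Lemma ebr_anti m n f g : ebr m n f g = - sg (~~ odd m && ~~ odd n) (ebr n m g f).
Proof. by rewrite /ebr; case: (odd m); case: (odd n) => /=; zmod. Qed.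

(** The symmetry of the associator, used with each of f, g, h as the outermost operation, cancels
    all terms of the three double brackets. Each use needs one of the positivity hypotheses. *)
Lemma jacobi m n p mn np mp f g h : ar m f -> ar n g -> ar p h ->
    (0 < m + n)%N -> (0 < n + p)%N -> (0 < m + p)%N ->
    mn.+1 = (m + n)%N -> np.+1 = (n + p)%N -> mp.+1 = (m + p)%N ->
  ebr m np f (ebr n p g h) =
  ebr mn p (ebr m n f g) h + sg (~~ odd m && ~~ odd n) (ebr n mp g (ebr m p f h)).
Proof.
move=> hf hg hh mn0 np0 mp0 emn enp emp.
have E1 := prelie_sym hf hg hh np0 emn enp emp.
have E2 : _ = sg (~~ odd m && ~~ odd p) _ :=
  prelie_sym hg hf hh mp0 (etrans emn (addnC _ _)) emp enp.
have E3 : _ = sg (~~ odd m && ~~ odd n) _ :=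
  prelie_sym hh hf hg mn0 (etrans emp (addnC _ _)) emn (etrans enp (addnC _ _)).
rewrite /ebr !(bulBl O, bulBr O hf, bulBr O hg, bulBr O hh).
rewrite !(bul_sgl O, bul_sgr O hf, bul_sgr O hg, bul_sgr O hh).
rewrite (odd_pred_add emn) (odd_pred_add enp) (odd_pred_add emp).
rewrite (canRL (subrK _) E1) (canRL (subrK _) E2) (canRL (subrK _) E3).
by case: (odd m); case: (odd n); case: (odd p) => /=; zmod.
Qed.

Variable M : P.
Hypotheses (hM : ar 2 M) (MM : bul 2 2 M M = 0).

Definition dd n f := sg (~~ odd n) (bul 2 n M f) - bul n 2 f M.

(** The sign undoes the one that [c] puts on the insertion of [g] in slot [m], leaving the plain cup
    product. *)
Definition ecup m n f g := sg (odd m && ~~ odd n) (brace2 2 m n M f g).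

Lemma dd_ebr n f : dd n f = - ebr n 2 f M.
Proof. by rewrite /dd /ebr andbT; zmod. Qed.

Lemma ar_dd n f : ar n f -> ar n.+1 (dd n f).
Proof.
by move=> hf; rewrite dd_ebr; apply: (arN O); apply: ar_ebr => //; lia.
Qed.

Lemma ddB n f g : dd n (f - g) = dd n f - dd n g.
Proof. by rewrite /dd (bulBr O hM) (bulBl O); case: (odd n) => /=; zmod. Qed.

Lemma dd_sg n b f : dd n (sg b f) = sg b (dd n f).
Proof.
by rewrite /dd (bul_sgr O hM) (bul_sgl O) sgg addbC -sgg; case: b => //=; zmod.
Qed.

Lemma ar_ecup m n k f g : k = (m + n)%N -> ar m f -> ar n g -> ar k (ecup m n f g).
Proof.
by move=> e hf hg; apply: (ar_sg O); apply: (ar_brace2 O) => //; rewrite e.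
Qed.

Lemma ebrBl m n f g h : ar n h -> ebr m n (f - g) h = ebr m n f h - ebr m n g h.
Proof.
move=> hh; rewrite /ebr (bulBl O) (bulBr O hh).
by case: (odd m); case: (odd n) => /=; zmod.
Qed.

Lemma ebrBr m n f g h : ar m h -> ebr m n h (f - g) = ebr m n h f - ebr m n h g.
Proof.
move=> hh; rewrite /ebr (bulBl O) (bulBr O hh).
by case: (odd m); case: (odd n) => /=; zmod.
Qed.

Lemma ebr0r m n h : ar m h -> ebr m n h 0 = 0.
Proof. by move=> hh; rewrite -[X in ebr m n h X](subrr 0) ebrBr // subrr. Qed.

(** The Jacobi identity for f, g, M, in which the term with [f, M] vanishes. *)
Lemma ebr_dd m n k f g : ar m f -> ar n g -> (0 < m + n)%N -> k.+1 = (m + n)%N ->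
  dd m f = 0 -> ebr m n.+1 f (dd n g) = dd k (ebr m n f g).
Proof.
move=> hf hg mn0 ek df.
have hfM : ebr m 2 f M = 0 by rewrite -[LHS]opprK -dd_ebr df oppr0.
rewrite !dd_ebr -[- ebr n 2 g M]add0r ebrBr // ebr0r // add0r; congr (- _).
rewrite (@jacobi m n 2 k n.+1 m.+1) // ?hfM ?ebr0r ?sg0 ?addr0 //; lia.
Qed.

Lemma ebr_cocycle m n k f g :
    ar m f -> ar n g -> (0 < m + n)%N -> k.+1 = (m + n)%N ->
  dd m f = 0 -> dd n g = 0 -> dd k (ebr m n f g) = 0.
Proof. by move=> hf hg mn ek df dg; rewrite -ebr_dd // dg ebr0r. Qed.

Lemma ecupBl m n f g h : ecup m n (f - g) h = ecup m n f h - ecup m n g h.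
Proof.
by rewrite /ecup (brace2Bl O _ _ _ _ _ hM); case: (odd m && _) => /=; zmod.
Qed.

Lemma ecupBr m n f g h : ar m h -> ecup m n h (f - g) = ecup m n h f - ecup m n h g.
Proof.
move=> hh; by rewrite /ecup (brace2Br O _ hM hh); case: (odd m && _) => /=; zmod.
Qed.

Lemma ecup0l m n h : ecup m n 0 h = 0.
Proof. by rewrite -[X in ecup m n X h](subrr 0) ecupBl subrr. Qed.

Lemma ecup0r m n h : ar m h -> ecup m n h 0 = 0.
Proof. by move=> hh; rewrite -[X in ecup m n h X](subrr 0) ecupBr // subrr. Qed.

Lemma brace2M m n f g : brace2 2 m n M f g = c n m (c m 0 M f) g.
Proof. by rewrite /brace2 big_ltn // [X in X + _]big_geq // add0r !big_nat1. Qed.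

Lemma brace2_0 a m n f g : brace2 a m n 0 f g = 0.
Proof. by rewrite /brace2 big1 // => j _; rewrite big1 // => i _; rewrite !(c0l O). Qed.

(** This is [brace2_bul] for x = y = M, where (M•M){f,g} = 0. *)
Lemma dd_ecup m n k f g : k = (m + n)%N -> ar m f -> ar n g ->
  dd k (ecup m n f g) = ecup m.+1 n (dd m f) g + sg (odd m) (ecup m n.+1 f (dd n g)).
Proof.
move=> -> hf hg.
have := @brace2_bul _ _ _ O 2 2 m n 3 (m + n) m.+1 n.+1 (m + n) M M f g hM hM hf hg.
rewrite MM brace2_0 => /(_ isT erefl erefl erefl erefl erefl) E.
rewrite /dd /ecup (bul_sgl O) (bul_sgr O hM) (brace2Bl O _ _ _ _ _ hM).
rewrite (brace2Br O _ hM hf) (brace2_sgl O _ _ _ _ _ hM) (brace2_sgr O _ hM hf).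
move: E; rewrite /= oddD.
by case: (odd m); case: (odd n) => /= E; zcomb E.
Qed.

(** By [prelie], M{f,g} ± M{g,f} = (M•f)•g - M•(f•g). Since [f] and [g] commute with [M] up to sign,
    [prelie_sym] for f, g, M reduces to (f•g)•M = ± (M•f)•g, so the right side is ± the differential
    of f•g. *)
Lemma ecup_comm m n k f g : ar m f -> ar n g -> (0 < m + n)%N -> k.+1 = (m + n)%N ->
  dd m f = 0 -> dd n g = 0 ->
  ecup n m g f = sg (odd m && odd n) (ecup m n f g)
    + sg (odd n) (dd k (bul m n f g)).
Proof.
move=> hf hg mn0 ek df dg.
have fM : bul m 2 f M = sg (~~ odd m) (bul 2 m M f) by apply/esym/subr0_eq.
have gM : bul n 2 g M = sg (~~ odd n) (bul 2 n M g) by apply/esym/subr0_eq.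
have E1 := @prelie _ _ _ O 2 m n m.+1 k M f g hM hf hg mn0 erefl ek.
have E2 := @prelie_sym m n 2 k n.+1 m.+1 f g M hf hg hM.
have {}E2 : _ := E2 _ ek _ _; move: E2.
rewrite fM gM (bul_sgl O) (bul_sgr O hf) /dd /ecup => -/(_ _ _ _) E2.
have {}E2 := E2 ltac:(lia) ltac:(lia) ltac:(lia); move: E1 E2.
rewrite (odd_pred_add ek).
by case: (odd m); case: (odd n) => /= E1 E2; zcomb_with E1 E2.
Qed.

(** Take [brace2_bul] for (h, M) and for (M, h). The terms (h•M){f,g} and (M•h){f,g} agree up to
    sign because [h] is a cocycle, and the terms where [M] meets [f] or [g] under [h] cancel because
    these are cocycles. The terms h{f,g}•M and M•h{f,g} form the differential of h{f,g}, and the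
    rest is the Poisson identity. *)
Lemma poisson m n p q k f g h : ar m f -> ar n g -> ar p h -> (0 < p)%N ->
    q.+2 = (m + n + p)%N -> k = (m + n)%N ->
    dd m f = 0 -> dd n g = 0 -> dd p h = 0 ->
  exists b, ebr k p (ecup m n f g) h =
    ecup (m + p).-1 n (ebr m p f h) g
    + sg (~~ odd p && odd m) (ecup m (n + p).-1 f (ebr n p g h))
    + sg b (dd q (brace2 p m n h f g)).
Proof.
move=> hf hg hh p0 eq -> df dg dh.
have Mf : bul 2 m M f = sg (~~ odd m) (bul m 2 f M).
  by apply: (canRL (@sgK _ _)); apply/subr0_eq.
have Mg : bul 2 n M g = sg (~~ odd n) (bul n 2 g M).
  by apply: (canRL (@sgK _ _)); apply/subr0_eq.
have Mh : bul 2 p M h = sg (~~ odd p) (bul p 2 h M).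
  by apply: (canRL (@sgK _ _)); apply/subr0_eq.
have emp : (m + p).-1.+1 = (p + m)%N by lia.
have enp : (n + p).-1.+1 = (p + n)%N by lia.
have := @brace2_bul _ _ _ O p 2 m n p.+1 q m.+1 n.+1 (m + n) h M f g hh hM hf hg.
move=> /(_ isT (esym (addn2 _)) _ erefl erefl erefl).
have -> : q.+2 = (p + m + n)%N by lia.
move=> /(_ erefl).
have := @brace2_bul _ _ _ O 2 p m n p.+1 (m + n) (m + p).-1 (n + p).-1 q M h f g hM hh hf hg.
have -> : q.+2 = (p + m + n)%N by lia.
move=> /(_ p0 erefl erefl emp enp erefl).
rewrite Mh Mf Mg.
rewrite (brace2_sgl O _ _ _ _ _ hh) (brace2_sgr O _ hh hf).
rewrite (brace2_sg O).
rewrite /ebr /dd /ecup (bul_sgl O) (bul_sgr O hh).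
rewrite !(brace2Bl O _ _ _ _ _ hM) !(brace2Br O _ hM hf).
rewrite !(brace2_sgl O _ _ _ _ _ hM) !(brace2_sgr O _ hM hf).
have -> : odd q = odd m (+) odd n (+) odd p.
  by have := congr1 odd eq; rewrite /= !oddD negbK.
rewrite (odd_pred_add emp) (odd_pred_add enp) oddD => E2 E1.
(* The sign of the homotopy depends on the parities; any sign will do, as the term is a
   coboundary. *)
move: E1 E2; case: (odd m); case: (odd n); case: (odd p) => /= E1 E2;
  first [exists false; rewrite /sg; zcomb_with E1 E2|exists true; rewrite /sg; zcomb_with E1 E2].
Qed.

(** Because of the signs in [c], M•M = 0 says that the two insertions of [M] in itself are opposite.
    Both triple products become f, g, h inserted successively in [c 2 0 M M]. *)
Lemma ecup_assoc m n p k l f g h : ar m f -> ar n g -> ar p h ->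
    k = (m + n)%N -> l = (n + p)%N ->
  ecup k p (ecup m n f g) h = ecup m l f (ecup n p g h).
Proof.
move=> hf hg hh -> ->.
have MM' : c 2 1 M M = - c 2 0 M M.
  by move: MM; rewrite /bul big_ltn // big_nat1 addrC => /eqP; rewrite addr_eq0 => /eqP.
have hMf : ar m.+1 (c m 0 M f) by apply: (ar_c O) hM hf.
have hMg : ar n.+1 (c n 0 M g) by apply: (ar_c O) hM hg.
have H1 : c (m + n) 0 M (c n m (c m 0 M f) g) =
    c n m (c m 0 (c 2 0 M M) f) g.
  rewrite -(c_seq O hM hMf hg) ?add0n //.
  by rewrite -[X in c m.+1 0 M X]/(c m 0 M f) -(c_seq O hM hM hf).
have H2 : c (n + p) m (c m 0 M f) (c p n (c n 0 M g) h) =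
    sg (odd m) (c p (m + n) (c n m (c m 0 (c 2 0 M M) f) g) h).
  rewrite -(c_seq O hMf hMg hh) // -(c_seq O hMf hM hg) ?addn0 //.
  rewrite -[X in c 2 X _ M]/((1 + m).-1) (c_par O hM hf hM) ?addn2 //.
  by rewrite MM' !(c_sgl O, cNl O) andbT; case: (odd m) => /=; rewrite ?opprK.
rewrite /ecup !brace2M (c_sgr O hM) (c_sgl O) (c_sgr O hMf) H1 H2 !sgg; congr sg.
by rewrite !oddD; case: (odd m); case: (odd n); case: (odd p).
Qed.

Lemma ddD n f g : dd n (f + g) = dd n f + dd n g.
Proof. by rewrite -[g in LHS]opprK ddB (dd_sg _ true) opprK. Qed.

(** Independence of representatives, with an explicit primitive. [F] or [G] has arity 0 when the
    corresponding class lies in HH^1. *)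
Lemma ecup_boundary i j k f f' F g g' G :
    ar i.+1 f -> ar i F -> ar j.+1 g' -> ar j G -> k = (i + j.+1)%N ->
    dd i.+1 f = 0 -> dd j.+1 g' = 0 -> f' - f = dd i F -> g' - g = dd j G ->
  ecup i.+1 j.+1 f' g' - ecup i.+1 j.+1 f g =
    dd k (ecup i j.+1 F g' + sg (odd i.+1) (ecup i.+1 j f G)).
Proof.
move=> hf hF hg' hG ek df dg' ef eg.
rewrite ddD dd_sg (dd_ecup ek hF hg') (@dd_ecup i.+1 j k) ?addSnnS //.
rewrite df dg' ecup0l (ecup0r _ hF) sg0 addr0 add0r sgK -ef -eg.
by rewrite ecupBl (ecupBr _ _ _ hf); zmod.
Qed.

Lemma ebr_boundary i j k f f' F g g' G :
    ar i.+1 f -> ar i F -> ar j.+1 g' -> ar j G -> k = (i + j)%N ->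
    dd i.+1 f = 0 -> dd j.+1 g' = 0 -> f' - f = dd i F -> g' - g = dd j G ->
  ebr i.+1 j.+1 f' g' - ebr i.+1 j.+1 f g =
    dd k (ebr i.+1 j f G - sg (~~ odd i.+1 && ~~ odd j.+1) (ebr j.+1 i g' F)).
Proof.
move=> hf hF hg' hG ek df dg' ef eg.
rewrite ddB dd_sg -(@ebr_dd i.+1 j) ?ek // -(@ebr_dd j.+1 i) //; last by rewrite addSn addnC.
rewrite -[- sg _ _](@ebr_anti i.+1 j.+1) -ef -eg ebrBl // ebrBr //.
by zmod.
Qed.

End GradedLie.

(** * Linear maps and evaluation of polynomials at commuting operators *)

Section LinearProp.
Variables (R : pzRingType) (U V : lmodType R) (f : U -> V).
Hypothesis fl : linear f.

Lemma linP0 : f 0 = 0. Proof. exact: linear_at0. Qed.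

Lemma linPD x y : f (x + y) = f x + f y.
Proof. by rewrite -[x in LHS]scale1r fl scale1r. Qed.

Lemma linPZ a x : f (a *: x) = a *: f x.
Proof. by rewrite -[a *: x]addr0 fl linP0 addr0. Qed.

Lemma linPN x : f (- x) = - f x.
Proof. by rewrite -scaleN1r linPZ scaleN1r. Qed.

Lemma linPB x y : f (x - y) = f x - f y.
Proof. by rewrite linPD linPN. Qed.

Lemma linP_sum I (r : seq I) (Q : pred I) (F : I -> U) :
  f (\sum_(i <- r | Q i) F i) = \sum_(i <- r | Q i) f (F i).
Proof. exact: (big_morph f linPD linP0). Qed.

End LinearProp.

Section Evaluation.
Variables (R : pzRingType).
Implicit Types V W : lmodType R.

Lemma lpoly_decomp (V : zmodType) k (p : lpoly V k) :
  p = \sum_(m <- lsupp p) lmono (lcoef p m) m.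
Proof. by rewrite {1}[p]monalgE; apply: eq_bigr => m _; rewrite unlock. Qed.

Lemma leval_mono k V W (t : 'I_k -> W -> W) (e : V -> W) v m :
    (forall i, linear (t i)) -> linear e ->
  leval t e (lmono v m) = foldr (fun i w => iter (m i) (t i) w) (e v) (enum 'I_k).
Proof.
move=> tl el; rewrite /leval.
pose F m0 u := foldr (fun i w => iter (m0 i) (t i) w) (e u) (enum 'I_k).
rewrite (@lsumE _ _ _ _ F _ [:: m]) //.
- by rewrite big_seq1 lcoef_lmono eqxx mulr1n.
- move=> m0; rewrite /F (linP0 el).
  exact: linear_at0 (foldr_linear (enum 'I_k) (fun i => m0 i) tl).
- move=> m'; rewrite inE; case: (eqVneq m m') => [-> //|ne] h.
  by rewrite -mcoeff_neq0 -[mcoeff _ _]/(lcoef _ _) lcoef_lmono (negPf ne) eqxx in h.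
Qed.

Lemma leval_lconst k V W (t : 'I_k -> W -> W) (e : V -> W) v :
  (forall i, linear (t i)) -> linear e -> leval t e (lconst k v) = e v.
Proof.
move=> tl el; rewrite /lconst leval_mono //.
elim: (enum _) => //= i s ->; by rewrite cm1.
Qed.

Lemma eq_leval k V W (t t' : 'I_k -> W -> W) (e e' : V -> W) p :
  (forall i, t i =1 t' i) -> e =1 e' -> leval t e p = leval t' e' p.
Proof.
move=> tt ee; apply: eq_bigr => m _; rewrite ee.
by elim: (enum _) => //= i s ->; apply: eq_iter.
Qed.

(** Evaluation passes through any linear map that intertwines the operators. Nested substitutions
    are thereby reduced to evaluations in [A]. *)
Lemma leval_morph k V W W' (s : 'I_k -> W -> W) (t : 'I_k -> W' -> W')
    (e : V -> W) (h : W -> W') p :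
    linear h -> (forall i w, h (s i w) = t i (h w)) ->
  h (leval s e p) = leval t (h \o e) p.
Proof.
move=> hl hst; rewrite (linP_sum hl); apply: eq_bigr => m _ /=.
elim: (enum _) => //= i r <-.
by elim: (m i) => //= j <-.
Qed.

Section Leval.
Variables (k : nat) (V W : lmodType R) (t : 'I_k -> W -> W) (e : V -> W).
Hypotheses (tl : forall i, linear (t i)) (el : linear e).

Lemma leval_lmap (U : lmodType R) (f : U -> V) (p : lpoly U k) : linear f ->
  leval t e (lmap f p) = leval t (e \o f) p.
Proof.
move=> fl; rewrite [p in LHS]lpoly_decomp (linP_sum (lmap_linear fl)).
have ll := leval_linear tl el; rewrite (linP_sum ll); apply: eq_bigr => m _.
have -> : lmap f (lmono (lcoef p m) m) = lmono (f (lcoef p m)) m.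
  apply/lpolyP => m'; rewrite lcoef_lmap ?(linP0 fl) // !lcoef_lmono.
  by case: (m == m'); rewrite ?mulr1n // !mulr0n (linP0 fl).
by rewrite leval_mono.
Qed.

Hypothesis tC : forall i j w, t i (t j w) = t j (t i w).

Lemma iter_comm (f g : W -> W) n w :
  (forall w, f (g w) = g (f w)) -> f (iter n g w) = iter n g (f w).
Proof. by move=> fg; elim: n => //= n IH; rewrite fg IH. Qed.

Lemma foldr_incr i (m : 'X_{1..k}) w :
  foldr (fun j w => iter (mmul m (ucm i) j) (t j) w) w (enum 'I_k) =
  t i (foldr (fun j w => iter (m j) (t j) w) w (enum 'I_k)).
Proof.
have : i \in enum 'I_k by rewrite mem_enum.
elim: (enum _) (enum_uniq 'I_k) => //= j s IH /andP[js us].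
rewrite inE cmM cmU => /orP[/eqP ij|si].
  rewrite -ij eqxx addn1 /=; congr (t i (iter _ _ _)).
  move: js; rewrite -ij; elim: s {IH us} => //= j' s IH.
  rewrite inE negb_or cmM cmU => /andP[/negPf -> /IH ->].
  by rewrite addn0.
rewrite IH //; case: eqP => [ij|_]; first by rewrite -ij si in js.
by rewrite addn0 iter_comm.
Qed.

Lemma leval_lamX i p : leval t e (lamX i p) = t i (leval t e p).
Proof.
have ll := leval_linear tl el; rewrite /lamX (linP_sum ll) (linP_sum (tl i)).
by apply: eq_bigr => m _; rewrite leval_mono // foldr_incr.
Qed.

Lemma leval_lamS lo hi p :
  leval t e (lamS lo hi p) = \sum_(i < k | (lo <= i < hi)%N) t i (leval t e p).
Proof.
have ll := leval_linear tl el; rewrite /lamS (linP_sum ll).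
by apply: eq_bigr => i _; apply: leval_lamX.
Qed.

End Leval.

(** Operators congruent modulo an invariant subspace have congruent evaluations. It serves for the
    image of [del] plus a scalar, in the proof of [good_mod] for cochains. *)
Lemma leval_sub_mod k V (t t' : 'I_k -> V -> V) (S : V -> Prop) p :
    (forall i, linear (t i)) ->
    S 0 -> (forall x y, S x -> S y -> S (x + y)) ->
    (forall i x, S x -> S (t i x)) -> (forall i x, S (t i x - t' i x)) ->
  S (leval t id p - leval t' id p).
Proof.
move=> tl S0 SD St Stt; rewrite /leval -sumrB; apply: big_ind => // m _.
elim: (enum _) => /= [|i s IH]; first by rewrite subrr.
elim: (m i) => //= j IHj.
set x := iter j (t i) _ in IHj *; set y := iter j (t' i) _ in IHj *.
rewrite -[t i x](addrNK (t i y)) -(linPB (tl i)) -addrA.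
by apply: SD; [apply: St|apply: Stt].
Qed.

End Evaluation.

(** * Polynomials are determined by their values at scalars *)

Section Characters.
Variables (C : fieldType) (V : lmodType C).
Hypothesis charC : [pchar C] =i pred0.

Definition scal k (l : 'I_k -> C) (i : 'I_k) (w : V) := l i *: w.

Lemma scal_linear k (l : 'I_k -> C) i : linear (scal l i).
Proof. by move=> c u v; rewrite /scal scalerDr !scalerA mulrC. Qed.

Definition chi k (m : 'X_{1..k}) (l : 'I_k -> C) := \prod_i l i ^+ m i.

Lemma leval_scal k (l : 'I_k -> C) p :
  leval (scal l) id p = \sum_(m <- lsupp p) chi m l *: lcoef p m.
Proof.
apply: eq_bigr => m _; rewrite /chi -big_enum /=.
elim: (enum _) => [|i s IH] /=; first by rewrite big_nil scale1r.
rewrite big_cons IH -scalerA; elim: (m i) => [|j]; first by rewrite expr0 scale1r.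
by rewrite iterS => ->; rewrite /scal exprS !scalerA.
Qed.

Lemma chiM k m (l l' : 'I_k -> C) : chi m (fun i => l i * l' i) = chi m l * chi m l'.
Proof. by rewrite /chi -big_split; apply: eq_bigr => i _; rewrite exprMn. Qed.

(** At a point with one coordinate 2 and the others 1, monomials take powers of 2 as values, and
    these are distinct in characteristic zero. *)
Lemma chi_sep k (m m' : 'X_{1..k}) : m != m' -> exists l, chi m l != chi m' l.
Proof.
move=> ne; have [i ni] : exists i, m i != m' i.
  apply/existsP; rewrite -[X in is_true X]negbK negb_exists; apply: contra ne => h.
  by apply/cmP => i; apply/eqP; rewrite -[_ == _]negbK (forallP h).
pose l j : C := if j == i then 2%:R else 1.
have chil m0 : chi m0 l = (2 ^ m0 i)%:R.
  rewrite /chi (bigD1 i) //= big1 ?mulr1 /l ?eqxx ?natrX // => j /negPf ->.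
  by rewrite expr1n.
exists l; rewrite !chil; apply: contra ni => /eqP e.
have natI := (@pcharf0P C).1 charC.
have: ((2 ^ m i)%:R - (2 ^ m' i)%:R : C) == 0 by rewrite e subrr.
wlog le: m m' {ne chil} e / (m' i <= m i)%N => [H|].
  have [h|h] := leqP (m' i) (m i); first exact: H.
  by rewrite -oppr_eq0 opprB => h'; rewrite eq_sym; apply: H => //; exact: ltnW.
rewrite -natrB ?leq_exp2l // natI subn_eq0 leq_exp2l // => h.
by rewrite eqn_leq h le.
Qed.

(** Independence of characters: rescale the point by [l] and subtract [chi m0 l] times the relation.
    This removes [m0] and multiplies [v m] by a scalar that is nonzero if [l] separates [m] from
    [m0]. *)
Lemma chi_free k (s : seq 'X_{1..k}) (v : 'X_{1..k} -> V) : uniq s ->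
    (forall l, \sum_(m <- s) chi m l *: v m = 0) ->
  {in s, forall m, v m = 0}.
Proof.
elim: s v => // m0 s IH v /= /andP[ms us] h.
have hs : {in s, forall m, v m = 0}.
  move=> m hm; have /chi_sep[l hl] : m != m0 by apply: contra ms => /eqP <-.
  have : (chi m l - chi m0 l) *: v m = 0.
    apply: (IH (fun m => (chi m l - chi m0 l) *: v m)) => // x.
    have e1 := h x; have e2 := h (fun i => l i * x i).
    rewrite !big_cons chiM in e1 e2.
    transitivity (\sum_(m <- s) chi m (fun i => l i * x i) *: v m -
                  chi m0 l *: \sum_(m <- s) chi m x *: v m); last first.
      move/eqP: e1; rewrite addrC addr_eq0 => /eqP ->.
      move/eqP: e2; rewrite addrC addr_eq0 => /eqP ->.
      by rewrite scalerN scalerA subrr.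
    rewrite scaler_sumr -sumrB; apply: eq_bigr => j _.
    by rewrite chiM !scalerA -scalerBl mulrBr mulrC [_ * chi m0 l]mulrC.
  by move/eqP; rewrite scaler_eq0 subr_eq0 (negPf hl) => /eqP.
move=> m; rewrite inE => /orP[/eqP ->|/hs //].
have := h (fun=> 1); rewrite big_cons big1_seq ?addr0.
  by rewrite /chi big1 ?scale1r // => i _; rewrite expr1n.
by move=> j /andP[_ /hs ->]; rewrite scaler0.
Qed.

Lemma lpoly_eq_scal k (p q : lpoly V k) :
  (forall l, leval (scal l) id p = leval (scal l) id q) -> p = q.
Proof.
move=> h; apply/subr0_eq; set r := p - q.
have hr l : leval (scal l) id r = 0.
  have ll : linear (leval (scal l) (@id V)).
    by apply: leval_linear => //; apply: scal_linear.
  by rewrite (linPB ll) h subrr.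
apply/lpolyP => m; have [hm|hm] := boolP (m \in lsupp r); last first.
  by rewrite lcoef_out // [RHS]mcoeff0.
rewrite [RHS]mcoeff0; apply: (chi_free (s := lsupp r)) hm => [|l].
  exact: fset_uniq.
by rewrite -leval_scal.
Qed.

End Characters.

Lemma scale_shift (R : pzRingType) (V : lmodType R) (a b : R) (u w : V) :
  a *: w + (u - b *: w) = u - (b - a) *: w.
Proof. by rewrite scalerBl; zmod. Qed.

(** * Values of cochains on words *)

Section Words.
Variables (C : closedFieldType) (A : assocConformalType C).

Definition letter : Type := (option C * A)%type.

Implicit Types (s : seq letter) (x y : A) (l : option C).

Definition l0 : letter := (Some 0, 0).

Definition nnone s := count (fun x : letter => ~~ isSome x.1) s.

Definition wt s : C := \sum_(x <- s) odflt 0 x.1.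

Definition lam s : option C := if nnone s == 0%N then Some (wt s) else None.

Definition close s : seq letter :=
  if s is x :: s' then
    if nnone s == 0%N then rcons (belast x s') (None, (last x s').2) else s
  else [::].

(** The operator substituted for the variable of a letter labelled [l], in a word whose scalars add
    up to [T]. With one label [None], all variables of the word add up to -del. *)
Definition act (T : C) l (w : A) : A :=
  if l is Some c then c *: w else - del w - T *: w.

Lemma nnone_cat s1 s2 : nnone (s1 ++ s2) = (nnone s1 + nnone s2)%N.
Proof. exact: count_cat. Qed.

Lemma wt_cat s1 s2 : wt (s1 ++ s2) = wt s1 + wt s2.
Proof. exact: big_cat. Qed.

Lemma wt_cons z s : wt (z :: s) = odflt 0 z.1 + wt s.
Proof. exact: big_cons. Qed.

Lemma wt_nil : wt [::] = 0.
Proof. exact: big_nil. Qed.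

Lemma close_open s : (0 < nnone s)%N -> close s = s.
Proof. by case: s => // x s; rewrite /close; case: eqP => [->|]. Qed.

Lemma close_rcons s z : nnone (rcons s z) = 0%N -> close (rcons s z) = rcons s (None, z.2).
Proof.
case: s => [|y s] h; rewrite /close /= -?/(rcons (y :: s) z) ?h //=.
  by move: h => /= ->.
by move: h => /= ->; rewrite belast_rcons last_rcons.
Qed.

Lemma size_close s : size (close s) = size s.
Proof. by case: s => // x s; rewrite /close; case: eqP => // _; rewrite size_rcons size_belast. Qed.

Lemma act_linear T l : linear (act T l).
Proof.
case: l => [d|] c u v; rewrite /act.
  by rewrite scalerDr !scalerA mulrC.
rewrite linearP opprD scalerDr scalerBr !scalerA [T * c]mulrC scalerN opprD.
by rewrite addrACA.
Qed.

Lemma del_linear : linear (del : A -> A).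
Proof. exact: linearP. Qed.

Lemma act_del T l w : act T l (del w) = del (act T l w).
Proof.
case: l => [c|]; rewrite /act; first by rewrite (linPZ del_linear).
by rewrite (linPB del_linear) (linPN del_linear) (linPZ del_linear).
Qed.

Lemma act_scale T l c w : act T l (c *: w) = c *: act T l w.
Proof. exact: linPZ (act_linear _ _) _ _. Qed.

Lemma act_comm T l l' w : act T l (act T l' w) = act T l' (act T l w).
Proof.
case: l' => [c|]; first by rewrite /= act_scale.
by rewrite [act T None w]/act (linPB (act_linear _ _)) (linPN (act_linear _ _))
  act_del act_scale.
Qed.

Lemma lam_cons c x s :
  lam ((Some c, x) :: s) = if lam s is Some d then Some (c + d) else None.
Proof. by rewrite /lam /= wt_cons; case: eqP. Qed.

(** The variables of a subword add up to the variable of the one letter that replaces it. If that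
    letter has label [None], the scalars of [s] no longer count in the total, hence [T - wt s]. *)
Lemma sum_act T s w : (nnone s <= 1)%N ->
  \sum_(z <- s) act T z.1 w = act (T - wt s) (lam s) w.
Proof.
elim: s => [|[l x] s IH]; first by rewrite big_nil /lam /= wt_nil scale0r.
rewrite big_cons wt_cons; case: l => [c|] h.
  rewrite IH // lam_cons /lam; case: eqP => _ /=; first by rewrite scalerDl.
  have -> : T - (c + wt s) = T - wt s - c by ring.
  exact: scale_shift.
have e : nnone s = 0%N by move: h => /=; lia.
rewrite (_ : odflt 0 (None, x).1 + wt s = wt s) ?add0r // IH ?e // addrC /lam /= e /=.
exact: scale_shift.
Qed.

Definition args n s : n.+1.-tuple A := [tuple (nth l0 s j).2 | j < n.+1].

Definition opers n s (i : 'I_n) : A -> A := act (wt s) (nth l0 s i).1.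

(* The value of phi at the letters of s, the i-th variable being the scalar    *)
(* attached to the i-th letter. The scalar of one letter may be replaced by    *)
(* None, and its variable is then -del minus the sum of the other scalars.     *)
(* This is what is always understood for the last letter, so its scalar is     *)
(* irrelevant if no other letter has None.                                     *)
Definition real n (phi : cmaps A n) s : A :=
  if (size s == n.+1) && (nnone s <= 1)%N then leval (@opers n s) id (phi (args n s)) else 0.

Definition real0 (v : A) s : A := if s is [::] then v else 0.

(** The properties of cochains on words that the composition laws use: sesquilinearity, in a form
    treating all arguments alike. [good_mod] concerns an element of [A] inserted behind the last
    letter with scalar 0: moving the label [None] to the letter before it changes the value only by
    an element of the image of [del + wt s]. *)
Record good n (F : seq letter -> A) : Prop := Good {
  good_out : forall s, (size s != n) || (1 < nnone s)%N -> F s = 0;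
  good_close : forall s, F (close s) = F s;
  good_linear : forall s1 l s2, linear (fun x => F (s1 ++ (l, x) :: s2));
  good_del : forall s1 c x s2, nnone (s1 ++ (Some c, x) :: s2) = 1%N ->
    F (s1 ++ (Some c, del x) :: s2) = - (c *: F (s1 ++ (Some c, x) :: s2));
  good_delN : forall s1 x s2,
    F (s1 ++ (None, del x) :: s2) = del (F (s1 ++ (None, x) :: s2))
      + wt (s1 ++ s2) *: F (s1 ++ (None, x) :: s2);
  good_mod : forall s x, (0 < size s)%N -> nnone s = 0%N ->
    exists z, F (close s ++ [:: (Some 0, x)]) - F (s ++ [:: (Some 0, x)]) =
      del z + wt s *: z
}.

Lemma good_real0 v : good 0 (real0 v).
Proof.
split.
- by case.
- by case=> // x s; rewrite /close; case: ifP => //; case: s.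
- by case=> [|? ?] l s2 c x y /=; rewrite scaler0 addr0.
- by case=> [|? ?] * /=; rewrite scaler0 oppr0.
- by case=> [|? ?] * /=; rewrite scaler0 addr0 raddf0.
- move=> s x s0 _; exists 0; rewrite raddf0 scaler0 addr0.
  have E s' : (0 < size s')%N -> real0 v (s' ++ [:: (Some 0, x)]) = 0 by case: s'.
  by rewrite !E ?subrr ?size_close.
Qed.

Lemma opers_linear n s (i : 'I_n) : linear (@opers n s i).
Proof. exact: act_linear. Qed.

Lemma opers_comm n s (i j : 'I_n) w : @opers n s i (opers s j w) = opers s j (opers s i w).
Proof. exact: act_comm. Qed.

Section Real.
Variables (n : nat) (phi : cmaps A n).

Lemma isSome_nth s j : nnone s = 0%N -> isSome (nth l0 s j).1.
Proof. by elim: s j => [|[[c|] x] s IH] [|j] //= /IH. Qed.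

Lemma real_out s : (size s != n.+1) || (1 < nnone s)%N -> real phi s = 0.
Proof. by rewrite /real ltnNge -negb_and => /negPf ->. Qed.

Lemma realE s : size s = n.+1 -> (nnone s <= 1)%N ->
  real phi s = leval (@opers n s) id (phi (args n s)).
Proof. by rewrite /real => -> ->; rewrite eqxx. Qed.

Lemma nth_letter s1 (z z' : letter) s2 j : z.1 = z'.1 ->
  (nth l0 (s1 ++ z :: s2) j).1 = (nth l0 (s1 ++ z' :: s2) j).1.
Proof.
by move=> e; rewrite !nth_cat; case: ifP => // _; case: (j - _)%N.
Qed.

Lemma real_upd s1 l x v s2 (i : 'I_n.+1) : size s1 = i ->
    let s := s1 ++ (l, x) :: s2 in size s = n.+1 -> (nnone s <= 1)%N ->
  real phi (s1 ++ (l, v) :: s2) = leval (@opers n s) id (phi (upd i v (args n s))).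
Proof.
move=> ei s es hs.
rewrite realE; last 2 first.
- by rewrite -es !size_cat.
- by move: hs; rewrite !nnone_cat.
have -> : args n (s1 ++ (l, v) :: s2) = upd i v (args n s).
  apply: eq_from_tnth => j; rewrite !tnth_mktuple -val_eqE /= -ei nth_cat.
  case: ltngtP => // h; last by rewrite h subnn.
    by rewrite nth_cat h.
  by rewrite nth_cat ltnNge ltnW //= -(subnSK h).
apply: eq_leval => // j w; rewrite /opers (nth_letter _ (z' := (l, x))) //.
by rewrite !wt_cat !wt_cons.
Qed.

Lemma real_close s : real phi (close s) = real phi s.
Proof.
have [h|h] := posnP (nnone s); last by rewrite close_open.
case/lastP: s h => [//|s z] h; rewrite close_rcons //.
have hs : nnone s = 0%N /\ isSome z.1.
  by move: h; rewrite -cats1 nnone_cat /=; case: (z.1) => //=; lia.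
rewrite -!cats1 /real !size_cat !nnone_cat /= hs.1.
case: eqP => //= es; rewrite hs.2 /=.
have -> : args n (s ++ [:: (None, z.2)]) = args n (s ++ [:: z]).
  apply: eq_from_tnth => j; rewrite !tnth_mktuple !nth_cat; case: ifP => // _.
  by case: (_ - _)%N => // j'; rewrite !nth_nil.
apply: eq_leval => // j w; rewrite /opers !nth_cat.
have -> : (j < size s)%N by have := ltn_ord j; lia.
have := isSome_nth j hs.1.
by case: (nth l0 s j).1.
Qed.

Hypothesis hphi : is_cochain phi.

Lemma real_linear s1 l s2 : linear (fun x => real phi (s1 ++ (l, x) :: s2)).
Proof.
move=> c x y; set s := s1 ++ (l, 0) :: s2.
have [hb|] := boolP ((size s != n.+1) || (1 < nnone s)%N).
  rewrite !real_out ?scaler0 ?addr0 //; by move: hb; rewrite /s !nnone_cat !size_cat.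
rewrite negb_or negbK -leqNgt => /andP[/eqP es hs].
have hi : (size s1 < n.+1)%N by rewrite -es size_cat /=; lia.
rewrite !(real_upd _ (i := Ordinal hi) (x := 0)) // (cochain_linear hphi).
by rewrite leval_linear //; apply: opers_linear.
Qed.

(** Also for the last argument: [del] plus the variables of the other letters is minus the variable
    of the last one. *)
Lemma real_del s1 l x s2 : let s := s1 ++ (l, x) :: s2 in nnone s = 1%N ->
  real phi (s1 ++ (l, del x) :: s2) = - act (wt s) l (real phi s).
Proof.
move=> s hs.
have [es|hb] := eqVneq (size s) n.+1; last first.
  rewrite [real phi s]real_out ?hb // real_out ?(linP0 (act_linear _ _)) ?oppr0 //.
  by move: hb; rewrite !size_cat /= => ->.
have hi : (size s1 < n.+1)%N by rewrite -es size_cat /=; lia.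
rewrite !(real_upd _ (i := Ordinal hi) (x := x)) ?hs // -/s.
have ex : x = tnth (args n s) (Ordinal hi).
  by rewrite tnth_mktuple nth_cat ltnn subnn.
have eu : upd (Ordinal hi) x (args n s) = args n s.
  by apply: eq_from_tnth => j; rewrite tnth_mktuple; case: eqP => // ->.
rewrite eu.
have evl : linear (leval (@opers n s) (@id A)).
  by apply: leval_linear => //; apply: opers_linear.
have el : (nth l0 s (size s1)).1 = l by rewrite nth_cat ltnn subnn.
have [hin|hin] := ltnP (size s1) n.
  have ei : Ordinal hi = widen_ord (leqnSn n) (Ordinal hin) by apply: val_inj.
  rewrite {1}ex ei cochain_del // (linPN evl) leval_lamX //.
  - by rewrite /opers el.
  - exact: opers_linear.
  - exact: opers_comm.
have ei : Ordinal hi = ord_max by apply: val_inj => /=; lia.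
rewrite {1}ex ei cochain_del_last // (linPD evl) (linP_sum evl).
rewrite leval_lmap //; [|exact: opers_linear|exact: del_linear].
rewrite -(@leval_morph _ n A A A (@opers n s) (@opers n s) id del); last 2 first.
- exact: del_linear.
- by move=> i w; rewrite /opers act_del.
under eq_bigr => i _ do
  rewrite (leval_lamX (@opers_linear n s) (fun _ _ _ => erefl) (@opers_comm n s)).
set w := leval _ _ _.
have es2 : s2 = [::] by move: es hin; rewrite size_cat; case: (s2) => //= *; lia.
have -> : \sum_(i < n) opers s i w = \sum_(z <- s1) act (wt s) z.1 w.
  have es1 : size s1 = n by lia.
  rewrite (big_nth l0) big_mkord /s es1.
  by apply: eq_bigr => i _; rewrite /opers nth_cat es1 ltn_ord.
have hs1 : (nnone s1 <= 1)%N by move: hs; rewrite nnone_cat; lia.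
rewrite sum_act // /s wt_cat wt_cons es2 wt_nil addr0.
move: hs; rewrite nnone_cat es2 /lam; case: (l) => [c|] /= h.
  have -> : nnone s1 = 1%N by lia.
  have -> : wt s1 + c - wt s1 = c by ring.
  by rewrite /= addrA subrr add0r.
have -> : nnone s1 = 0%N by lia.
by rewrite /= addr0 opprB opprK addrC.
Qed.

Lemma good_real : good n.+1 (real phi).
Proof.
split.
- exact: real_out.
- exact: real_close.
- exact: real_linear.
- by move=> s1 c x s2 /real_del.
- move=> s1 x s2.
  have [h|h] := eqVneq (nnone (s1 ++ (None, x) :: s2)) 1%N.
    by rewrite real_del //= opprB opprK addrC !wt_cat wt_cons add0r.
  rewrite !real_out ?raddf0 ?scaler0 ?addr0 //; move: h; rewrite !nnone_cat /=; lia.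
- move=> s x s0 hs.
  case/lastP: s s0 hs => // s z _ hs; rewrite close_rcons //.
  have [e|ne] := eqVneq (size s).+1 n; last first.
    exists 0; rewrite !real_out ?raddf0 ?scaler0 ?addr0 ?subr0 //;
      by rewrite !size_cat !size_rcons /=; apply/orP; left; lia.
  move: hs; rewrite -!cats1 nnone_cat => hs.
  have hs1 : nnone s = 0%N by lia.
  rewrite !realE; rewrite ?size_cat ?nnone_cat /=; [|lia..].
  have -> : args n ((s ++ [:: (None, z.2)]) ++ [:: (Some 0, x)]) =
            args n ((s ++ [:: z]) ++ [:: (Some 0, x)]).
    apply: eq_from_tnth => j; rewrite !tnth_mktuple -!catA !nth_cat.
    by case: ifP => // _; case: (_ - _)%N.
  set s' := s ++ [:: z]; set u := s' ++ _.
  (* The two evaluations differ in the operator of the letter [z] only: -del - wt s against the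
     scalar c of [z], and the difference is minus [del + wt s']. *)
  pose S w := exists y, w = del y + wt s' *: y.
  apply: (@leval_sub_mod _ n A _ _ S).
  + exact: opers_linear.
  + by exists 0; rewrite raddf0 scaler0 addr0.
  + move=> _ _ [y ->] [y' ->]; exists (y + y').
    by rewrite raddfD scalerDr addrACA.
  + move=> i _ [y ->]; exists (opers ((s ++ [:: (None, z.2)]) ++ [:: (Some 0, x)]) i y).
    by rewrite (linPD (@opers_linear _ _ _)) /opers act_del act_scale.
  + move=> i w; rewrite /opers /u /s' -!catA !nth_cat; case: ltnP => hi.
      have hT T : act T (nth l0 s i).1 w = act 0 (nth l0 s i).1 w.
        have := isSome_nth i hs1.
        by case: (nth l0 s i).1.
      by exists 0; rewrite (hT (wt _)) (hT (wt _)) subrr raddf0 scaler0 addr0.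
    have -> : (i - size s)%N = 0%N by have := ltn_ord i; lia.
    have hz : isSome z.1 by move: hs; rewrite /=; case: (z.1) => //=; lia.
    exists (- w) => /=; rewrite /s' !wt_cat !wt_cons !wt_nil.
    by case: (z.1) hz => //= c _; rewrite !addr0 raddfN scalerN scalerDl opprD addrA.
Qed.

End Real.
End Words.

(** * Composition of functions on words *)

Section Composition.
Variables (C : closedFieldType) (A : assocConformalType C).
Local Notation letter := (letter A).
Implicit Types (s a b d e : seq letter) (x y : A) (l : option C).
Implicit Types F G H : seq letter -> A.

Definition wcomp0 n i F G s : A :=
  F (take i s ++ (lam (take n (drop i s)), G (take n (drop i s))) :: drop (i + n) s).

(** Closing first decides, from the whole word, whether the letter with the dependent variable lies
    in the subword given to [G], and so which label the value of [G] receives. *)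
Definition wcomp n i F G s : A := wcomp0 n i F G (close s).

Lemma wcomp0_cat n i F G a s b : size a = i -> size s = n ->
  wcomp0 n i F G (a ++ s ++ b) = F (a ++ (lam s, G s) :: b).
Proof.
move=> <- <-; rewrite /wcomp0 take_size_cat // drop_size_cat // take_size_cat //.
by rewrite catA -size_cat drop_size_cat.
Qed.

Lemma nnone_lam a s b x :
  nnone (a ++ (lam s, x) :: b) = (nnone a + (nnone s != 0) + nnone b)%N.
Proof. by rewrite nnone_cat /= /lam; case: (nnone s) => [|k] /=; lia. Qed.

Lemma lam_cat s a : lam (s ++ a) =
  if lam s is Some c then if lam a is Some d then Some (c + d) else None else None.
Proof.
rewrite /lam nnone_cat addn_eq0 wt_cat.
by case: (nnone s == 0)%N; case: (nnone a == 0)%N.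
Qed.

Lemma lam_lam a s b x : lam (a ++ (lam s, x) :: b) = lam (a ++ s ++ b).
Proof.
rewrite -cat1s !lam_cat; have -> : lam [:: (lam s, x)] = lam s; last by [].
by rewrite {1}/lam /=; case: (lam s) => //= c; rewrite wt_cons wt_nil addr0.
Qed.

Lemma close_split s1 l s2 : exists s1' l' s2', size s1' = size s1 /\
  forall x, close (s1 ++ (l, x) :: s2) = s1' ++ (l', x) :: s2'.
Proof.
have [h|h] := posnP (nnone (s1 ++ (l, 0) :: s2)); last first.
  by exists s1, l, s2; split=> // x; rewrite close_open //; move: h; rewrite !nnone_cat.
have hx x : nnone (s1 ++ (l, x) :: s2) = 0%N by move: h; rewrite !nnone_cat.
case/lastP: s2 {h} hx => [|s2 z] hx.
  exists s1, None, [::]; split=> // x; move: (hx x); rewrite !cats1 => h.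
  by rewrite close_rcons.
exists s1, l, (rcons s2 (None, z.2)); split=> // x; move: (hx x).
by rewrite -!rcons_cons -!rcons_cat => h; rewrite close_rcons.
Qed.

(** The marked letter between [s1] and [s2] lies before, inside or after the subword given to the
    inner function. *)
Lemma word_cases n i (s1 s2 : seq letter) : (i + n <= size s1 + (size s2).+1)%N ->
  [\/ exists t s b, [/\ s2 = t ++ s ++ b, i = ((size s1).+1 + size t)%N & size s = n],
      exists a b d e, [/\ s1 = a ++ b, s2 = d ++ e, size a = i
                        & (size b + (size d).+1)%N = n]
    | exists a s b, [/\ s1 = a ++ s ++ b, size a = i & size s = n]].
Proof.
move=> h; have [h1|h1] := ltnP (size s1) i.
  apply: Or31; exists (take (i - (size s1).+1) s2).
  exists (take n (drop (i - (size s1).+1) s2)), (drop n (drop (i - (size s1).+1) s2)).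
  rewrite !cat_take_drop !size_takel ?size_drop //; [split=> //|..]; lia.
have [h2|h2] := ltnP (size s1) (i + n).
  apply: Or32; exists (take i s1), (drop i s1).
  exists (take (i + n - (size s1).+1) s2), (drop (i + n - (size s1).+1) s2).
  rewrite !cat_take_drop !size_takel ?size_drop //; [split=> //|..]; lia.
apply: Or33; exists (take i s1), (take n (drop i s1)), (drop n (drop i s1)).
rewrite !cat_take_drop !size_takel ?size_drop //; lia.
Qed.

Section Comp.
Variables (m n i : nat) (F G : seq letter -> A).
Hypothesis im : (i < m)%N.
Hypothesis Fout : forall s, (size s != m) || (1 < nnone s)%N -> F s = 0.
Hypothesis Flin : forall s1 l s2, linear (fun x => F (s1 ++ (l, x) :: s2)).
Hypothesis Gout : forall s, (size s != n) || (1 < nnone s)%N -> G s = 0.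
Hypothesis Glin : forall s1 l s2, linear (fun x => G (s1 ++ (l, x) :: s2)).

Lemma wcomp0_short s : (size s < i + n)%N -> wcomp0 n i F G s = 0.
Proof.
move=> h; have [hi|hi] := leqP i (size s).
  rewrite /wcomp0 (@Gout (take _ _)); first exact: linP0 (Flin _ _ _).
  by apply/orP; left; rewrite size_take_min size_drop; lia.
rewrite /wcomp0 Fout // size_cat take_oversize ?drop_oversize /=; [|lia..].
by apply/orP; left; lia.
Qed.

Lemma wcomp0_out s : ((size s).+1 != (m + n)%N) || (1 < nnone s)%N -> wcomp0 n i F G s = 0.
Proof.
have [h|h] := ltnP (size s) (i + n); first by rewrite wcomp0_short.
rewrite -[s](cat_take_drop i) -[drop i s](cat_take_drop n).
rewrite wcomp0_cat ?size_takel ?size_drop; [|lia..].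
set a := take i s; set b := take n _; set d := drop n _.
rewrite !nnone_cat !size_cat => hs.
have [hb|hb] := ltnP 1 (nnone b).
  by rewrite (@Gout b) ?hb ?orbT //; apply: linP0 (Flin _ _ _).
have sb : size b = n by rewrite size_takel // size_drop; lia.
rewrite Fout // nnone_lam size_cat /=; move: hs; rewrite sb => /orP[h1|h1].
  by apply/orP; left; lia.
by apply/orP; right; lia.
Qed.

Lemma wcomp_out s : ((size s).+1 != (m + n)%N) || (1 < nnone s)%N -> wcomp n i F G s = 0.
Proof.
move=> h; rewrite /wcomp wcomp0_out // size_close.
by case/orP: h => [->//|h]; rewrite close_open ?h ?orbT //; lia.
Qed.

Lemma wcomp0_linear s1 l s2 : linear (fun x => wcomp0 n i F G (s1 ++ (l, x) :: s2)).
Proof.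
move=> c x y.
have [h|h] := ltnP (size s1 + (size s2).+1) (i + n).
  by rewrite !wcomp0_short ?size_cat // scaler0 addr0.
have [[t [s [b [-> ei es]]]]|[a [b [d [e [-> -> ea en]]]]]|[a [s [b [-> ea es]]]]] := word_cases h.
- have E z : s1 ++ (l, z) :: t ++ s ++ b = (s1 ++ (l, z) :: t) ++ s ++ b by rewrite -catA.
  rewrite !E !wcomp0_cat //; [|by rewrite size_cat /=; lia..].
  by rewrite -!catA /= Flin.
- have E z : (a ++ b) ++ (l, z) :: d ++ e = a ++ (b ++ (l, z) :: d) ++ e by rewrite -!catA.
  rewrite !E !wcomp0_cat //; [|by rewrite size_cat..].
  have el z : lam (b ++ (l, z) :: d) = lam (b ++ (l, 0) :: d).
    by rewrite /lam !nnone_cat !wt_cat !wt_cons.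
  by rewrite Glin (el (_ + _)) (el x) (el y) Flin.
- have E z : (a ++ s ++ b) ++ (l, z) :: s2 = a ++ s ++ (b ++ (l, z) :: s2) by rewrite -!catA.
  rewrite !E !wcomp0_cat //.
  by have := Flin (a ++ (lam s, G s) :: b) l s2 c x y; rewrite -!catA.
Qed.

Lemma wcomp_linear s1 l s2 : linear (fun x => wcomp n i F G (s1 ++ (l, x) :: s2)).
Proof.
have [s1' [l' [s2' [_ E]]]] := close_split s1 l s2.
by move=> c x y; rewrite /wcomp !E wcomp0_linear.
Qed.

End Comp.

Section GoodComp.
Variables (m n i : nat) (F G : seq letter -> A).
Hypotheses (im : (i < m)%N) (gF : good m F) (gG : good n G).

Let shortFG := wcomp0_short im (good_out gF) (good_linear gF) (good_out gG).

Lemma wcomp_del s1 c x s2 : nnone (s1 ++ (Some c, x) :: s2) = 1%N ->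
  wcomp n i F G (s1 ++ (Some c, del x) :: s2) =
  - (c *: wcomp n i F G (s1 ++ (Some c, x) :: s2)).
Proof.
move=> h1; have h1' : nnone (s1 ++ (Some c, del x) :: s2) = 1%N.
  by move: h1; rewrite !nnone_cat.
rewrite /wcomp !close_open ?h1 ?h1' //.
have [h|h] := ltnP (size s1 + (size s2).+1) (i + n).
  by rewrite !shortFG ?size_cat // scaler0 oppr0.
have [[t [s [b [e2 ei es]]]]|[a [b [d [e [e1 e2 ea en]]]]]|[a [s [b [e1 ea es]]]]] :=
  word_cases h.
- have E z : s1 ++ (Some c, z) :: t ++ s ++ b = (s1 ++ (Some c, z) :: t) ++ s ++ b.
    by rewrite -catA.
  rewrite e2 !E !wcomp0_cat //; [|by rewrite size_cat /=; lia..].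
  rewrite -!catA /= (good_del gF) //.
  by rewrite -cat_cons catA nnone_lam; move: h1; rewrite e2 !nnone_cat /= !nnone_cat; lia.
- have E z : (a ++ b) ++ (Some c, z) :: d ++ e = a ++ (b ++ (Some c, z) :: d) ++ e.
    by rewrite -!catA.
  rewrite e1 e2 !E !wcomp0_cat //; [|by rewrite size_cat..].
  have el : lam (b ++ (Some c, del x) :: d) = lam (b ++ (Some c, x) :: d).
    by rewrite /lam !nnone_cat !wt_cat !wt_cons.
  rewrite el; have Fl := good_linear gF.
  (* If [None] is in the subword, the rule for [G] applies directly. Otherwise [G] closes its
     subword; when this relabels the marked letter, [G] yields [del + wt b], and [F] replaces [del]
     by -(wt b + c), which leaves -c. *)
  have [hb|hb] := posnP (nnone (b ++ (Some c, x) :: d)); last first.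
    rewrite (good_del gG) ?(linPN (Fl _ _ _)) ?(linPZ (Fl _ _ _)) //.
    by move: h1 hb; rewrite e1 e2 !nnone_cat /= !nnone_cat; lia.
  have hb' : nnone (b ++ (Some c, del x) :: d) = 0%N by move: hb; rewrite !nnone_cat.
  case/lastP: d => [|d z] in e2 en el hb hb' E *.
    rewrite -(good_close gG (b ++ [:: (Some c, del x)])) !cats1 close_rcons -?cats1 //.
    rewrite -(good_close gG (b ++ [:: (Some c, x)])) cats1 close_rcons -?cats1 //.
    rewrite (good_delN gG) cats0; set y := G _.
    have hl : lam (b ++ [:: (Some c, x)]) = Some (wt b + c).
      by rewrite /lam hb wt_cat wt_cons wt_nil addr0.
    rewrite hl (linPD (Fl _ _ _)) (linPZ (Fl _ _ _)) (good_del gF).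
      by rewrite scalerDl opprD addrAC addNr add0r.
    by move: h1 hb; rewrite e1 e2 !nnone_cat /= ?nnone_cat /=; lia.
  rewrite -(good_close gG (b ++ (Some c, del x) :: _)).
  rewrite -(good_close gG (b ++ (Some c, x) :: _)).
  move: hb hb'; rewrite -!rcons_cons -!rcons_cat => hb hb'.
  rewrite !close_rcons // !rcons_cat !rcons_cons (good_del gG).
    by rewrite (linPN (Fl _ _ _)) (linPZ (Fl _ _ _)).
  by move: hb; rewrite -!cats1 !nnone_cat /= ?nnone_cat /=; lia.
- have E z : (a ++ s ++ b) ++ (Some c, z) :: s2 = a ++ s ++ (b ++ (Some c, z) :: s2).
    by rewrite -!catA.
  rewrite e1 !E !wcomp0_cat //.
  have := @good_del _ _ _ _ gF (a ++ (lam s, G s) :: b) c x s2.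
  rewrite -!catA /=; apply; rewrite nnone_lam.
  by move: h1; rewrite e1 !nnone_cat /=; lia.
Qed.

Lemma wcomp_delN s x : nnone s = 0%N ->
  wcomp n i F G (rcons s (None, del x)) = del (wcomp n i F G (rcons s (None, x)))
    + wt s *: wcomp n i F G (rcons s (None, x)).
Proof.
move=> h0; have hc y : close (rcons s (None, y)) = rcons s (None, y).
  by rewrite close_open // -cats1 nnone_cat /=; lia.
rewrite /wcomp !hc -!cats1.
have [h|h] := ltnP (size s + 1) (i + n).
  by rewrite !shortFG ?size_cat // raddf0 scaler0 addr0.
have Fl := good_linear gF.
have [[t [u [b [e2 ei es]]]]|[a [b [d [e [e1 e2 ea en]]]]]|[a [u [b [e1 ea es]]]]] :=
  word_cases (s2 := [::]) h.
- case: t u b e2 ei es => // -[] // -[] // _ /= ei es.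
  have E y : s ++ [:: (None, y)] = (s ++ [:: (None, y)]) ++ [::] ++ [::] by rewrite !cats0.
  rewrite (E (del x)) (E x) !wcomp0_cat //; [|by rewrite size_cat /=; lia..].
  rewrite -!catA /= (good_delN gF) wt_cat wt_cons /lam /= !wt_nil.
  by rewrite !addr0.
- case: d e e2 en => // -[] // _ en.
  have E y : (a ++ b) ++ [:: (None, y)] = a ++ (b ++ [:: (None, y)]) ++ [::].
    by rewrite cats0 catA.
  rewrite e1 !E !wcomp0_cat //; [|by rewrite size_cat..].
  have el y : lam (b ++ [:: (None, y)]) = None.
    by rewrite /lam nnone_cat addn_eq0 andbF.
  rewrite !el (good_delN gG) (linPD (Fl _ _ _)) (linPZ (Fl _ _ _)) (good_delN gF).
  by rewrite !cats0 wt_cat scalerDl addrA.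
- have E y : (a ++ u ++ b) ++ [:: (None, y)] = a ++ u ++ (b ++ [:: (None, y)]).
    by rewrite -!catA.
  rewrite e1 !E !wcomp0_cat //.
  have := @good_delN _ _ _ _ gF (a ++ (lam u, G u) :: b) x [::].
  rewrite -!catA /= cats0 !wt_cat wt_cons => ->.
  have -> : lam u = Some (wt u); last by [].
  by move: h0; rewrite e1 /lam !nnone_cat; case: eqP => //; lia.
Qed.

End GoodComp.

Section CompositionLaws.
Variables (m n p : nat) (F G H : seq letter -> A).
Hypotheses (gF : good m F) (gG : good n G) (gH : good p H).

Let FGout i (im : (i < m)%N) :=
  wcomp_out im (good_out gF) (good_linear gF) (good_out gG).
Let FHout i (im : (i < m)%N) :=
  wcomp_out im (good_out gF) (good_linear gF) (good_out gH).
Let GHout i (im : (i < n)%N) :=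
  wcomp_out im (good_out gG) (good_linear gG) (good_out gH).
Let FGlin i (im : (i < m)%N) :=
  wcomp_linear im (good_out gF) (good_linear gF) (good_out gG) (good_linear gG).
Let FHlin i (im : (i < m)%N) :=
  wcomp_linear im (good_out gF) (good_linear gF) (good_out gH) (good_linear gH).

Lemma nnone0_cat s a : nnone (s ++ a) = 0%N -> nnone s = 0%N /\ nnone a = 0%N.
Proof. by move/eqP; rewrite nnone_cat addn_eq0 => /andP[/eqP -> /eqP ->]. Qed.

Lemma nnone_close s : (0 < size s)%N -> (nnone s <= 1)%N -> nnone (close s) = 1%N.
Proof.
move=> h0 h1; have [h|h] := posnP (nnone s); last by rewrite close_open //; lia.
case/lastP: s h0 h h1 => // s z _ h _; rewrite close_rcons //.
by move: h; rewrite -!cats1 !nnone_cat /=; lia.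
Qed.

Lemma close_cat_rcons s a z : nnone (s ++ rcons a z) = 0%N ->
  close (s ++ rcons a z) = s ++ close (rcons a z).
Proof.
move=> h; have [_ h'] := nnone0_cat h.
by rewrite close_rcons // -!rcons_cat close_rcons // rcons_cat.
Qed.

Lemma nnone_sub a s b x : (0 < nnone (a ++ s ++ b))%N ->
  (0 < nnone (a ++ (lam s, x) :: b))%N.
Proof. by rewrite nnone_lam !nnone_cat; lia. Qed.

(** Both sides are the same substitution, except that on the right the inner composite closes its
    subword before [H] is applied. This matters only if no label [None] is in that subword, and the
    cases are about its last letter. *)
Lemma wcomp_seq i j k : (i < m)%N -> (j < n)%N -> k.+1 = (n + p)%N ->
  wcomp p (i + j) (wcomp n i F G) H = wcomp k i F (wcomp p j G H).
Proof.
move=> im jn ek; apply: funext => s.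
have ijm : (i + j < (m + n).-1)%N by lia.
have [hb|] := boolP (((size s).+2 != (m + n + p)%N) || (1 < nnone s)%N).
  rewrite (@wcomp_out (m + n).-1 p _ _ _ ijm _ (FGlin im) (good_out gH)).
  - rewrite (@wcomp_out m k _ _ _ im (good_out gF) (good_linear gF)) //.
    + move=> t ht; apply: (GHout jn); case/orP: ht => ht; apply/orP; [left|by right].
      by move: ht; rewrite -ek; lia.
    + by case/orP: hb => hb; apply/orP; [left; lia|right].
  - move=> t ht; apply: (FGout im); case/orP: ht => ht; apply/orP; [left; lia|by right].
  - by case/orP: hb => hb; apply/orP; [left; lia|right].
rewrite negb_or negbK -leqNgt => /andP[/eqP es hs]; rewrite /wcomp.
have [s0|s0] := posnP (size s).
  have [e1 e2 e3] : [/\ i = 0, j = 0 & p = 0]%N by split; lia.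
  rewrite (size0nil s0) /close e1 e2 e3 /wcomp0 /= /lam /= !wt_nil.
  have -> : n = 1%N by lia.
  rewrite -(good_close gF [:: (Some 0, _)]) -(good_close gG [:: (Some 0, _)]).
  by rewrite /close.
have h1 := nnone_close s0 hs; have sz := size_close s.
move: (close s) h1 sz => {hs s0} w h1 sz.
have {es sz} es : (size w).+2 = (m + n + p)%N by lia.
rewrite -[w](cat_take_drop i) -[drop i w](cat_take_drop j).
set a := take i w; set b := take j _.
rewrite -[drop j _](cat_take_drop p) -[drop p _](cat_take_drop (n - j.+1)).
set h := take p _; set d := take (n - j.+1) _; set e := drop _ _.
have ea : size a = i by rewrite size_takel //; lia.
have eb : size b = j by rewrite size_takel // size_drop; lia.
have eh : size h = p by rewrite size_takel // !size_drop; lia.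
have ed : size d = (n - j.+1)%N by rewrite size_takel // !size_drop; lia.
have ew : w = a ++ b ++ h ++ d ++ e by rewrite !cat_take_drop.
have hn : (0 < nnone (a ++ b ++ h ++ d ++ e))%N by rewrite -ew h1.
rewrite [LHS](_ : _ = F (a ++ (lam (b ++ (lam h, H h) :: d), G (b ++ (lam h, H h) :: d)) :: e));
  last first.
  rewrite [a ++ b ++ _]catA wcomp0_cat ?size_cat ?ea ?eb //.
  rewrite close_open ?nnone_sub -?catA //.
  have -> : b ++ (lam h, H h) :: d ++ e = (b ++ (lam h, H h) :: d) ++ e by rewrite -catA.
  by rewrite wcomp0_cat // size_cat /= eb ed; lia.
rewrite lam_lam.
rewrite [RHS](_ : _ = F (a ++ (lam (b ++ h ++ d), wcomp0 p j G H (close (b ++ h ++ d))) :: e));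
  last first.
  have -> : b ++ h ++ d ++ e = (b ++ h ++ d) ++ e by rewrite -!catA.
  by rewrite wcomp0_cat // !size_cat eb eh ed; lia.
have [hm|hm] := posnP (nnone (b ++ h ++ d)); last first.
  by rewrite [close (b ++ h ++ d)]close_open // wcomp0_cat.
have hmx : nnone (b ++ (lam h, H h) :: d) = 0%N.
  by move: hm; rewrite nnone_lam !nnone_cat; lia.
case/lastP: d => [|d z] in ed ew hn hm hmx *; last first.
  have -> : b ++ h ++ rcons d z = (b ++ h) ++ rcons d z by rewrite catA.
  rewrite close_cat_rcons -?catA // close_rcons; last first.
    by move: hm; rewrite !nnone_cat; lia.
  rewrite wcomp0_cat // -[in LHS](good_close gG).
  move: hmx; rewrite -rcons_cons => hmx; rewrite close_cat_rcons //.
  rewrite rcons_cons -rcons_cons close_rcons //.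
  by have [] := nnone0_cat hmx.
rewrite cats0.
(* If the last letter belongs to [h], closing gives the value of [H] the label [None], just as [G]
   would by closing its own word. *)
case/lastP: h => [|h z] in eh ew hn hm hmx *; last first.
  have hm' : nnone (b ++ rcons h z) = 0%N by move: hm; rewrite cats0.
  have [_ hz] := nnone0_cat hm'.
  rewrite close_cat_rcons //.
  have -> : b ++ close (rcons h z) = b ++ close (rcons h z) ++ [::] by rewrite cats0.
  rewrite wcomp0_cat ?size_close // (good_close gH) -[in LHS](good_close gG).
  rewrite cats1 close_rcons; last by rewrite -cats1.
  rewrite (close_rcons hz) -[rcons b _]cats1.
  have -> // : lam (rcons h (None, z.2)) = None.
  by rewrite /lam -cats1 nnone_cat addn_eq0 andbF.
rewrite cats0.
have -> : close b = close b ++ [::] ++ [::] by rewrite !cats0.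
case: (posnP (size b)) => [b0|b0].
  by rewrite (size0nil b0) wcomp0_cat // -eb b0.
have hb : nnone b = 0%N by move: hm; rewrite !nnone_cat; lia.
rewrite wcomp0_cat ?size_close //.
have -> : lam ([::] : seq letter) = Some 0 by rewrite /lam /= wt_nil.
(* Here [H] is an element of [A] inserted after all of [b]. The two sides differ by
   [del z + wt b *: z] in a letter of [F] with scalar [wt b], where [F] vanishes on it. *)
have [z hz] := good_mod gG (H [::]) b0 hb.
have hl : lam b = Some (wt b) by rewrite /lam hb.
have Fl := good_linear gF; apply/esym/subr0_eq.
rewrite -(linPB (Fl _ _ _)) hz (linPD (Fl _ _ _)) (linPZ (Fl _ _ _)) hl.
rewrite (good_del gF) ?addNr // -hl nnone_lam hb /= addn0.
by move: h1; rewrite ew !nnone_cat /=; lia.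
Qed.

(** As n + p > 0, a word of the right length is nonempty and has a letter [None] once closed. The
    label survives either insertion, so nothing is closed a second time and both sides fill the same
    two slots of [F]. *)
Lemma wcomp_par i j : (i < j < m)%N -> (0 < n + p)%N ->
  wcomp p (j + n).-1 (wcomp n i F G) H = wcomp n i (wcomp p j F H) G.
Proof.
move=> ijm np; have [im jm] : (i < m)%N /\ (j < m)%N by lia.
have ijm' : ((j + n).-1 < (m + n).-1)%N by lia.
have im' : (i < (m + p).-1)%N by lia.
apply: funext => s.
have [hb|] := boolP (((size s).+2 != (m + n + p)%N) || (1 < nnone s)%N).
  rewrite (@wcomp_out (m + n).-1 p _ _ _ ijm' _ (FGlin im) (good_out gH)).
  - rewrite (@wcomp_out (m + p).-1 n _ _ _ im' _ (FHlin jm) (good_out gG)) //.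
    + move=> t ht; apply: (FHout jm); case/orP: ht => ht; apply/orP; [left; lia|by right].
    + by case/orP: hb => hb; apply/orP; [left; lia|right].
  - move=> t ht; apply: (FGout im); case/orP: ht => ht; apply/orP; [left; lia|by right].
  - by case/orP: hb => hb; apply/orP; [left; lia|right].
rewrite negb_or negbK -leqNgt => /andP[/eqP es hs]; rewrite /wcomp.
have s0 : (0 < size s)%N by lia.
have h1 := nnone_close s0 hs; have sz := size_close s.
move: (close s) h1 sz => {hs s0} w h1 sz.
have {es sz} es : (size w).+2 = (m + n + p)%N by lia.
rewrite -[w](cat_take_drop i) -[drop i w](cat_take_drop n).
set a := take i w; set b := take n _.
rewrite -[drop n _](cat_take_drop (j - i.+1)) -[drop (j - _) _](cat_take_drop p).
set d := take (j - _) _; set h := take p _; set e := drop _ _.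
have ea : size a = i by rewrite size_takel //; lia.
have eb : size b = n by rewrite size_takel // size_drop; lia.
have ed : size d = (j - i.+1)%N by rewrite size_takel // !size_drop; lia.
have eh : size h = p by rewrite size_takel // !size_drop; lia.
have ew : w = a ++ b ++ d ++ h ++ e by rewrite !cat_take_drop.
have hn : (0 < nnone (a ++ b ++ d ++ h ++ e))%N by rewrite -ew h1.
have -> : wcomp0 n i (wcomp p j F H) G (a ++ b ++ d ++ h ++ e) =
    F (a ++ (lam b, G b) :: d ++ (lam h, H h) :: e).
  rewrite wcomp0_cat // /wcomp (close_open (nnone_sub _ hn)).
  have E (x : letter) : a ++ x :: d ++ h ++ e = (a ++ x :: d) ++ h ++ e by rewrite -catA.
  by rewrite E wcomp0_cat -?catA //= size_cat /= ea ed; lia.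
have E : a ++ b ++ d ++ h ++ e = (a ++ b ++ d) ++ h ++ e by rewrite -!catA.
rewrite E in hn *; rewrite wcomp0_cat //; last by rewrite !size_cat ea eb ed; lia.
by rewrite (close_open (nnone_sub _ hn)) -!catA wcomp0_cat.
Qed.

End CompositionLaws.
End Composition.

Lemma scale_merge (R : pzRingType) (V : lmodType R) (a b : R) (u w : V) :
  - (u + a *: w) - b *: w = - u - (a + b) *: w.
Proof. by rewrite scalerDl; zmod. Qed.

(** * Composition of cochains is substitution on words *)

Section Cochains.
Variables (C : closedFieldType) (A : assocConformalType C).
Local Notation letter := (letter A).
Local Notation l0 := (l0 A).
Implicit Types (s a b e : seq letter) (l : option C).

Lemma nth_args n s j : (j < n.+1)%N -> nth 0 (args n s) j = (nth l0 s j).2.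
Proof. by move=> hj; rewrite -(tnth_nth 0 (args n s) (Ordinal hj)) tnth_mktuple. Qed.

Lemma sum_ord_block (V : zmodType) (F : nat -> V) k i n : (i + n <= k)%N ->
  \sum_(j < k | (i <= j < i + n)%N) F j = \sum_(0 <= j < n) F (i + j)%N.
Proof.
move=> h; rewrite -(big_mkord (fun j => (i <= j < i + n)%N)).
transitivity (\sum_(i <= j < i + n) F j); last first.
  by rewrite -{1}[i]add0n big_addn addKn; apply: eq_bigr => j _; rewrite addnC.
rewrite (big_nat_widen i _ k) // (big_nat_widenl i 0) //.
by apply: eq_bigl => j; rewrite andbC.
Qed.

Section LevalOpers.
Variables (k : nat) (s : seq letter).

Definition evs := leval (@opers _ A k s) id.

Lemma evs_linear : linear evs.
Proof. by apply: leval_linear => //; apply: opers_linear. Qed.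

Lemma evs_lamX i p : evs (lamX i p) = act (wt s) (nth l0 s i).1 (evs p).
Proof.
exact: (leval_lamX (@opers_linear _ A k s) (fun _ _ _ => erefl) (@opers_comm _ A k s)).
Qed.

Lemma evs_lamS i n p : (i + n <= k)%N ->
  evs (lamS i (i + n) p) = \sum_(0 <= j < n) act (wt s) (nth l0 s (i + j)).1 (evs p).
Proof.
move=> h; rewrite /evs
  (leval_lamS (@opers_linear _ A k s) (fun _ _ _ => erefl) (@opers_comm _ A k s)).
exact: (sum_ord_block (fun j => act (wt s) (nth l0 s j).1 (evs p))).
Qed.

Lemma evs_lamS1 i p : (i < k)%N ->
  evs (lamS i i.+1 p) = act (wt s) (nth l0 s i).1 (evs p).
Proof. by move=> h; rewrite -addn1 evs_lamS ?addn1 // big_nat1 addn0. Qed.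

Lemma evs_lmap_del p : evs (lmap del p) = del (evs p).
Proof.
have dl := @del_linear C A.
rewrite /evs leval_lmap //; last exact: opers_linear.
rewrite -(@leval_morph _ k A A A (@opers _ A k s) (@opers _ A k s) id del) //.
by move=> i w; rewrite /opers act_del.
Qed.

Lemma evs_lsubst n (t : 'I_n -> lpoly A k -> lpoly A k) (t' : 'I_n -> A -> A) p :
    (forall i q, evs (t i q) = t' i (evs q)) ->
  evs (lsubst t p) = leval t' id p.
Proof.
move=> h; rewrite /lsubst (leval_morph _ _ evs_linear h).
apply: eq_leval => // v; rewrite /= /evs leval_lconst //; exact: opers_linear.
Qed.

End LevalOpers.

Lemma real_comp_at m n k i (f : cmaps A m) (g : cmaps A n) :
    is_cochain f -> is_cochain g -> (i <= m)%N -> k = (m + n)%N ->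
  real (comp_at k i f g) = wcomp n.+1 i (real f) (real g).
Proof.
move=> hf hg im ek; have gf := good_real hf; have gg := good_real hg.
apply: funext => s.
have [hb|] := boolP ((size s != k.+1) || (1 < nnone s)%N).
  rewrite real_out //.
  rewrite (@wcomp_out _ _ m.+1 _ _ _ _ _ (good_out gf) (good_linear gf) (good_out gg)) //.
  by case/orP: hb => hb; apply/orP; [left; lia|right].
rewrite negb_or negbK -leqNgt => /andP[/eqP es hs].
rewrite -real_close /wcomp.
have {hs} h1 : nnone (close s) = 1%N by apply: nnone_close => //; lia.
move: (close s) h1 (size_close s) => w h1; rewrite es => {}es.
rewrite -[w](cat_take_drop i) -[drop i w](cat_take_drop n.+1).
set a := take i w; set b := take _ _; set e := drop _ _.
have ea : size a = i by rewrite size_takel //; lia.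
have eb : size b = n.+1 by rewrite size_takel // size_drop; lia.
have ew : a ++ b ++ e = w by rewrite !cat_take_drop.
have ee : size e = (m - i)%N.
  by move: es; rewrite -ew !size_cat ea eb; lia.
rewrite wcomp0_cat // ew realE ?h1 //.
have hw : (nnone a + (nnone b + nnone e))%N = 1%N by rewrite -!nnone_cat ew.
pose u v := a ++ (lam b, v) :: e.
have su v : size (u v) = m.+1 by rewrite size_cat /= ea ee; lia.
have nu v : (nnone (u v) <= 1)%N by rewrite nnone_lam; lia.
have wtu v : wt (u v) = wt a + odflt 0 (lam b) + wt e.
  by rewrite wt_cat wt_cons addrA.
have wtw : wt w = wt a + wt b + wt e by rewrite -ew !wt_cat addrA.
(* If [None] is outside [b], replacing [b] by one letter does not change the total of the scalars,
   so -del minus the total is the same operator. *)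
have hact j v x : (nth l0 (a ++ e) j).1 = x -> forall y : A, act (wt w) x y = act (wt (u v)) x y.
  case: x => // hx y; congr (_ - _ *: _).
  have hae : (0 < nnone (a ++ e))%N.
    by rewrite lt0n; apply/eqP => h; have := isSome_nth j h; rewrite hx.
  have hb : nnone b = 0%N by move: hae; rewrite nnone_cat; lia.
  by rewrite wtw wtu /lam hb.
have El : linear (fun v => real f (u v)) by apply: good_linear gf _ _ _.
(* The variables of [g] can be evaluated outside [f]: if [None] is in [b], the rule of [f] for [del]
   turns -del - wt b into -del - wt w. *)
pose tau (j : 'I_n) : A -> A := act (wt w) (nth l0 w (i + j)).1.
transitivity (leval tau (fun v => real f (u v)) (g (args n b))); last first.
  rewrite [real g b]realE //; last lia.
  rewrite (@leval_morph _ n _ _ _ (@opers _ A n b) tau _ (fun v => real f (u v))) //.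
  move=> j v; rewrite /tau -ew nth_cat ea ltnNge leq_addr /= addKn nth_cat eb.
  have -> : (j < n.+1)%N by have := ltn_ord j; lia.
  rewrite /opers; case ej : (nth l0 b j).1 => [c|] /=; first by rewrite (linPZ El).
  have hb : lam b = None.
    rewrite /lam; case: eqP => // hb.
    by have := isSome_nth j hb; rewrite ej.
  rewrite (linPB El) (linPN El) (linPZ El) /= /u hb (good_delN gf).
  have -> : wt (a ++ b ++ e) = wt (a ++ e) + wt b by rewrite !wt_cat; ring.
  exact: scale_merge.
have ew1 r : (r < i)%N -> nth l0 w r = nth l0 a r.
  by move=> hr; rewrite -ew nth_cat ea hr.
have ew2 r : (i < r)%N -> nth l0 w (r + n) = nth l0 e (r - i.+1).
  move=> hr; rewrite -ew nth_cat ea ltnNge (_ : (i <= r + n)%N) /=; last lia.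
  rewrite nth_cat eb ltnNge (_ : (n.+1 <= r + n - i)%N) /=; last lia.
  by congr (nth l0 e _); lia.
have hk := @evs_linear k w.
rewrite -/(@evs k w _) /comp_at (leval_morph _ _ hk (t := tau)); last first.
  by move=> j q; rewrite evs_lamS1 //; have := ltn_ord j; lia.
have -> : seg n.+1 (args k w) i = args n b.
  apply: eq_from_tnth => j; rewrite !tnth_mktuple nth_args; last by have := ltn_ord j; lia.
  by rewrite -ew nth_cat ea ltnNge leq_addr /= addKn nth_cat eb ltn_ord.
apply: eq_leval => // v /=; rewrite realE //.
have -> : [tuple if (j < i)%N then nth 0 (args k w) j
           else if j == i :> nat then v else nth 0 (args k w) (j + n) | j < m.+1] =
          args m (u v).
  apply: eq_from_tnth => j; rewrite !tnth_mktuple; have hj := ltn_ord j.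
  rewrite nth_cat ea; case: ltngtP => hji; last by rewrite hji subnn.
    by rewrite nth_args ?ew1 //; lia.
  by rewrite nth_args ?ew2 -?(subnSK hji) //; lia.
apply: evs_lsubst => j q; have hj := ltn_ord j; rewrite /opers.
case: ifP => hji.
  rewrite evs_lamS1; last lia.
  have -> : (nth l0 (u v) j).1 = (nth l0 w j).1.
    by rewrite ew1 // nth_cat ea hji.
  by apply: (hact j); rewrite ew1 // nth_cat ea hji.
case: eqP => [eji|nji].
  rewrite -addnS evs_lamS; last lia.
  have -> : (nth l0 (u v) j).1 = lam b by rewrite nth_cat ea eji ltnn subnn.
  transitivity (\sum_(z <- b) act (wt w) z.1 (@evs k w q)).
    rewrite (big_nth l0) eb; apply: eq_big_nat => r /andP[_ hr].
    by rewrite -ew nth_cat ea ltnNge leq_addr /= addKn nth_cat eb hr.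
  rewrite sum_act; last lia.
  rewrite wtw wtu; case: (lam b) => //=; rewrite addr0.
  by rewrite (_ : wt a + wt b + wt e - wt b = wt a + wt e) //; ring.
have ij : (i < j)%N by lia.
rewrite evs_lamS1; last lia.
have -> : (nth l0 (u v) j).1 = (nth l0 w (j + n)).1.
  by rewrite ew2 // nth_cat ea ltnNge (ltnW ij) /= -(subnSK ij).
apply: (hact j.-1); rewrite ew2 // nth_cat ea ltnNge (_ : (i <= j.-1)%N) /=; last lia.
by congr (nth l0 e _).1; lia.
Qed.

End Cochains.

(** * The operad of cochains *)

Section Operad.
Variables (C : closedFieldType) (A : assocConformalType C).
Hypothesis charC : [pchar C] =i pred0.
Local Notation letter := (letter A).
Local Notation l0 := (l0 A).
Implicit Types s : seq letter.

(** On these words [real phi] is the value of the polynomial [phi a] at the point [l]. *)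
Definition word n (l : 'I_n -> C) (a : n.+1.-tuple A) : seq letter :=
  rcons [seq (Some (l j), tnth a (widen_ord (leqnSn n) j)) | j <- enum 'I_n]
    (None, tnth a ord_max).

Section Word.
Variables (n : nat) (l : 'I_n -> C).

Lemma size_word a : size (word l a) = n.+1.
Proof. by rewrite size_rcons size_map size_enum_ord. Qed.

Lemma nnone_word a : nnone (word l a) = 1%N.
Proof.
rewrite /nnone /word -cats1 count_cat count_map (eq_count (a2 := pred0)) //.
by rewrite count_pred0.
Qed.

Lemma nth_word a (i : 'I_n) : nth l0 (word l a) i = (Some (l i), tnth a (widen_ord (leqnSn n) i)).
Proof.
rewrite nth_rcons size_map size_enum_ord ltn_ord.
by rewrite (nth_map i) ?size_enum_ord // nth_ord_enum.
Qed.

Lemma nth_word_last a : nth l0 (word l a) n = (None, tnth a ord_max).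
Proof. by rewrite nth_rcons size_map size_enum_ord ltnn eqxx. Qed.

Lemma nth_word2 a (i : 'I_n.+1) : (nth l0 (word l a) i).2 = tnth a i.
Proof.
have [h|h] := ltnP i n.
  have ei : i = widen_ord (leqnSn n) (Ordinal h) by apply: val_inj.
  by rewrite -[nat_of_ord i]/(nat_of_ord (Ordinal h)) nth_word -ei.
have ei : i = ord_max by apply: val_inj => /=; have := ltn_ord i; lia.
by rewrite ei nth_word_last.
Qed.

Lemma args_word a : args n (word l a) = a.
Proof. by apply: eq_from_tnth => i; rewrite tnth_mktuple nth_word2. Qed.

Lemma word_upd a i v :
  word l (upd i v a) =
    take i (word l a) ++ ((nth l0 (word l a) i).1, v) :: drop i.+1 (word l a).
Proof.
have hi := ltn_ord i.
apply: (@eq_from_nth _ l0).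
  rewrite size_cat /= size_takel ?size_drop !size_word //; lia.
rewrite size_word => j hj; rewrite [LHS]surjective_pairing.
have -> : (nth l0 (word l (upd i v a)) j).1 = (nth l0 (word l a) j).1.
  have [h|h] := ltnP j n; first by rewrite -[j]/(nat_of_ord (Ordinal h)) !nth_word.
  by rewrite (_ : j = n) ?nth_word_last //; lia.
have -> : (nth l0 (word l (upd i v a)) j).2 = tnth (upd i v a) (Ordinal hj).
  by rewrite -nth_word2.
rewrite tnth_mktuple -val_eqE /= nth_cat size_takel ?size_word //; last exact: ltnW.
case: ltngtP => h; last by rewrite h subnn.
- by rewrite nth_take // -(nth_word2 _ (Ordinal hj)) /= -surjective_pairing.
- rewrite -(subnSK h) /= nth_drop -(nth_word2 _ (Ordinal hj)) /= -surjective_pairing.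
  by congr (nth l0 _ _); lia.
Qed.

Lemma word_split a (i : 'I_n.+1) :
  word l a = take i (word l a) ++ nth l0 (word l a) i :: drop i.+1 (word l a).
Proof. by rewrite -drop_nth ?cat_take_drop // size_word. Qed.

Lemma real_word (phi : cmaps A n) a : real phi (word l a) = leval (scal l) id (phi a).
Proof.
rewrite realE ?size_word ?nnone_word // args_word; apply: eq_leval => // i w.
by rewrite /opers nth_word.
Qed.

End Word.

Lemma real_inj n : injective (@real C A n).
Proof.
move=> phi psi h; apply: funext => a; apply: (lpoly_eq_scal charC) => l.
by rewrite -!real_word h.
Qed.

(** Sesquilinearity is visible on words, so composites inherit it from [wcomp_linear], [wcomp_del]
    and [wcomp_delN]. *)
Lemma is_cochain_real n (phi : cmaps A n) :
    (forall s1 l s2, linear (fun x => real phi (s1 ++ (l, x) :: s2))) ->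
    (forall s1 c x s2, nnone (s1 ++ (Some c, x) :: s2) = 1%N ->
      real phi (s1 ++ (Some c, del x) :: s2) =
      - (c *: real phi (s1 ++ (Some c, x) :: s2))) ->
    (forall s x, nnone s = 0%N ->
      real phi (rcons s (None, del x)) =
      del (real phi (rcons s (None, x))) + wt s *: real phi (rcons s (None, x))) ->
  is_cochain phi.
Proof.
move=> hl hd hn.
have evl l : linear (leval (@scal C A n l) id) by apply: leval_linear => // i; apply: scal_linear.
have lX l i p : leval (scal l) id (lamX i p) = l i *: leval (@scal C A n l) id p.
  apply: leval_lamX => //; first exact: scal_linear.
  by move=> j j' w; rewrite /scal !scalerA mulrC.
split=> [i a c u v|i a|a]; apply: (lpoly_eq_scal charC) => l.
- by rewrite evl -!real_word !word_upd hl.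
- rewrite (linPN (evl l)) lX -!real_word word_upd nth_word [in RHS](word_split _ _ (widen_ord _ i)).
  have := word_split l a (widen_ord (leqnSn n) i); rewrite [nth _ _ _]nth_word /= => ew.
  by rewrite -hd ?nth_word // -ew nnone_word.
- rewrite (linPD (evl l)) (linP_sum (evl l)) -real_word.
  have hX i p : leval (scal l) id (lamX i p) = l i *: leval (@scal C A n l) id p by [].
  rewrite (eq_bigr _ (fun i _ => hX i _)) -scaler_suml -real_word.
  have -> : leval (scal l) id (lmap del (phi a)) = del (real phi (word l a)).
    have dl := @del_linear C A.
    rewrite leval_lmap //; last exact: scal_linear.
    rewrite real_word (@leval_morph _ n A A A (scal l) (scal l) id del) //.
    by move=> i w; rewrite /scal (linPZ dl).
  set s := [seq (Some (l j), tnth a (widen_ord (leqnSn n) j)) | j <- enum 'I_n].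
  have -> : word l (upd ord_max (del (tnth a ord_max)) a) = rcons s (None, del (tnth a ord_max)).
    rewrite /word tnth_mktuple eqxx; congr rcons; apply: eq_map => j.
    by rewrite tnth_mktuple -val_eqE /= ltn_eqF.
  have -> : \sum_i l i = wt s by rewrite /wt big_map big_enum.
  apply: hn; have := nnone_word l a.
  by rewrite /word -/s -cats1 nnone_cat /=; lia.
Qed.

Lemma is_cochain_comp_at m n k i (f : cmaps A m) (g : cmaps A n) :
    is_cochain f -> is_cochain g -> (i <= m)%N -> k = (m + n)%N ->
  is_cochain (comp_at k i f g).
Proof.
move=> hf hg im ek; have gf := good_real hf; have gg := good_real hg.
apply: is_cochain_real; rewrite (real_comp_at hf hg im ek).
- exact: (wcomp_linear (m := m.+1) im
    (good_out gf) (good_linear gf) (good_out gg) (good_linear gg)).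
- exact: (wcomp_del (m := m.+1) im gf gg).
- exact: (wcomp_delN (m := m.+1) im gf gg).
Qed.

(* Insertion of an element of A, the cochains of degree 0 being the elements   *)
(* of A modulo del A. The variable of f which corresponds to v is replaced by  *)
(* 0. If v is the last argument, then the last variable of f belongs to the    *)
(* argument before v, which is the last one of the result, so it is replaced   *)
(* by -del minus the sum of the remaining variables.                           *)
Definition insert n i (f : cmaps A n.+1) (v : A) : cmaps A n := fun a =>
  lsubst (fun j : 'I_n.+1 =>
      if (j < i)%N then
        if (j < n)%N then lamS j j.+1 else fun p => - lmap del p - lamS 0 n p
      else if j == i :> nat then fun=> 0 else lamS j.-1 j)
    (f [tuple if (j < i)%N then nth 0 a j
              else if j == i :> nat then v else nth 0 a j.-1 | j < n.+2]).

Lemma real_insert n i (f : cmaps A n.+1) (v : A) : is_cochain f -> (i <= n.+1)%N ->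
  real (insert i f v) = wcomp 0 i (real f) (real0 v).
Proof.
move=> hf im; have gf := good_real hf; have gv := good_real0 v.
apply: funext => s.
have [hb|] := boolP ((size s != n.+1) || (1 < nnone s)%N).
  rewrite real_out //.
  rewrite (@wcomp_out _ _ n.+2 _ _ _ _ im (good_out gf) (good_linear gf) (good_out gv)) //.
  by case/orP: hb => hb; apply/orP; [left; lia|right].
rewrite negb_or negbK -leqNgt => /andP[/eqP es hs].
rewrite -real_close /wcomp.
have {hs} h1 : nnone (close s) = 1%N by apply: nnone_close => //; lia.
move: (close s) h1 (size_close s) => w h1; rewrite es => {}es.
pose u := take i w ++ (Some 0, v) :: drop i w.
have st : size (take i w) = i by rewrite size_takel // es.
have wtu : wt u = wt w.
  by rewrite /u -[w in RHS](cat_take_drop i) !wt_cat wt_cons add0r.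
have ux : nnone u = 1%N by rewrite -h1 /u -[w in RHS](cat_take_drop i) !nnone_cat.
have ulo j : (j < i)%N -> nth l0 u j = nth l0 w j.
  by move=> h; rewrite /u nth_cat st h nth_take.
have ui : nth l0 u i = (Some 0, v) by rewrite /u nth_cat st ltnn subnn.
have uhi j : (i < j)%N -> nth l0 u j = nth l0 w j.-1.
  move=> h; rewrite /u nth_cat st ltnNge (ltnW h) /= -(subnSK h) /= nth_drop.
  by congr (nth l0 w _); lia.
have -> : wcomp0 0 i (real f) (real0 v) w = real f u.
  by rewrite /wcomp0 take0 addn0 /lam /= wt_nil.
rewrite !realE ?ux ?h1 //; last by rewrite /u size_cat /= st size_drop es; lia.
have -> : insert i f v (args n w) =
    lsubst (fun j : 'I_n.+1 =>
      if (j < i)%N then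
        if (j < n)%N then lamS j j.+1 else fun p => - lmap del p - lamS 0 n p
      else if j == i :> nat then fun=> 0 else lamS j.-1 j) (f (args n.+1 u)).
  congr (lsubst _ (f _)); apply: eq_from_tnth => j; rewrite !tnth_mktuple.
  have hj := ltn_ord j; case: ltngtP => h; last by rewrite h ui.
    by rewrite ulo // nth_args //; lia.
  by rewrite uhi // nth_args //; lia.
rewrite -/(@evs C A n w _); apply: evs_lsubst => j q; have hj := ltn_ord j.
have el := @evs_linear C A n w.
rewrite /opers wtu; case: ltngtP => h.
- rewrite ulo //; case: (ltnP j n) => hjn; first by rewrite evs_lamS1.
  have ej : nat_of_ord j = n by lia.
  rewrite (linPB el) (linPN el) evs_lmap_del.
  rewrite -[n in lamS 0 n]add0n evs_lamS // ej.
  move: (evs w q) h1 es => y {st wtu ux ulo ui uhi u el}; case/lastP: w => // s1 z h1.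
  rewrite size_rcons => -[es1].
  have -> : \sum_(0 <= r < n) act (wt (rcons s1 z)) (nth l0 (rcons s1 z) (0 + r)).1 y =
            \sum_(x <- s1) act (wt (rcons s1 z)) x.1 y.
    rewrite (big_nth l0) es1; apply: eq_big_nat => r /andP[_ hr].
    by rewrite add0n nth_rcons es1 hr.
  move: h1; rewrite -cats1 nnone_cat /= => h1.
  rewrite sum_act; last lia.
  rewrite nth_cat es1 ltnn subnn wt_cat wt_cons wt_nil addr0 /lam.
  move: h1; case: (z.1) => [c|] /= h1.
    have -> : nnone s1 = 1%N by lia.
    rewrite (_ : wt s1 + c - wt s1 = c); last by ring.
    by rewrite /= opprB addrA addrC addrA addNr add0r.
  have -> : nnone s1 = 0%N by lia.
  by rewrite /= addr0.
- rewrite uhi // -{2}[nat_of_ord j](prednK (leq_ltn_trans (leq0n i) h)) evs_lamS1 //.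
  by lia.
- by rewrite h ui /= scale0r (linP0 el).
Qed.

Lemma is_cochain_insert n i (f : cmaps A n.+1) (v : A) : is_cochain f -> (i <= n.+1)%N ->
  is_cochain (insert i f v).
Proof.
move=> hf im; have gf := good_real hf; have gv := good_real0 v.
apply: is_cochain_real; rewrite (real_insert v hf im).
- exact: (wcomp_linear (m := n.+2) im
    (good_out gf) (good_linear gf) (good_out gv) (good_linear gv)).
- exact: (wcomp_del (m := n.+2) im gf gv).
- exact: (wcomp_delN (m := n.+2) im gf gv).
Qed.

Lemma real_insert0 (f : cmaps A 0) (v : A) : is_cochain f ->
  wcomp 0 0 (real f) (real0 v) = real0 (real f [:: (None, v)]).
Proof.
move=> hf; have gf := good_real hf; have gv := good_real0 v.
apply: funext => -[|z s].
  rewrite /wcomp /wcomp0 /= /lam /= wt_nil -(good_close gf [:: (Some 0, v)]).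
  by rewrite /close.
by rewrite (@wcomp_out _ _ 1 _ _ _ _ _ (good_out gf) (good_linear gf) (good_out gv)).
Qed.

Definition arity n (F : seq letter -> A) : Prop :=
  match n with
  | 0 => exists v, F = real0 v
  | n'.+1 => exists2 phi : cmaps A n', is_cochain phi & F = real phi
  end.

(** Substitution with the sign (-1)^((n-1) i) absorbed, as [odd_operad] requires. *)
Definition scomp n i (F G : seq letter -> A) : seq letter -> A :=
  sg (~~ odd n && odd i) (wcomp n i F G).

Lemma arity_good n F : arity n F -> good n F.
Proof.
case: n => [[v ->]|n [phi hphi ->]]; [exact: good_real0|exact: good_real].
Qed.

Lemma realB n (phi psi : cmaps A n) : real (phi - psi) = real phi - real psi.
Proof.
apply: funext => s; rewrite -[RHS]/(real phi s - real psi s) /real.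
case: ifP => _; last by rewrite subrr.
exact: linPB (@evs_linear C A n s) _ _.
Qed.

Lemma sgE b (F : seq letter -> A) s : sg b F s = sg b (F s).
Proof. by case: b. Qed.

Lemma scomp_operad : odd_operad arity scomp.
Proof.
have wB m n i F G H : arity m H -> wcomp n i H (F - G) = wcomp n i H F - wcomp n i H G.
  move=> /arity_good gH; apply: funext => s; rewrite /wcomp /wcomp0.
  by rewrite !fctE (linPB (good_linear gH _ _ _)).
have wN m n i F b H : arity m H -> wcomp n i H (sg b F) = sg b (wcomp n i H F).
  move=> /arity_good gH; apply: funext => s; rewrite /wcomp /wcomp0 !sgE.
  by case: b => //=; rewrite (linPN (good_linear gH _ _ _)).
have wNl n i F b H : wcomp n i (sg b F) H = sg b (wcomp n i F H).
  by case: b.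
split.
- move=> [|n] f g.
    move=> [v ->] [v' ->]; exists (v - v'); apply: funext => -[|z s] //=.
    by rewrite fctE /= subrr.
  move=> [phi hphi ->] [psi hpsi ->]; exists (phi - psi); last by rewrite realB.
  by rewrite -[phi - psi]addrC -scaleN1r; apply: is_cochainP.
- move=> [|n]; first by exists 0; apply: funext => -[].
  exists 0; first exact: is_cochain0.
  by rewrite -(subrr (0 : cmaps A n)) realB subrr.
- move=> [|m] // n k i F G im ek [phi hphi ->] aG; rewrite /scomp.
  suff : arity k (wcomp n i (real phi) G).
    case: (_ && _) => //=; case: k {ek} => [|k].
      move=> [v ->]; exists (- v); apply: funext => -[|z s] //=.
      by rewrite fctE /= oppr0.
    move=> [psi hpsi ->]; exists (- psi).
      by rewrite -scaleN1r -[_ *: psi]addr0; apply: is_cochainP => //; apply: is_cochain0.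
    by rewrite -[- real psi]add0r -[- psi]add0r realB; congr (_ - _);
       rewrite -(subrr psi) realB subrr.
  case: n aG ek => [[v ->]|n [psi hpsi ->]] ek; last first.
    case: k ek => [|k] ek; first by lia.
    have ek' : k = (m + n)%N by lia.
    exists (comp_at k i phi psi); first exact: is_cochain_comp_at.
    by rewrite real_comp_at.
  case: m k phi hphi im ek => [|m] [|k] phi hphi im ek; try lia.
    have -> : i = 0%N by lia.
    by exists (real phi [:: (None, v)]); rewrite real_insert0.
  have {ek} ekm : k = m by lia.
  rewrite ekm; exists (insert i phi v); first exact: is_cochain_insert.
  by rewrite real_insert.
- move=> n i F G H; rewrite /scomp.
  have -> : wcomp n i (F - G) H = wcomp n i F H - wcomp n i G H by [].
  by case: (_ && _) => //=; rewrite opprD.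
- by move=> m n i F G H aH; rewrite /scomp (wB m) //; case: (_ && _) => //=; rewrite opprD.
- move=> m n p k i j F G H aF aG aH im jn ek; rewrite /scomp wNl (wN m) //.
  rewrite !sgg -(wcomp_seq (arity_good aF) (arity_good aG) (arity_good aH) im jn ek).
  congr sg; move/(congr1 odd): ek; rewrite /= !oddD.
  by case: (odd k); case: (odd n); case: (odd p); case: (odd i); case: (odd j).
- move=> m n p i j F G H aF aG aH ij np; rewrite /scomp !wNl !sgg.
  rewrite (wcomp_par (arity_good aF) (arity_good aG) (arity_good aH) ij np).
  have ho : odd (j + n) = ~~ odd (j + n).-1.
    by rewrite -[in LHS](@prednK (j + n)) //; lia.
  rewrite oddD in ho; congr sg; move: ho.
  by case: (odd _.-1); case: (odd n); case: (odd p); case: (odd i); case: (odd j).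
Qed.

End Operad.

(** * The conformal product evaluated on words *)

Section Hochschild.
Variables (C : closedFieldType) (A : assocConformalType C).
Hypothesis charC : [pchar C] =i pred0.
Local Notation letter := (letter A).
Local Notation l0 := (l0 A).
Local Notation arity := (@arity C A).
Local Notation scomp := (@scomp C A).
Local Notation M := (real (@mu_cochain C A)).
Let O := @scomp_operad C A charC.
Implicit Types s : seq letter.

Lemma is_cochain_mu : is_cochain (@mu_cochain C A).
Proof.
split=> [i a c u v|i a|a].
- rewrite /mu_cochain !tnth_mktuple.
  case: (unliftP ord0 i) => [j ->|->]; first by rewrite ord1 /= mu_linear_r.
  by rewrite /= mu_linear_l.
- rewrite ord1 /mu_cochain !tnth_mktuple /= -mu_del_l.
  by congr (mu (del (tnth a _)) _); apply: val_inj.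
- by rewrite /mu_cochain !tnth_mktuple /= mu_del_r big_ord1.
Qed.

Lemma arity_mu : arity 2 M.
Proof. by exists (@mu_cochain C A); first exact: is_cochain_mu. Qed.

Lemma real_muE (z z' : letter) : (nnone [:: z; z'] <= 1)%N ->
  M [:: z; z'] = leval (fun _ : 'I_1 => act (wt [:: z; z']) z.1) id (mu z.2 z'.2).
Proof.
move=> h; rewrite realE // /mu_cochain !tnth_mktuple.
by apply: eq_leval => // i w; rewrite /opers ord1.
Qed.

Lemma real_word_inj k (phi psi : cmaps A k) :
  (forall (l : 'I_k -> C) a, real phi (word l a) = real psi (word l a)) -> phi = psi.
Proof.
move=> h; apply: funext => a; apply: (lpoly_eq_scal charC) => l.
by rewrite -!real_word h.
Qed.

Section Eval.
Variables (k : nat) (l : 'I_k -> C) (a : k.+1.-tuple A).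
Local Notation W := (word l a).
Local Notation ev := (@evs C A k W).

Lemma ev_seg n o (phi : cmaps A n) : (o + n <= k)%N ->
  ev (lsubst (fun j : 'I_n => lamS (o + j) (o + j).+1) (phi (seg n.+1 a o))) =
  real phi (take n.+1 (drop o W)).
Proof.
move=> h; set s := take _ _.
have hs j : (j < n.+1)%N -> nth l0 s j = nth l0 W (o + j).
  by move=> hj; rewrite nth_take // nth_drop.
have ss : size s = n.+1 by rewrite size_takel // size_drop size_word; lia.
have ns : (nnone s <= 1)%N.
  rewrite -(nnone_word l a) -[W in X in (_ <= X)%N](cat_take_drop o).
  by rewrite -(cat_take_drop n.+1 (drop o W)) !nnone_cat -/s; lia.
rewrite realE // (evs_lsubst (t' := @opers C A n s)) => [|j q].
  congr (leval _ _ (phi _)); apply: eq_from_tnth => j; rewrite !tnth_mktuple hs //.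
  have hj : (o + j < k.+1)%N by have := ltn_ord j; lia.
  by rewrite -[(o + j)%N]/(nat_of_ord (Ordinal hj)) nth_word2 (tnth_nth 0).
have hj : (o + j < k)%N by have := ltn_ord j; lia.
rewrite evs_lamS1 // /opers hs; last exact: leqW (ltn_ord j).
by rewrite -[(o + j)%N]/(nat_of_ord (Ordinal hj)) nth_word.
Qed.

Lemma nnone_take c : (c <= k)%N -> nnone (take c W) = 0%N.
Proof.
move=> h; have := nnone_word l a; rewrite -{1}[W](cat_take_drop c) nnone_cat.
suff : (0 < nnone (drop c W))%N by lia.
rewrite -has_count; apply/(has_nthP l0); exists (k - c)%N.
  by rewrite size_drop size_word; lia.
by rewrite nth_drop subnKC // nth_word_last.
Qed.

Lemma ev_lamS c q : (c <= k)%N -> ev (lamS 0 c q) = wt (take c W) *: ev q.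
Proof.
move=> h; rewrite -[c in lamS 0 c]add0n evs_lamS //.
transitivity (\sum_(z <- take c W) act (wt W) z.1 (ev q)).
  rewrite (big_nth l0) size_takel ?size_word ?leqW //; apply: eq_big_nat => r /andP[_ hr].
  by rewrite add0n nth_take.
by rewrite sum_act ?nnone_take // /lam nnone_take.
Qed.

(** At a scalar point the sum of the first [c] variables becomes the sum of the first [c] scalars,
    so the conformal product with this parameter is [M] on two letters. *)
Lemma ev_lprod c P Q : (c <= k)%N ->
  ev (lprod (@mu C A) (lamS 0 c) P Q) = M [:: (lam (take c W), ev P); (None, ev Q)].
Proof.
move=> h; have el := @evs_linear C A k W.
set t := wt (take c W).
pose B x y := leval (fun _ : 'I_1 => fun w : A => t *: w) id (mu x y).
have tl : forall i : 'I_1, linear (fun w : A => t *: w).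
  by move=> _ d u v; rewrite scalerDr !scalerA mulrC.
have Bl y : linear (B^~ y).
  by move=> d u v; rewrite /B mu_linear_l leval_linear.
have Br x : linear (B x).
  by move=> d u v; rewrite /B mu_linear_r leval_linear.
have -> : M [:: (lam (take c W), ev P); (None, ev Q)] = B (ev P) (ev Q).
  by rewrite /lam nnone_take // real_muE.
pose T (i : 'I_k) (w : A) := l i *: w.
have eX i q : ev (lamX i q) = T i (ev q) by rewrite evs_lamX nth_word.
have Tl x (i : 'I_k) w : B x (T i w) = T i (B x w) by rewrite (linPZ (Br x)).
have Tl' y (i : 'I_k) w : B (T i w) y = T i (B w y) by rewrite (linPZ (Bl y)).
have evE p : ev p = leval T id p.
  by apply: eq_leval => // i w; rewrite /opers nth_word.
rewrite /lprod (leval_morph _ _ el eX) /=.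
rewrite [ev P in RHS]evE (leval_morph _ _ (Bl (ev Q)) (fun i w => Tl' (ev Q) i w)).
apply: eq_leval => // u /=.
rewrite (leval_morph _ _ el eX) [ev Q]evE (leval_morph _ _ (Br u) (Tl u)).
apply: eq_leval => // v /=.
by apply: evs_lsubst => j q; apply: ev_lamS.
Qed.

Lemma ev_lconst v : ev (lconst k v) = v.
Proof. by rewrite /evs leval_lconst //; apply: opers_linear. Qed.

End Eval.

Lemma evsE k (l : 'I_k -> C) a (phi : cmaps A k) :
  real phi (word l a) = @evs C A k (word l a) (phi a).
Proof. by rewrite realE ?size_word ?nnone_word // args_word. Qed.

Lemma close_word k (l : 'I_k -> C) (a : k.+1.-tuple A) : close (word l a) = word l a.
Proof. by rewrite close_open // nnone_word. Qed.

Lemma word_last k (l : 'I_k -> C) (a : k.+1.-tuple A) :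
  drop k (word l a) = [:: (None, tnth a ord_max)].
Proof.
rewrite (drop_nth l0) ?size_word // nth_word_last drop_oversize // size_word //.
Qed.

Lemma nnone_drop k (l : 'I_k -> C) (a : k.+1.-tuple A) c : (c <= k)%N ->
  lam (drop c (word l a)) = None.
Proof.
move=> h; have := nnone_word l a; rewrite -{1}[word l a](cat_take_drop c) nnone_cat.
by rewrite nnone_take // add0n /lam => ->.
Qed.

(** The first term of the Hochschild differential as an insertion in the product; [comp_at_mu_l]
    treats the last term. *)
Lemma comp_at_mu_r n (phi : cmaps A n) : is_cochain phi ->
  comp_at n.+1 1 (@mu_cochain C A) phi =
  fun a => lprod (@mu C A) (lamS 0 1) (lconst _ (nth 0 a 0))
    (lsubst (fun j : 'I_n => lamS j.+1 j.+2) (phi (seg n.+1 a 1))).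
Proof.
move=> hphi; apply: real_word_inj => l a.
rewrite (real_comp_at is_cochain_mu hphi) // evsE ev_lprod // ev_lconst.
rewrite (@ev_seg _ l a _ 1) //.
rewrite /wcomp close_word.
have sd : size (drop 1 (word l a)) = n.+1 by rewrite size_drop size_word subn1.
rewrite -[word l a in LHS](cat_take_drop 1) -[drop 1 _ in LHS]cats0.
rewrite wcomp0_cat ?size_takel ?size_word // nnone_drop //.
rewrite (take_oversize (s := drop 1 _)) ?sd //.
have -> : take 1 (word l a) = [:: nth l0 (word l a) 0].
  by rewrite (take_nth l0) ?size_word // take0.
rewrite -[0%N]/(nat_of_ord (ord0 : 'I_n.+1)) nth_word /= /lam /= wt_cons wt_nil addr0 (tnth_nth 0).
by [].
Qed.

Lemma comp_at_mu_l n (phi : cmaps A n) : is_cochain phi ->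
  comp_at n.+1 0 (@mu_cochain C A) phi =
  fun a => lprod (@mu C A) (lamS 0 n.+1)
    (lsubst (fun j : 'I_n => lamS j j.+1) (phi (seg n.+1 a 0))) (lconst _ (nth 0 a n.+1)).
Proof.
move=> hphi; apply: real_word_inj => l a.
rewrite (real_comp_at is_cochain_mu hphi) // evsE ev_lprod // ev_lconst.
rewrite (@ev_seg _ l a _ 0) // drop0.
rewrite /wcomp close_word -[word l a in LHS](cat_take_drop n.+1).
rewrite -[take n.+1 _ ++ _]/([::] ++ take n.+1 _ ++ _) wcomp0_cat ?size_takel ?size_word //.
by rewrite word_last (tnth_nth 0).
Qed.

Lemma cochain_cupE m n k (f : cmaps A m) (g : cmaps A n) : k = (m.+1 + n)%N ->
    is_cochain f -> is_cochain g ->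
  cochain_cup k f g = comp_at k m.+1 (comp_at m.+1 0 (@mu_cochain C A) f) g.
Proof.
move=> ek hf hg; apply: real_word_inj => l a.
have hmf : is_cochain (comp_at m.+1 0 (@mu_cochain C A) f).
  exact: (is_cochain_comp_at charC is_cochain_mu hf).
rewrite (real_comp_at hmf hg) // (real_comp_at is_cochain_mu hf) //.
rewrite evsE ev_lprod; last by rewrite ek leq_addr.
rewrite (@ev_seg _ l a _ 0); last by rewrite ek; lia.
rewrite (@ev_seg _ l a _ m.+1); last by rewrite ek.
rewrite drop0; set W := word l a.
have sd : size (drop m.+1 W) = n.+1 by rewrite size_drop size_word ek; lia.
have st : size (take m.+1 W) = m.+1 by rewrite size_takel ?size_word // ek; lia.
rewrite (take_oversize (s := drop _ _)) ?sd //.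
rewrite /wcomp close_word -[word l a in RHS](cat_take_drop m.+1) -/W.
rewrite -[drop m.+1 W in RHS]cats0 wcomp0_cat //.
rewrite nnone_drop; last by rewrite ek leq_addr.
rewrite close_open; last by rewrite nnone_cat /= addn1.
by rewrite -[take m.+1 W ++ _]/([::] ++ take m.+1 W ++ _) wcomp0_cat.
Qed.

End Hochschild.

(** * Differential, bracket and cup product in operadic terms *)

Section RealOps.
Variables (C : closedFieldType) (A : assocConformalType C).
Hypothesis charC : [pchar C] =i pred0.
Local Notation arity := (@arity C A).
Local Notation scomp := (@scomp C A).
Local Notation M := (real (@mu_cochain C A)).
Local Notation dd := (dd scomp M).
Let O := @scomp_operad C A charC.
Let aM := @arity_mu C A.
Let hmu := @is_cochain_mu C A.

Lemma real_zero n : real (0 : cmaps A n) = 0.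
Proof. by rewrite -(subrr (0 : cmaps A n)) realB subrr. Qed.

Lemma realN n (f : cmaps A n) : real (- f) = - real f.
Proof. by rewrite -[- f]add0r realB real_zero add0r. Qed.

Lemma realD n (f g : cmaps A n) : real (f + g) = real f + real g.
Proof. by rewrite -[g in LHS]opprK realB realN opprK. Qed.

Lemma real_sum n I (r : seq I) (Q : pred I) (F : I -> cmaps A n) :
  real (\sum_(i <- r | Q i) F i) = \sum_(i <- r | Q i) real (F i).
Proof. exact: (big_morph _ (@realD n) (@real_zero n)). Qed.

Lemma real_sign n k (f : cmaps A n) : real ((-1) ^+ k *: f) = sg (odd k) (real f).
Proof.
rewrite -signr_odd; case: (odd k) => /=; first by rewrite expr1 scaleN1r realN.
by rewrite expr0 scale1r.
Qed.

Lemma scomp_real m n k i (f : cmaps A m) (g : cmaps A n) :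
    is_cochain f -> is_cochain g -> (i <= m)%N -> k = (m + n)%N ->
  scomp n.+1 i (real f) (real g) = real ((-1) ^+ (n * i) *: comp_at k i f g).
Proof.
move=> hf hg im ek; rewrite real_sign (real_comp_at hf hg im ek) /scomp oddM /=.
by rewrite negbK.
Qed.

Lemma bul_real m n k (f : cmaps A m) (g : cmaps A n) :
    is_cochain f -> is_cochain g -> k = (m + n)%N ->
  bul scomp m.+1 n.+1 (real f) (real g) = real (bullet k f g).
Proof.
move=> hf hg ek; rewrite /bullet real_sum /bul big_mkord; apply: eq_bigr => i _.
by rewrite (scomp_real hf hg _ ek) // -ltnS.
Qed.

Lemma real_bracket m n k (f : cmaps A m) (g : cmaps A n) :
    is_cochain f -> is_cochain g -> k = (m + n)%N ->
  real (cochain_bracket k f g) = ebr scomp m.+1 n.+1 (real f) (real g).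
Proof.
move=> hf hg ek; rewrite /cochain_bracket realB real_sign /ebr (bul_real hf hg ek).
by rewrite (bul_real hg hf (etrans ek (addnC _ _))) oddM /= !negbK.
Qed.

Lemma real_cup m n k (f : cmaps A m) (g : cmaps A n) :
    is_cochain f -> is_cochain g -> k = (m.+1 + n)%N ->
  real (cochain_cup k f g) = ecup scomp M m.+1 n.+1 (real f) (real g).
Proof.
move=> hf hg ek; rewrite (cochain_cupE charC ek hf hg).
have hmf : is_cochain (comp_at m.+1 0 (@mu_cochain C A) f).
  exact: (is_cochain_comp_at charC hmu hf).
rewrite (real_comp_at hmf hg) // (real_comp_at hmu hf) //.
rewrite /ecup brace2M /scomp [~~ odd m.+1 && _]andbF.
by rewrite [odd m.+1 && _]andbC sgK.
Qed.

Lemma bul2 n F G : bul scomp 2 n F G = scomp n 0 F G + scomp n 1 F G.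
Proof. by rewrite /bul big_ltn // big_nat1. Qed.

Lemma diff_arith (V : zmodType) b (x y z : V) :
  x - y + sg b z = sg b (z + sg b x) - y.
Proof. by case: b => /=; zmod. Qed.

(** The two outer terms of the differential make up ± M•f, the inner ones -f•M. *)
Lemma real_diff n (f : cmaps A n) : is_cochain f -> real (diff f) = dd n.+1 (real f).
Proof.
move=> hf.
have -> : diff f = comp_at n.+1 1 (@mu_cochain C A) f
    + \sum_(i < n.+1) (-1) ^+ i.+1 *: comp_at n.+1 i f (@mu_cochain C A)
    + (-1) ^+ n.+2 *: comp_at n.+1 0 (@mu_cochain C A) f.
  rewrite (comp_at_mu_r charC hf) (comp_at_mu_l charC hf).
  apply: funext => a; rewrite [RHS]/(_ + _) /= /diff; congr (_ + _).
  by rewrite [RHS]/(_ + _) /= fct_sumE.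
rewrite !realD real_sum real_sign.
have -> : \sum_(i < n.+1) real ((-1) ^+ i.+1 *: comp_at n.+1 i f (@mu_cochain C A)) =
          - bul scomp n.+1 2 (real f) M.
  rewrite /bul big_mkord -sumrN; apply: eq_bigr => i _.
  rewrite (@scomp_real n 1 n.+1 i f _ hf hmu (ltn_ord i) (esym (addn1 n))).
  rewrite -realN -scaleNr.
  by rewrite mul1n exprS mulN1r.
rewrite /dd bul2 (@scomp_real 1 n n.+1 0 _ f hmu hf) //.
rewrite (@scomp_real 1 n n.+1 1 _ f hmu hf) // muln0 muln1 !real_sign /=.
rewrite negbK; exact: diff_arith.
Qed.

Lemma leval_at0 (p : lpoly A 1) : leval (fun _ w => 0 *: w) id p = lcoef p mone.
Proof.
have chi0 (m : 'X_{1..1}) : chi m (fun _ : 'I_1 => 0 : C) = (m == mone)%:R.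
  rewrite /chi big_ord1 expr0n; congr (nat_of_bool _)%:R.
  apply/eqP/eqP => [h|->]; last by rewrite cm1.
  by apply/eqP/cmP => i; rewrite cm1 ord1.
rewrite (leval_scal (fun=> 0)).
under eq_bigr => m _ do rewrite chi0.
rewrite (@lsumE C A 1 A (fun m v => (m == mone)%:R *: v) p (undup (mone :: lsupp p))).
- rewrite (bigD1_seq mone) ?undup_uniq ?mem_undup ?mem_head //= eqxx scale1r.
  by rewrite big1 ?addr0 // => m /negPf ->; rewrite scale0r.
- by move=> m; rewrite scaler0.
- exact: undup_uniq.
- by move=> m hm; rewrite mem_undup inE hm orbT.
Qed.

(** With [v] in the second slot of the product the variable becomes -del, and with [v] in the first
    slot it becomes 0; these are the two terms of d_0. *)
Lemma real_diff0 (v : A) : real (diff0 v) = dd 0 (real0 v).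
Proof.
have [psi hpsi E] : arity 1 (dd 0 (real0 v)).
  by apply: (ar_dd O aM); exists v.
rewrite E; congr real; apply: (real_word_inj charC) => l a; rewrite -E evsE.
have -> : word l a = [:: (None, tnth a ord0)].
  rewrite /word (_ : enum 'I_0 = [::]) /=; last by apply: size0nil; rewrite size_enum_ord.
  by congr [:: (_, tnth a _)]; apply: val_inj.
rewrite /diff0 /evs leval_lconst //; last exact: opers_linear.
rewrite /dd bul2 /bul big_geq // subr0 /scomp /= opprD opprK.
rewrite -[RHS]/(- wcomp 0 0 M (real0 v) _ + wcomp 0 1 M (real0 v) _) [RHS]addrC.
congr (_ - _).
  rewrite /wcomp close_open // /wcomp0 /= /lam /= wt_nil real_muE //=.
  rewrite !wt_cons wt_nil !addr0; apply: eq_leval => // i w.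
  by rewrite /= scale0r subr0.
rewrite /wcomp close_open // /wcomp0 /= /lam /= wt_nil real_muE //=.
by rewrite leval_at0.
Qed.

(** The insertions of [M] in its two slots carry opposite signs, so this is the associativity
    axiom. *)
Lemma mu_assoc_bul : bul scomp 2 2 M M = 0.
Proof.
rewrite bul2 (@scomp_real 1 1 2 0 _ _ hmu hmu) // (@scomp_real 1 1 2 1 _ _ hmu hmu) // -realD.
suff -> : comp_at 2 1 (@mu_cochain C A) (@mu_cochain C A) =
          comp_at 2 0 (@mu_cochain C A) (@mu_cochain C A).
  by rewrite muln0 muln1 expr0 expr1 scale1r scaleN1r subrr real_zero.
rewrite (comp_at_mu_r charC hmu) (comp_at_mu_l charC hmu); apply: funext => a.
have sE o (t : nat -> nat) : (forall j, t j = o + j)%N -> forall b c : A,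
    lsubst (fun j : 'I_1 => lamS (t j) (t j).+1) (mu b c) =
    lsubst (fun=> lamS o o.+1) (mu b c) :> lpoly A 2.
  by move=> h b c; congr (lsubst _ _); apply: funext => j; rewrite h ord1 addn0.
rewrite /mu_cochain (sE 1%N succn) // (sE 0%N id) // !tnth_mktuple /=.
by rewrite -mu_assoc.
Qed.

Lemma cocycle_real n (f : cmaps A n) : f \in @cocycle C A n ->
  arity n.+1 (real f) /\ dd n.+1 (real f) = 0.
Proof.
move=> /asboolP[hf df]; split; first by exists f.
by rewrite -real_diff // df real_zero.
Qed.

Lemma arity_cochain n (f : cmaps A n) : arity n.+1 (real f) -> is_cochain f.
Proof. by move=> [g hg /(real_inj charC) ->]. Qed.

Lemma real_cocycle n (f : cmaps A n) :
  arity n.+1 (real f) -> dd n.+1 (real f) = 0 -> f \in @cocycle C A n.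
Proof.
move=> /arity_cochain hf df; apply/asboolP; split=> //.
by apply: (real_inj charC); rewrite real_diff // df real_zero.
Qed.

Lemma coboundaryE n (f : cmaps A n) :
  is_coboundary f <-> exists2 F, arity n F & real f = dd n F.
Proof.
case: n f => [|n] f /=; split.
- by move=> [v ->]; exists (real0 v); [exists v|exact: real_diff0].
- by move=> [_ [v ->]]; rewrite -real_diff0 => /(real_inj charC) ->; exists v.
- by move=> [g [hg ->]]; exists (real g); [exists g|exact: real_diff].
- move=> [_ [g hg ->]]; rewrite -real_diff // => /(real_inj charC) ->.
  by exists g.
Qed.

End RealOps.

(** * The induced operations on cohomology *)

Section Cohomology.
Variables (C : closedFieldType) (A : assocConformalType C).
Hypothesis charC : [pchar C] =i pred0.
Local Notation letter := (letter A).
Local Notation arity := (@arity C A).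
Local Notation scomp := (@scomp C A).
Local Notation M := (real (@mu_cochain C A)).
Local Notation dd := (dd scomp M).
Local Notation ecup := (ecup scomp M).
Local Notation ebr := (ebr scomp).
Let O := @scomp_operad C A charC.
Let aM := @arity_mu C A.
Let MM := @mu_assoc_bul C A charC.
Implicit Types F G H : seq letter -> A.

Lemma scaleE c F (s : seq letter) : (c *: F) s = c *: F s.
Proof. by []. Qed.

Lemma realP n c (f g : cmaps A n) : real (c *: f + g) = c *: real f + real g.
Proof.
rewrite realD; congr (_ + _); apply: funext => s; rewrite scaleE /real.
case: ifP => _; last by rewrite scaler0.
exact: linPZ (@evs_linear C A n s) _ _.
Qed.

Lemma sgP b c F G : sg b (c *: F + G) = c *: sg b F + sg b G.
Proof. by case: b => //=; rewrite opprD scalerN. Qed.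

Lemma scompPl n i c F G H : scomp n i (c *: F + G) H = c *: scomp n i F H + scomp n i G H.
Proof. by rewrite /scomp -sgP. Qed.

Lemma scompPr m n i c F G H : arity m H ->
  scomp n i H (c *: F + G) = c *: scomp n i H F + scomp n i H G.
Proof.
move=> /arity_good gH; rewrite /scomp -sgP; congr sg; apply: funext => s.
exact: good_linear gH _ _ _ _ _ _.
Qed.

Lemma bulPl m n c F G H :
  bul scomp m n (c *: F + G) H = c *: bul scomp m n F H + bul scomp m n G H.
Proof.
by rewrite /bul scaler_sumr -big_split; apply: eq_bigr => i _; rewrite scompPl.
Qed.

Lemma bulPr m n c F G H : arity m H ->
  bul scomp m n H (c *: F + G) = c *: bul scomp m n H F + bul scomp m n H G.
Proof.
move=> aH; rewrite /bul scaler_sumr -big_split; apply: eq_bigr => i _.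
by rewrite (scompPr _ _ _ _ _ aH).
Qed.

Lemma ebrPl m n c F G H : arity n H ->
  ebr m n (c *: F + G) H = c *: ebr m n F H + ebr m n G H.
Proof.
by move=> aH; rewrite /ebr bulPl (bulPr _ _ _ _ aH) sgP opprD addrACA scalerBr.
Qed.

Lemma ebrPr m n c F G H : arity m H ->
  ebr m n H (c *: F + G) = c *: ebr m n H F + ebr m n H G.
Proof.
by move=> aH; rewrite /ebr bulPl (bulPr _ _ _ _ aH) sgP opprD addrACA scalerBr.
Qed.

Lemma ecupPl m n c F G H :
  ecup m n (c *: F + G) H = c *: ecup m n F H + ecup m n G H.
Proof. by rewrite /ecup !brace2M (scompPr _ _ _ _ _ aM) scompPl sgP. Qed.

Lemma ecupPr m n c F G H : arity m H ->
  ecup m n H (c *: F + G) = c *: ecup m n H F + ecup m n H G.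
Proof.
move=> aH; rewrite /ecup !brace2M -sgP.
by rewrite (scompPr (m := m.+1)) //; apply: (ar_c O) aM aH.
Qed.

Definition rz n (z : cocycles A n) := real (val z).

Lemma arity_rz n (z : cocycles A n) : arity n.+1 (rz z).
Proof. by have [] := cocycle_real charC (valP z). Qed.

Lemma dd_rz n (z : cocycles A n) : dd n.+1 (rz z) = 0.
Proof. by have [] := cocycle_real charC (valP z). Qed.

Lemma rzP n c (z w : cocycles A n) : rz (c *: z + w) = c *: rz z + rz w.
Proof. by rewrite /rz val_cocyclesP realP. Qed.

Lemma rzN n (z : cocycles A n) : rz (- z) = - rz z.
Proof. by rewrite /rz raddfN realN. Qed.

Lemma rzD n (z w : cocycles A n) : rz (z + w) = rz z + rz w.
Proof. by rewrite /rz raddfD realD. Qed.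

Lemma rz_sign n k (z : cocycles A n) : rz ((-1) ^+ k *: z) = sg (odd k) (rz z).
Proof. by rewrite /rz -real_sign -[_ *: z]addr0 val_cocyclesP val_cocycles0 addr0. Qed.

Lemma class_eq n (z w : cocycles A n) :
  HHclass z = HHclass w <-> exists2 F, arity n F & rz z - rz w = dd n F.
Proof.
by split=> [/HHclassP/(coboundaryE charC)|h]; last apply/HHclassP/(coboundaryE charC);
  rewrite realB.
Qed.

Lemma class_real n (z w : cocycles A n) : rz z = rz w -> HHclass z = HHclass w.
Proof. by move=> /(real_inj charC)/val_inj ->. Qed.

Lemma class_boundary n (z w : cocycles A n) b F : arity n F ->
  rz z = rz w + sg b (dd n F) -> HHclass z = HHclass w.
Proof.
move=> aF e; apply/class_eq; exists (sg b F); first exact: (ar_sg O).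
by rewrite e addrC addKr (dd_sg O aM).
Qed.

Lemma class_opp n (z : cocycles A n) : HHclass (- z) = - HHclass z.
Proof. exact: raddfN. Qed.

Lemma class_scale n c (z : cocycles A n) : HHclass (c *: z) = c *: HHclass z.
Proof. exact: HHclassZ. Qed.

Lemma class_repr n (z : cocycles A n) :
  exists2 F, arity n F & rz (repr (HHclass z)) - rz z = dd n F.
Proof. by apply/class_eq; rewrite {1}/HHclass reprK. Qed.

Section Cup.
Variables (i j k : nat).
Hypothesis e : (i.+1 + j.+1 = k.+1)%N.

Let ek : k = (i.+1 + j)%N. Proof. by lia. Qed.
Let ek' : k = (i + j.+1)%N. Proof. by lia. Qed.

Lemma cup_cocycle (f : cocycles A i) (g : cocycles A j) :
  cochain_cup k (val f) (val g) \in @cocycle C A k.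
Proof.
have af := arity_rz f; have ag := arity_rz g.
apply: (real_cocycle charC).
  rewrite (real_cup charC (arity_cochain charC af) (arity_cochain charC ag) ek).
  by apply: (ar_ecup O aM) => //; lia.
rewrite (real_cup charC (arity_cochain charC af) (arity_cochain charC ag) ek).
rewrite (dd_ecup O aM MM _ af ag); last by lia.
by rewrite !dd_rz (ecup0l O aM) (ecup0r O aM) // sg0 addr0.
Qed.

Definition cupz f g : cocycles A k := Cocycle (cup_cocycle f g).

Lemma rz_cup f g : rz (cupz f g) = ecup i.+1 j.+1 (rz f) (rz g).
Proof.
exact: (real_cup charC (arity_cochain charC (arity_rz f))
  (arity_cochain charC (arity_rz g)) ek).
Qed.

(** Representatives are chosen here; [HHcupE] shows that the choice is irrelevant. *)
Definition HHcup (x : HH A i) (y : HH A j) : HH A k := HHclass (cupz (repr x) (repr y)).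

Lemma HHcupE f g : HHcup (HHclass f) (HHclass g) = HHclass (cupz f g).
Proof.
have [F aF ef] := class_repr f; have [G aG eg] := class_repr g.
have af := arity_rz f; have ag := arity_rz (repr (HHclass g)).
apply/class_eq; rewrite !rz_cup.
eexists; last exact: (ecup_boundary O aM MM af aF ag aG ek' (dd_rz f) (dd_rz _) ef eg).
apply: (arD O); first exact: (ar_ecup O aM ek' aF ag).
by apply: (ar_sg O); apply: (ar_ecup O aM ek af aG).
Qed.

End Cup.

Section Bracket.
Variables (i j k : nat).
Hypothesis e : (i.+1 + j.+1 = k.+2)%N.

Let ek : k = (i + j)%N. Proof. by lia. Qed.
Let ek1 : k.+1 = (i.+1 + j)%N. Proof. by lia. Qed.
Let ek2 : k.+1 = (j.+1 + i)%N. Proof. by lia. Qed.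

Lemma bracket_cocycle (f : cocycles A i) (g : cocycles A j) :
  cochain_bracket k (val f) (val g) \in @cocycle C A k.
Proof.
have af := arity_rz f; have ag := arity_rz g.
have E := real_bracket (arity_cochain charC af) (arity_cochain charC ag) ek.
apply: (real_cocycle charC); rewrite E; first exact: (ar_ebr O (esym e) af ag).
by apply: (ebr_cocycle O aM af ag _ (esym e) (dd_rz f) (dd_rz g)).
Qed.

Definition brz f g : cocycles A k := Cocycle (bracket_cocycle f g).

Lemma rz_br f g : rz (brz f g) = ebr i.+1 j.+1 (rz f) (rz g).
Proof.
exact: (real_bracket (arity_cochain charC (arity_rz f))
  (arity_cochain charC (arity_rz g)) ek).
Qed.

Definition HHbr (x : HH A i) (y : HH A j) : HH A k := HHclass (brz (repr x) (repr y)).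

Lemma HHbrE f g : HHbr (HHclass f) (HHclass g) = HHclass (brz f g).
Proof.
have [F aF ef] := class_repr f; have [G aG eg] := class_repr g.
have af := arity_rz f; have ag := arity_rz (repr (HHclass g)).
apply/class_eq; rewrite !rz_br.
eexists; last exact: (ebr_boundary O aM af aF ag aG ek (dd_rz f) (dd_rz _) ef eg).
apply: (arB O); first exact: (ar_ebr O ek1 af aG).
by apply: (ar_sg O); apply: (ar_ebr O ek2 ag aF).
Qed.

End Bracket.

Lemma gerstenhaber_HH :
  is_gerstenhaber (fun i j k e => @HHcup i j k e) (fun i j k e => @HHbr i j k e).
Proof.
split.
- move=> i j k e b c a a'; have [f ->] := HHclass_surj a.
  have [f' ->] := HHclass_surj a'; have [g ->] := HHclass_surj b.
  rewrite -class_scale -HHclassD !HHcupE -class_scale -HHclassD.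
  by apply: class_real; rewrite rzP !rz_cup rzP ecupPl.
- move=> i j k e a c b b'; have [f ->] := HHclass_surj a.
  have [g ->] := HHclass_surj b; have [g' ->] := HHclass_surj b'.
  rewrite -class_scale -HHclassD !HHcupE -class_scale -HHclassD.
  by apply: class_real; rewrite rzP !rz_cup rzP ecupPr //; apply: arity_rz.
- move=> i j k e b c a a'; have [f ->] := HHclass_surj a.
  have [f' ->] := HHclass_surj a'; have [g ->] := HHclass_surj b.
  rewrite -class_scale -HHclassD !HHbrE -class_scale -HHclassD.
  by apply: class_real; rewrite rzP !rz_br rzP ebrPl //; apply: arity_rz.
- move=> i j k e a c b b'; have [f ->] := HHclass_surj a.
  have [g ->] := HHclass_surj b; have [g' ->] := HHclass_surj b'.
  rewrite -class_scale -HHclassD !HHbrE -class_scale -HHclassD.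
  by apply: class_real; rewrite rzP !rz_br rzP ebrPr //; apply: arity_rz.
- move=> i j l ij jl k e1 e2 e3 e4 a b c.
  have [f ->] := HHclass_surj a; have [g ->] := HHclass_surj b; have [h ->] := HHclass_surj c.
  rewrite !HHcupE; apply: class_real; rewrite !rz_cup.
  exact: (ecup_assoc O aM MM (arity_rz f) (arity_rz g) (arity_rz h) (esym e1) (esym e3)).
- move=> i j k e e' a b; have [f ->] := HHclass_surj a; have [g ->] := HHclass_surj b.
  rewrite !HHcupE -class_scale.
  (* The homotopy f•g of [ecup_comm], one degree below the cup product. *)
  have aB : arity k (bul scomp i.+1 j.+1 (rz f) (rz g)).
    exact: (ar_bul O (esym e) (arity_rz f) (arity_rz g)).
  apply: (class_boundary (b := odd j.+1) aB); rewrite rz_sign !rz_cup oddM.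
  by apply: (ecup_comm O aM (arity_rz f) (arity_rz g) _ (esym e) (dd_rz f) (dd_rz g)).
- move=> i j k e e' a b; have [f ->] := HHclass_surj a; have [g ->] := HHclass_surj b.
  rewrite !HHbrE -class_scale -class_opp; apply: class_real.
  by rewrite rzN rz_sign !rz_br ebr_anti oddM /= !negbK.
- move=> i j l ij jl il k e1 e2 e3 e4 e5 e6 a b c.
  have [f ->] := HHclass_surj a; have [g ->] := HHclass_surj b; have [h ->] := HHclass_surj c.
  rewrite !HHbrE -class_scale -HHclassD; apply: class_real.
  rewrite rzD rz_sign !rz_br.
  rewrite (jacobi O (arity_rz f) (arity_rz g) (arity_rz h) _ _ _
    (esym e3) (esym e1) (esym e5)) //.
  by rewrite oddM /= !negbK.
- move=> i j l ij il jl k e1 e2 e3 e4 e5 e6 a b c.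
  have [f ->] := HHclass_surj a; have [g ->] := HHclass_surj b; have [h ->] := HHclass_surj c.
  rewrite !(HHbrE, HHcupE) -class_scale -HHclassD.
  have eq : k.+2 = (i.+1 + j.+1 + l.+1)%N by rewrite e1 e2.
  have [s E] := poisson O aM (arity_rz f) (arity_rz g) (arity_rz h) (ltn0Sn l) eq
    (esym e1) (dd_rz f) (dd_rz g) (dd_rz h).
  (* The homotopy h{f,g} of [poisson], one degree below the identity. *)
  have aB : arity k (brace2 scomp l.+1 i.+1 j.+1 (rz h) (rz f) (rz g)).
    by apply: (ar_brace2 O _ (arity_rz h) (arity_rz f) (arity_rz g)); rewrite eq; lia.
  apply: (class_boundary (b := s) aB); rewrite rzD rz_sign.
  rewrite rz_br rz_cup E !rz_cup !rz_br e3 e5 /=.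
  by rewrite oddM /= !negbK.
Qed.

End Cohomology.

Theorem theorem5p4 (C : closedFieldType) (charC : [pchar C] =i pred0)
    (A : assocConformalType C) :
  exists (cup : cup_op (HH A)) (br : bracket_op (HH A)),
    [/\ is_induced_cup cup, is_induced_bracket br & is_gerstenhaber cup br].
Proof.
exists (fun i j k e => @HHcup C A charC i j k e).
exists (fun i j k e => @HHbr C A charC i j k e); split.
- by move=> i j k e f g; exists (cupz charC e f g); split=> //; apply: HHcupE.
- by move=> i j k e f g; exists (brz charC e f g); split=> //; apply: HHbrE.
- exact: gerstenhaber_HH.
Qed.
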